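(* Let $H$ be a coquasi-Hopf algebra with bijective antipode and $A$ a right $H$-comodule algebra which is left faithfully flat and Galois over $B=A^{coH}$. Then the $B\otimes B^{op}$-algebra $L=(A\otimes A^{op})^{coH}$ (with its twisted multiplication, defined in the context) is a $\times_B$-bialgebra in the sense of Takeuchi, equivalently a (left) bialgebroid over $B$.
   Context: Everything is over a field $k$; $\otimes=\otimes_k$. Sweedler notation: $\Delta(h)=h_1\otimes h_2$ (summation suppressed); for a right comodule, $\rho(m)=m_0\otimes m_1$, iterated as $m_0\otimes m_1\otimes m_2$, etc. A coquasi-bialgebra is a coassociative counital coalgebra $(H,\Delta,\varepsilon)$ with coalgebra morphisms $H\otimes H\to H$, $h\otimes g\mapsto hg$, and $k\to H$, $1\mapsto 1_H$, and a convolution invertible $\omega\in(H\otimes H\otimes H)^*$ such that for all $h,g,x,y\in H$: $h_1(g_1x_1)\omega(h_2,g_2,x_2)=\omega(h_1,g_1,x_1)(h_2g_2)x_2$; $1_Hh=h1_H=h$; $\omega(h_1,g_1,x_1y_1)\omega(h_2g_2,x_2,y_2)=\omega(g_1,x_1,y_1)\omega(h_1,g_2x_2,y_2)\omega(h_2,g_3,x_3)$; $\omega(h,1_H,g)=\varepsilon(h)\varepsilon(g)$. A coquasi-Hopf algebra is a coquasi-bialgebra with a coalgebra antihomomorphism $S:H\to H$ (antipode) and $\alpha,\beta\in H^*$ such that $S(h_1)\alpha(h_2)h_3=\alpha(h)1_H$, $h_1\beta(h_2)S(h_3)=\beta(h)1_H$, $\omega(h_1\beta(h_2),S(h_3),\alpha(h_4)h_5)=\omega^{-1}(S(h_1),\alpha(h_2)h_3\beta(h_4),S(h_5))=\varepsilon(h)$.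 The triple $(S,\alpha,\beta)$ is fixed and normalized by $\alpha(1_H)=\beta(1_H)=1$. A right $H$-comodule algebra is a right $H$-comodule $A$ with a multiplication and an element $1_A$ such that $\rho(ab)=a_0b_0\otimes a_1b_1$, $\rho(1_A)=1_A\otimes 1_H$, $1_Aa=a=a1_A$, $(ab)c=a_0(b_0c_0)\omega(a_1,b_1,c_1)$. $B=A^{coH}=\{a\in A:\rho(a)=a\otimes 1_H\}$ is an associative unital algebra, and $A$ is a $B$-bimodule by multiplication. ''Left faithfully flat over $B$'' means faithfully flat as a left $B$-module. ''Galois over $B$'' means that $can:A\otimes_BA\to A\otimes H$, $can(a\otimes_Bb)=a_0b_0\otimes b_4\,\omega^{-1}(a_1,b_1\beta(b_2),S(b_3))$, is bijective. $L=\{\sum a\otimes b\in A\otimes A:\ \sum a_0\otimes b_0\otimes a_1b_1=\sum a\otimes b\otimes1_H\}$, an associative algebra with unit $1_A\otimes1_A$ and multiplication $(a\otimes b)(c\otimes d)=a_0c_0\otimes d_0b_0\,\omega^{-1}(a_1,c_1,d_1b_1)\omega(c_2,d_2,b_2)$ (products in $A$, summations suppressed). It is a $B\otimes B^{op}$-algebra through the algebra maps $s:B\to L$, $s(b)=b\otimes1_A$ and $t:B^{op}\to L$, $t(b)=1_A\otimes b$, whose images commute. That $L$ is a (left) bialgebroid over $B$, or $\times_B$-bialgebra, means: with $L$ regarded as a $B$-bimodule by $b\cdot l\cdot b'=s(b)t(b')l$, there are $B$-bimodule maps $\Delta_L:L\to L\otimes_BL$ and $\varepsilon_L:L\to B$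 making $L$ a $B$-coring such that: the image of $\Delta_L$ lies in $L\times_BL=\{\sum x\otimes_By:\ \sum xt(b)\otimes_By=\sum x\otimes_Bys(b)\ \forall b\in B\}$; $\Delta_L:L\to L\times_BL$ is a unital algebra map for the factorwise product; $\varepsilon_L(1)=1$; and $\varepsilon_L(xy)=\varepsilon_L(x\,s(\varepsilon_L(y)))=\varepsilon_L(x\,t(\varepsilon_L(y)))$ for all $x,y\in L$. Equivalently, ${}_L\mathcal{M}$ has a monoidal structure for which the forgetful functor ${}_L\mathcal{M}\to{}_B\mathcal{M}_B$ is strictly monoidal. *)

(* Defs.v *)
From HB Require Import structures.
From mathcomp Require Import all_boot all_algebra.
From mathcomp Require Import boolp.

Set Implicit Arguments.
Unset Strict Implicit.
Unset Printing Implicit Defensive.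

Import GRing.Theory.
Local Open Scope ring_scope.
Local Open Scope quotient_scope.

(* Balanced tensor products of abelian groups.  [ra] is a right action of the *)
(* scalars [I] on [M] and [la] a left action of [I] on [N].  The group        *)
(* [btens ra la] consists of the formal sums \sum_i m_i (x) n_i, two of them  *)
(* being identified when every balanced map takes the same value on both;     *)
(* [btensor_lift] and [btensP] below give its universal property.             *)
Section BalancedTensor.
Variables (M N : zmodType) (I : Type) (ra : I -> M -> M) (la : I -> N -> N).

Record balanced (V : zmodType) (f : M -> N -> V) : Prop := Balanced {
  balDl : forall m m' n, f (m + m') n = f m n + f m' n;
  balDr : forall m n n', f m (n + n') = f m n + f m n';
  balM : forall i m n, f (ra i m) n = f m (la i n)
}.

Definition formal_eval (V : zmodType) (f : M -> N -> V) (s : seq (M * N)) : V :=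
  \sum_(p <- s) f p.1 p.2.

Definition formal_eq (s1 s2 : seq (M * N)) : Prop :=
  forall (V : zmodType) (f : M -> N -> V),
    balanced f -> formal_eval f s1 = formal_eval f s2.

Definition formal_eqb : rel (seq (M * N)) := fun s1 s2 => `[< formal_eq s1 s2 >].

Lemma formal_eqb_equiv : equiv_class_of formal_eqb.
Proof.
split=> [s|s1 s2|s2 s1 s3].
- exact/asboolP.
- by apply/asboolP/asboolP => e V f fB; rewrite (e V f fB).
- move=> /asboolP e1 /asboolP e2; apply/asboolP => V f fB.
  by rewrite (e1 V f fB) (e2 V f fB).
Qed.

Canonical formal_equiv := EquivRelPack formal_eqb_equiv.
Canonical formal_encModRel := defaultEncModRel formal_eqb.

Definition btens : Type := {eq_quot formal_eqb}.
HB.instance Definition _ := Choice.on btens.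
HB.instance Definition _ := EqQuotient.on btens.

Definition btens_class (s : seq (M * N)) : btens := \pi_btens s.
Definition bpure (m : M) (n : N) : btens := btens_class [:: (m, n)].

(* The value at [t] of the map m (x) n |-> f m n, computed on a chosen        *)
(* decomposition of [t] into pure tensors; for balanced [f] the choice is     *)
(* immaterial ([btensor_lift_class]).                                         *)
Definition btensor_lift (V : zmodType) (f : M -> N -> V) (t : btens) : V :=
  formal_eval f (repr t).

Lemma formal_eval_cat (V : zmodType) (f : M -> N -> V) s1 s2 :
  formal_eval f (s1 ++ s2) = formal_eval f s1 + formal_eval f s2.
Proof. by rewrite /formal_eval big_cat. Qed.

Lemma btens_class_eq s1 s2 : formal_eq s1 s2 -> btens_class s1 = btens_class s2.
Proof. by move=> e; apply/eqmodP/asboolP. Qed.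

Lemma btensor_lift_class (V : zmodType) (f : M -> N -> V) s :
  balanced f -> btensor_lift f (btens_class s) = formal_eval f s.
Proof.
move=> fB; have /eqmodP/asboolP e : repr (btens_class s) = s %[mod btens].
  by rewrite reprK.
exact: e.
Qed.

Lemma bal0l (V : zmodType) (f : M -> N -> V) n : balanced f -> f 0 n = 0.
Proof. by move=> fB; apply: (addIr (f 0 n)); rewrite -(balDl fB) !add0r. Qed.

Lemma balNl (V : zmodType) (f : M -> N -> V) m n : balanced f -> f (- m) n = - f m n.
Proof.
by move=> fB; apply/eqP; rewrite -addr_eq0 -(balDl fB) addNr (bal0l n fB).
Qed.

Definition btens_add (x y : btens) : btens := btens_class (repr x ++ repr y).
Definition btens_opp (x : btens) : btens :=
  btens_class [seq (- p.1, p.2) | p <- repr x].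

Lemma btens_addE s1 s2 :
  btens_add (btens_class s1) (btens_class s2) = btens_class (s1 ++ s2).
Proof.
apply: btens_class_eq => V f fB; rewrite !formal_eval_cat.
by rewrite -/(btensor_lift f _) -/(btensor_lift f _) !btensor_lift_class.
Qed.

Lemma btens_ind (P : btens -> Prop) : (forall s, P (btens_class s)) -> forall x, P x.
Proof. by move=> Ps x; rewrite -[x]reprK; apply: Ps. Qed.

Lemma btens_addA : associative btens_add.
Proof.
move=> x y z; elim/btens_ind: x => x; elim/btens_ind: y => y.
by elim/btens_ind: z => z; rewrite !btens_addE catA.
Qed.

Lemma btens_addC : commutative btens_add.
Proof.
move=> x y; apply: btens_class_eq => V f _.
by rewrite !formal_eval_cat addrC.
Qed.

Lemma btens_add0 : left_id (btens_class [::]) btens_add.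
Proof. by move=> x; elim/btens_ind: x => x; rewrite btens_addE. Qed.

Lemma btens_addN : left_inverse (btens_class [::]) btens_opp btens_add.
Proof.
move=> x; rewrite -{2}[x]reprK -/(btens_class _) /btens_opp btens_addE.
apply: btens_class_eq => V f fB.
rewrite formal_eval_cat /formal_eval big_map big_nil -big_split big1 // => p _.
by rewrite /= (balNl _ _ fB) addNr.
Qed.

HB.instance Definition _ :=
  GRing.isZmodule.Build btens btens_addA btens_addC btens_add0 btens_addN.

Lemma btens_class_cat s1 s2 :
  btens_class (s1 ++ s2) = btens_class s1 + btens_class s2.
Proof. by rewrite -btens_addE. Qed.

Lemma btens_classE s : btens_class s = \sum_(p <- s) bpure p.1 p.2.
Proof.
elim: s => [|[m n] s IH]; first by rewrite big_nil.
by rewrite big_cons -IH -cat1s btens_class_cat.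
Qed.

Lemma btensP (t : btens) : exists s : seq (M * N), t = \sum_(p <- s) bpure p.1 p.2.
Proof. by exists (repr t); rewrite -btens_classE /btens_class reprK. Qed.

Lemma bpure_balanced : balanced bpure.
Proof.
split=> [m m' n|m n n'|i m n].
- rewrite -btens_class_cat; apply: btens_class_eq => V f fB.
  by rewrite /formal_eval !big_cons !big_nil /= !addr0 (balDl fB).
- rewrite -btens_class_cat; apply: btens_class_eq => V f fB.
  by rewrite /formal_eval !big_cons !big_nil /= !addr0 (balDr fB).
- apply: btens_class_eq => V f fB.
  by rewrite /formal_eval !big_cons !big_nil /= !addr0 (balM fB).
Qed.

Lemma btensor_lift_pure (V : zmodType) (f : M -> N -> V) m n :
  balanced f -> btensor_lift f (bpure m n) = f m n.
Proof.
by move=> fB; rewrite btensor_lift_class // /formal_eval big_seq1.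
Qed.

Lemma btensor_liftD (V : zmodType) (f : M -> N -> V) :
  balanced f -> {morph btensor_lift f : x y / x + y}.
Proof.
move=> fB x y; elim/btens_ind: x => x; elim/btens_ind: y => y.
by rewrite -btens_class_cat !btensor_lift_class // formal_eval_cat.
Qed.

End BalancedTensor.

Section Tensor.
Variables (k : comPzRingType) (M N : lmodType k).

Definition tens : Type := btens (fun (a : k) (m : M) => a *: m) (fun (a : k) (n : N) => a *: n).
HB.instance Definition _ := GRing.Zmodule.on tens.

Definition pure (m : M) (n : N) : tens := bpure _ _ m n.

Definition bilinear_map (V : lmodType k) (f : M -> N -> V) : Prop :=
  (forall n, linear (fun m => f m n)) /\ (forall m, linear (f m)).

Lemma tens_scale_balanced (a : k) :
  @balanced M N k *:%R *:%R tens (fun m n => pure (a *: m) n).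
Proof.
have [pDl pDr pM] := @bpure_balanced M N k *:%R *:%R.
split=> [m m' n|m n n'|b m n] /=.
- by rewrite scalerDr; apply: pDl.
- exact: pDr.
- by rewrite scalerA mulrC -scalerA; apply: pM.
Qed.

Definition tens_scale (a : k) (t : tens) : tens :=
  btensor_lift (fun m n => pure (a *: m) n) t.

Lemma tens_scaleD a : {morph tens_scale a : x y / x + y}.
Proof. exact: btensor_liftD (tens_scale_balanced a). Qed.

Lemma tens_scale_pure a m n : tens_scale a (pure m n) = pure (a *: m) n.
Proof. exact: (btensor_lift_pure _ _ (tens_scale_balanced a)). Qed.

Lemma tens_ext (V : zmodType) (f g : tens -> V) :
  {morph f : x y / x + y} -> {morph g : x y / x + y} ->
  (forall m n, f (pure m n) = g (pure m n)) -> forall t, f t = g t.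
Proof.
move=> fD gD fg t.
have z0 (h : tens -> V) : {morph h : x y / x + y} -> h 0 = 0.
  by move=> hD; apply: (addIr (h 0)); rewrite -hD !add0r.
have [s ->] := btensP t.
elim: s => [|[m n] s IH]; first by rewrite big_nil !z0.
by rewrite big_cons fD gD IH; congr (_ + _); apply: fg.
Qed.

Lemma tens_scaleA a b t : tens_scale a (tens_scale b t) = tens_scale (a * b) t.
Proof.
move: t; apply: tens_ext; first by move=> x y; rewrite !tens_scaleD.
  exact: tens_scaleD.
by move=> m n; rewrite !tens_scale_pure scalerA.
Qed.

Lemma tens_scale1 : left_id 1 tens_scale.
Proof.
apply: tens_ext => //; first exact: tens_scaleD.
by move=> m n; rewrite tens_scale_pure scale1r.
Qed.

Lemma tens_scaleDl t : {morph tens_scale^~ t : a b / a + b}.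
Proof.
move=> a b; move: t; apply: tens_ext; first exact: tens_scaleD.
  by move=> x y; rewrite !tens_scaleD addrACA.
move=> m n; rewrite !tens_scale_pure scalerDl.
by have [pDl _ _] := @bpure_balanced M N k *:%R *:%R; apply: pDl.
Qed.

HB.instance Definition _ := GRing.Zmodule_isLmodule.Build k tens
  tens_scaleA tens_scale1 tens_scaleD tens_scaleDl.

Lemma pureDl m m' n : pure (m + m') n = pure m n + pure m' n.
Proof. by have [pDl _ _] := @bpure_balanced M N k *:%R *:%R; apply: pDl. Qed.

Lemma pureDr m n n' : pure m (n + n') = pure m n + pure m n'.
Proof. by have [_ pDr _] := @bpure_balanced M N k *:%R *:%R; apply: pDr. Qed.

Lemma pureZl a m n : pure (a *: m) n = a *: pure m n.
Proof. by rewrite -tens_scale_pure. Qed.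

Lemma pureZr a m n : pure m (a *: n) = a *: pure m n.
Proof.
by rewrite -pureZl; have [_ _ pM] := @bpure_balanced M N k *:%R *:%R; rewrite /pure -pM.
Qed.

Lemma pure0l n : pure 0 n = 0.
Proof. by rewrite -{1}(scale0r (0 : M)) pureZl scale0r. Qed.

Lemma pureBl m m' n : pure (m - m') n = pure m n - pure m' n.
Proof. by rewrite pureDl -scaleN1r pureZl scaleN1r. Qed.

Lemma bilinear_balanced (V : lmodType k) (f : M -> N -> V) :
  bilinear_map f -> @balanced M N k *:%R *:%R V f.
Proof.
move=> [fl fr]; split=> [m m' n|m n n'|a m n].
- by have := fl n 1 m m'; rewrite !scale1r.
- by have := fr m 1 n n'; rewrite !scale1r.
- have e0l : f 0 n = 0.
    by have := fl n 1 0 0; rewrite !scale1r addr0 => /(canLR (addrK _)); rewrite subrr.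
  have e0r : f m 0 = 0.
    by have := fr m 1 0 0; rewrite !scale1r addr0 => /(canLR (addrK _)); rewrite subrr.
  have := fl n a m 0; have := fr m a n 0.
  by rewrite !addr0 e0l e0r !addr0 => -> ->.
Qed.

Lemma lift_linear (V : lmodType k) (f : M -> N -> V) :
  bilinear_map f -> linear (btensor_lift f : tens -> V).
Proof.
move=> fB; have fb := bilinear_balanced fB; have fD := btensor_liftD fb.
move=> a t t'; rewrite fD; congr (_ + _); move: t; apply: tens_ext.
- by move=> x y; rewrite scalerDr fD.
- by move=> x y; rewrite fD scalerDr.
move=> m n; rewrite -pureZl !(btensor_lift_pure _ _ fb).
have := fB.1 n a m 0; rewrite addr0 => ->.
by rewrite (bal0l _ fb) addr0.
Qed.

End Tensor.

Notation "M \ot N" := (tens M N) (at level 40, left associativity) : type_scope.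
Notation "m \ot n" := (pure m n) (at level 40, left associativity) : ring_scope.

(* [\Te_(x, y <- t) E] is Sweedler-style summation over t = \sum x (x) y.  The  *)
(* tensor comes first so that its type determines those of the bound variables. *)
Definition sweedler (M N : zmodType) (I : Type) (ra : I -> M -> M) (la : I -> N -> N)
    (V : zmodType) (t : btens ra la) (f : M -> N -> V) : V := btensor_lift f t.

Notation "'\Te_' ( x , y <- t ) E" :=
  (sweedler t (fun x y => E))
  (at level 41, x name, y name, E at level 41,
   format "'[' '\Te_' ( x ,  y  <-  t ) '/  '  E ']'") : ring_scope.

(* A right R-module is an [lmodType R^c]. *)
Section FaithfullyFlat.
Variables (R : pzRingType).

Definition rtens (M : lmodType R^c) (N : lmodType R) : Type :=
  btens (fun (r : R) (m : M) => (r : R^c) *: m) (fun (r : R) (n : N) => r *: n).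
HB.instance Definition _ M N := GRing.Zmodule.on (@rtens M N).

Definition rtens_map (M M' : lmodType R^c) (N : lmodType R)
    (f : {linear M -> M'}) (t : rtens M N) : rtens M' N :=
  \Te_(m, n <- t) bpure _ _ (f m) n.

Definition exact (U V W : zmodType) (f : U -> V) (g : V -> W) : Prop :=
  forall v, g v = 0 <-> exists u, f u = v.

Definition faithfully_flat (N : lmodType R) : Prop :=
  forall (M1 M2 M3 : lmodType R^c) (f : {linear M1 -> M2}) (g : {linear M2 -> M3}),
    exact f g <-> exact (rtens_map (N := N) f) (rtens_map (N := N) g).

End FaithfullyFlat.

Record coalgebra (k : fieldType) := Coalgebra {
  coalg_sort :> lmodType k;
  Delta : {linear coalg_sort -> (coalg_sort \ot coalg_sort)%type};
  counit : {linear coalg_sort -> k^o};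
  Delta_coassoc : forall h : coalg_sort,
    \Te_(h1, h2 <- Delta h) h1 \ot Delta h2 =
    \Te_(h', h3 <- Delta h) \Te_(h1, h2 <- Delta h') h1 \ot (h2 \ot h3);
  counitl : forall h : coalg_sort, \Te_(h1, h2 <- Delta h) counit h1 *: h2 = h;
  counitr : forall h : coalg_sort, \Te_(h1, h2 <- Delta h) counit h2 *: h1 = h
}.

Arguments Delta {k c}.
Arguments counit {k c}.

Notation "'\De_' ( h1 , h2 <- h ) E" :=
  (sweedler (Delta h) (fun h1 h2 => E))
  (at level 41, h1 name, h2 name, E at level 41,
   format "'[' '\De_' ( h1 ,  h2  <-  h ) '/  '  E ']'") : ring_scope.
Notation "'\De_' ( h1 , h2 , h3 <- h ) E" :=
  (sweedler (Delta h) (fun h1 h' => \De_(h2, h3 <- h') E))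
  (at level 41, h1 name, h2 name, h3 name, E at level 41,
   format "'[' '\De_' ( h1 ,  h2 ,  h3  <-  h ) '/  '  E ']'") : ring_scope.
Notation "'\De_' ( h1 , h2 , h3 , h4 <- h ) E" :=
  (sweedler (Delta h) (fun h1 h' => \De_(h2, h3, h4 <- h') E))
  (at level 41, h1 name, h2 name, h3 name, h4 name, E at level 41,
   format "'[' '\De_' ( h1 ,  h2 ,  h3 ,  h4  <-  h ) '/  '  E ']'") : ring_scope.
Notation "'\De_' ( h1 , h2 , h3 , h4 , h5 <- h ) E" :=
  (sweedler (Delta h) (fun h1 h' => \De_(h2, h3, h4, h5 <- h') E))
  (at level 41, h1 name, h2 name, h3 name, h4 name, h5 name, E at level 41,
   format "'[' '\De_' ( h1 ,  h2 ,  h3 ,  h4 ,  h5  <-  h ) '/  '  E ']'") : ring_scope.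

Definition dual3 (k : fieldType) (H : lmodType k)
    (f : {linear (H \ot (H \ot H))%type -> k^o}) (h g x : H) : k :=
  f (h \ot (g \ot x)).

Record coquasiBialgebra (k : fieldType) := CoquasiBialgebra {
  coquasi_coalg :> coalgebra k;
  hmul_lin : {linear (coquasi_coalg \ot coquasi_coalg)%type -> coquasi_coalg};
  hone : coquasi_coalg;
  omega_lin : {linear (coquasi_coalg \ot (coquasi_coalg \ot coquasi_coalg))%type -> k^o};
  omegai_lin : {linear (coquasi_coalg \ot (coquasi_coalg \ot coquasi_coalg))%type -> k^o};
  hmul := fun h g : coquasi_coalg => hmul_lin (h \ot g);
  omega := dual3 omega_lin;
  omegai := dual3 omegai_lin;
  Delta_mul : forall h g : coquasi_coalg,
    Delta (hmul h g) =
    \De_(h1, h2 <- h) \De_(g1, g2 <- g) hmul h1 g1 \ot hmul h2 g2;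
  counit_mul : forall h g : coquasi_coalg, counit (hmul h g) = counit h * counit g;
  Delta_one : Delta hone = hone \ot hone;
  counit_one : counit hone = 1;
  omega_mulVr : forall h g x : coquasi_coalg,
    \De_(h1, h2 <- h) \De_(g1, g2 <- g) \De_(x1, x2 <- x)
      (omega h1 g1 x1 * omegai h2 g2 x2) =
    counit h * counit g * counit x;
  omega_mulVl : forall h g x : coquasi_coalg,
    \De_(h1, h2 <- h) \De_(g1, g2 <- g) \De_(x1, x2 <- x)
      (omegai h1 g1 x1 * omega h2 g2 x2) =
    counit h * counit g * counit x;
  hmul_quasiA : forall h g x : coquasi_coalg,
    \De_(h1, h2 <- h) \De_(g1, g2 <- g) \De_(x1, x2 <- x)
      omega h2 g2 x2 *: hmul h1 (hmul g1 x1) =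
    \De_(h1, h2 <- h) \De_(g1, g2 <- g) \De_(x1, x2 <- x)
      omega h1 g1 x1 *: hmul (hmul h2 g2) x2;
  hmul1h : forall h : coquasi_coalg, hmul hone h = h;
  hmulh1 : forall h : coquasi_coalg, hmul h hone = h;
  omega_cocycle : forall h g x y : coquasi_coalg,
    \De_(h1, h2 <- h) \De_(g1, g2 <- g) \De_(x1, x2 <- x) \De_(y1, y2 <- y)
      (omega h1 g1 (hmul x1 y1) * omega (hmul h2 g2) x2 y2) =
    \De_(h1, h2 <- h) \De_(g1, g2, g3 <- g) \De_(x1, x2, x3 <- x) \De_(y1, y2 <- y)
      (omega g1 x1 y1 * omega h1 (hmul g2 x2) y2 * omega h2 g3 x3);
  omega_unit : forall h g : coquasi_coalg, omega h hone g = counit h * counit g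
}.

Arguments omega {k c}.
Arguments omegai {k c}.
Arguments hone {k c}.

Record coquasiHopf (k : fieldType) := CoquasiHopf {
  hopf_bialg :> coquasiBialgebra k;
  antipode : {linear hopf_bialg -> hopf_bialg};
  alpha : {linear hopf_bialg -> k^o};
  beta : {linear hopf_bialg -> k^o};
  Delta_antipode : forall h : hopf_bialg,
    Delta (antipode h) = \De_(h1, h2 <- h) antipode h2 \ot antipode h1;
  counit_antipode : forall h : hopf_bialg, counit (antipode h) = counit h;
  antipode_alpha : forall h : hopf_bialg,
    \De_(h1, h2, h3 <- h) alpha h2 *: hmul (antipode h1) h3 = alpha h *: (hone : hopf_bialg);
  antipode_beta : forall h : hopf_bialg,
    \De_(h1, h2, h3 <- h) beta h2 *: hmul h1 (antipode h3) = beta h *: (hone : hopf_bialg);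
  antipode_omega : forall h : hopf_bialg,
    \De_(h1, h2, h3, h4, h5 <- h)
      omega (beta h2 *: h1) (antipode h3) (alpha h4 *: h5) = counit h;
  antipode_omegai : forall h : hopf_bialg,
    \De_(h1, h2, h3, h4, h5 <- h)
      omegai (antipode h1) ((alpha h2 * beta h4) *: h3) (antipode h5) = counit h;
  alpha_one : alpha hone = 1;
  beta_one : beta hone = 1
}.

Arguments antipode {k c}.
Arguments alpha {k c}.
Arguments beta {k c}.

Record comoduleAlgebra (k : fieldType) (H : coquasiBialgebra k) := ComoduleAlgebra {
  comod_sort :> lmodType k;
  coact : {linear comod_sort -> (comod_sort \ot H)%type};
  amul_lin : {linear (comod_sort \ot comod_sort)%type -> comod_sort};
  aone : comod_sort;
  amul := fun a b : comod_sort => amul_lin (a \ot b);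
  coact_coassoc : forall a : comod_sort,
    \Te_(a0, h <- coact a) a0 \ot Delta h =
    \Te_(a', a2 <- coact a) \Te_(a0, a1 <- coact a') a0 \ot (a1 \ot a2);
  coact_counit : forall a : comod_sort, \Te_(a0, a1 <- coact a) counit a1 *: a0 = a;
  coact_mul : forall a b : comod_sort,
    coact (amul a b) =
    \Te_(a0, a1 <- coact a) \Te_(b0, b1 <- coact b) amul a0 b0 \ot hmul a1 b1;
  coact_one : coact aone = aone \ot hone;
  amul1a : forall a : comod_sort, amul aone a = a;
  amula1 : forall a : comod_sort, amul a aone = a;
  amul_quasiA : forall a b c : comod_sort,
    amul (amul a b) c =
    \Te_(a0, a1 <- coact a) \Te_(b0, b1 <- coact b) \Te_(c0, c1 <- coact c)
      omega a1 b1 c1 *: amul a0 (amul b0 c0)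
}.

Arguments coact {k H _}.
Arguments aone {k H _}.

Notation "'\Co_' ( a0 , a1 <- a ) E" :=
  (sweedler (coact a) (fun a0 a1 => E))
  (at level 41, a0 name, a1 name, E at level 41,
   format "'[' '\Co_' ( a0 ,  a1  <-  a ) '/  '  E ']'") : ring_scope.
Notation "'\Co_' ( a0 , a1 , a2 <- a ) E" :=
  (sweedler (coact a) (fun a0 h => \De_(a1, a2 <- h) E))
  (at level 41, a0 name, a1 name, a2 name, E at level 41,
   format "'[' '\Co_' ( a0 ,  a1 ,  a2  <-  a ) '/  '  E ']'") : ring_scope.
Notation "'\Co_' ( a0 , a1 , a2 , a3 <- a ) E" :=
  (sweedler (coact a) (fun a0 h => \De_(a1, a2, a3 <- h) E))
  (at level 41, a0 name, a1 name, a2 name, a3 name, E at level 41,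
   format "'[' '\Co_' ( a0 ,  a1 ,  a2 ,  a3  <-  a ) '/  '  E ']'") : ring_scope.
Notation "'\Co_' ( a0 , a1 , a2 , a3 , a4 <- a ) E" :=
  (sweedler (coact a) (fun a0 h => \De_(a1, a2, a3, a4 <- h) E))
  (at level 41, a0 name, a1 name, a2 name, a3 name, a4 name, E at level 41,
   format "'[' '\Co_' ( a0 ,  a1 ,  a2 ,  a3 ,  a4  <-  a ) '/  '  E ']'") : ring_scope.

Section SweedlerTheory.

Lemma sweedler_pure (k : comPzRingType) (M N V : lmodType k) (f : M -> N -> V) m n :
  bilinear_map f -> \Te_(x, y <- m \ot n) f x y = f m n.
Proof. by move=> /bilinear_balanced fB; apply: btensor_lift_pure. Qed.

Variables (M N : zmodType) (I : Type) (ra : I -> M -> M) (la : I -> N -> N).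

Lemma eq_sweedler (V : zmodType) (t : btens ra la) (f g : M -> N -> V) :
  (forall x y, f x y = g x y) -> sweedler t f = sweedler t g.
Proof. by move=> fg; apply: eq_bigr => p _; apply: fg. Qed.

Lemma sweedler_raddf (V W : zmodType) (g : {additive V -> W}) (t : btens ra la)
    (f : M -> N -> V) :
  g (sweedler t f) = sweedler t (fun x y => g (f x y)).
Proof. exact: raddf_sum. Qed.

Lemma sweedler_bilinear (k : comPzRingType) (U W V : lmodType k) (t : btens ra la)
    (F : U -> W -> M -> N -> V) :
  (forall x y, bilinear_map (fun u w => F u w x y)) ->
  bilinear_map (fun u w => sweedler t (F u w)).
Proof.
move=> FB; split=> [w|u] a x y; rewrite scaler_sumr -big_split;
  apply: eq_bigr => p _; have [Fl Fr] := FB p.1 p.2.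
  exact: Fl.
exact: Fr.
Qed.

End SweedlerTheory.

Section QuasiBialgebraTheory.
Variables (k : fieldType) (H : coquasiBialgebra k).
Implicit Types h g x : H.

Lemma hmul_bilinear : bilinear_map (@hmul k H).
Proof.
by split=> h a x y; rewrite /hmul ?pureDl ?pureDr ?pureZl ?pureZr linearP.
Qed.

Lemma omegaDZ1 a h h' g x : omega (a *: h + h') g x = a * omega h g x + omega h' g x.
Proof. by rewrite /omega /dual3 pureDl pureZl linearP. Qed.

Lemma omegaDZ2 a h g g' x : omega h (a *: g + g') x = a * omega h g x + omega h g' x.
Proof. by rewrite /omega /dual3 pureDl pureZl pureDr pureZr linearP. Qed.

Lemma omegaDZ3 a h g x x' : omega h g (a *: x + x') = a * omega h g x + omega h g x'.
Proof. by rewrite /omega /dual3 !pureDr !pureZr linearP. Qed.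

End QuasiBialgebraTheory.

Section Coinvariants.
Variables (k : fieldType) (H : coquasiBialgebra k) (A : comoduleAlgebra H).

Definition coinvariant : {pred A} := [pred a | `[< coact a = a \ot hone >]].

Lemma coinvariantP a : reflect (coact a = a \ot hone) (a \in coinvariant).
Proof. exact: asboolP. Qed.

Lemma coinvariant_zmod_closed : zmod_closed coinvariant.
Proof.
split=> [|a b /coinvariantP ca /coinvariantP cb]; apply/coinvariantP.
  by rewrite linear0 pure0l.
by rewrite linearB ca cb pureBl.
Qed.
HB.instance Definition _ := GRing.isZmodClosed.Build A coinvariant coinvariant_zmod_closed.

Record coinv : Type := Coinv { coinv_val :> A; coinv_valP : coinv_val \in coinvariant }.
HB.instance Definition _ := [isSub for coinv_val].
HB.instance Definition _ := [Choice of coinv by <:].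
HB.instance Definition _ := [SubChoice_isSubZmodule of coinv by <:].

Lemma coact_coinv (b : coinv) : coact (b : A) = (b : A) \ot hone.
Proof. exact/coinvariantP/coinv_valP. Qed.

Lemma amul_bilinear : bilinear_map (@amul k H A).
Proof.
by split=> h a x y; rewrite /amul ?pureDl ?pureDr ?pureZl ?pureZr linearP.
Qed.

Lemma amulDZl c a a' b : amul (c *: a + a') b = c *: amul a b + amul a' b :> A.
Proof. exact: (amul_bilinear.1 b c). Qed.

Lemma amulDZr c a b b' : amul a (c *: b + b') = c *: amul a b + amul a b' :> A.
Proof. exact: (amul_bilinear.2 a c). Qed.

Lemma amulDl a a' b : amul (a + a') b = amul a b + amul a' b :> A.
Proof. by rewrite -[a]scale1r amulDZl !scale1r. Qed.

Lemma amulDr a b b' : amul a (b + b') = amul a b + amul a b' :> A.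
Proof. by rewrite -[b]scale1r amulDZr !scale1r. Qed.

Lemma amulZr c a b : amul a (c *: b) = c *: amul a b :> A.
Proof. by rewrite /amul pureZr linearZ. Qed.

Lemma coinv_mul_subproof (b c : coinv) : amul b c \in coinvariant.
Proof.
apply/coinvariantP; rewrite coact_mul !coact_coinv.
have [hl hr] := hmul_bilinear H.
rewrite (sweedler_pure (f := fun a0 a1 => \Te_(b0, b1 <- (c : A) \ot hone)
   amul a0 b0 \ot hmul a1 b1)); last first.
  apply: sweedler_bilinear => x y; split=> [w|u] a z z'.
    by rewrite amulDZl pureDl pureZl.
  by rewrite hl pureDr pureZr.
rewrite (sweedler_pure (f := fun b0 b1 => amul (b : A) b0 \ot hmul hone b1)).
  by rewrite hmul1h.
split=> [w|u] a z z'; first by rewrite amulDZr pureDl pureZl.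
by rewrite hr pureDr pureZr.
Qed.

Definition coinv_mul (b c : coinv) : coinv := Coinv (coinv_mul_subproof b c).

Lemma coinv_one_subproof : aone \in coinvariant.
Proof. exact/coinvariantP/coact_one. Qed.

Definition coinv_one : coinv := Coinv coinv_one_subproof.

Lemma coinv_amulA (b c : coinv) (a : A) : amul (amul b c) a = amul b (amul c a) :> A.
Proof.
rewrite amul_quasiA !coact_coinv.
rewrite (sweedler_pure (f := fun a0 a1 => \Te_(b0, b1 <- (c : A) \ot hone)
  \Co_(c0, c1 <- a) omega a1 b1 c1 *: amul a0 (amul b0 c0))); last first.
  apply: sweedler_bilinear => x y; apply: sweedler_bilinear => z w.
  split=> [u|u] d e e'; first by rewrite amulDZl scalerDr !scalerA mulrC.
  by rewrite omegaDZ1 scalerDl !scalerA.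
rewrite (sweedler_pure (f := fun b0 b1 =>
  \Co_(c0, c1 <- a) omega hone b1 c1 *: amul (b : A) (amul b0 c0))); last first.
  apply: sweedler_bilinear => z w.
  split=> [u|u] d e e'; first by rewrite amulDZl amulDZr scalerDr !scalerA mulrC.
  by rewrite omegaDZ2 scalerDl !scalerA.
rewrite -[in RHS](coact_counit a) /sweedler /btensor_lift /formal_eval /=.
pose g := amul_lin A \o pure (b : A) \o (amul_lin A \o pure (c : A)).
have gD : {morph g : x y / x + y} by move=> x y; rewrite /g /= !(pureDr, linearD).
have g0 : g 0 = 0 by apply: (addIr (g 0)); rewrite -gD !add0r.
rewrite -[RHS]/(g _) (big_morph g gD g0).
apply: eq_bigr => p _.
by rewrite omega_unit counit_one mul1r -!amulZr.
Qed.

Lemma coinv_mulA : associative coinv_mul.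
Proof. by move=> x y z; apply: val_inj; rewrite /= coinv_amulA. Qed.
Lemma coinv_mul1l : left_id coinv_one coinv_mul.
Proof. by move=> x; apply: val_inj; rewrite /= amul1a. Qed.
Lemma coinv_mul1r : right_id coinv_one coinv_mul.
Proof. by move=> x; apply: val_inj; rewrite /= amula1. Qed.
Lemma coinv_mulDl : left_distributive coinv_mul +%R.
Proof. by move=> x y z; apply: val_inj; rewrite /= amulDl. Qed.
Lemma coinv_mulDr : right_distributive coinv_mul +%R.
Proof. by move=> x y z; apply: val_inj; rewrite /= amulDr. Qed.

HB.instance Definition _ := GRing.Zmodule_isPzRing.Build coinv
  coinv_mulA coinv_mul1l coinv_mul1r coinv_mulDl coinv_mulDr.

(* A copy of A, carrying the left B-module structure given by multiplication. *)
Definition leftmod : Type := A.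
HB.instance Definition _ := GRing.Zmodule.on leftmod.

Definition leftmod_scale (b : coinv) (a : leftmod) : leftmod := amul (b : A) (a : A).

Lemma leftmod_scaleA (b c : coinv) (a : leftmod) :
  leftmod_scale b (leftmod_scale c a) = leftmod_scale (b * c) a.
Proof. by rewrite /leftmod_scale /= coinv_amulA. Qed.
Lemma leftmod_scale1 : left_id (1 : coinv) leftmod_scale.
Proof. by move=> a; exact: amul1a. Qed.
Lemma leftmod_scaleDr : right_distributive leftmod_scale +%R.
Proof. by move=> b x y; exact: amulDr. Qed.
Lemma leftmod_scaleDl (a : leftmod) : {morph leftmod_scale^~ a : b c / b + c}.
Proof. by move=> b c; exact: amulDl. Qed.

HB.instance Definition _ := GRing.Zmodule_isLmodule.Build coinv leftmod
  leftmod_scaleA leftmod_scale1 leftmod_scaleDr leftmod_scaleDl.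

Definition tensB : Type :=
  btens (fun (b : coinv) (a : A) => amul a b) (fun (b : coinv) (a : A) => amul (b : A) a).
HB.instance Definition _ := GRing.Zmodule.on tensB.

End Coinvariants.

Definition left_faithfully_flat (k : fieldType) (H : coquasiBialgebra k)
    (A : comoduleAlgebra H) : Prop :=
  faithfully_flat (leftmod A).

Definition galois_can (k : fieldType) (H : coquasiHopf k) (A : comoduleAlgebra H)
    (t : tensB A) : (A \ot H)%type :=
  \Te_(a, b <- t) \Co_(a0, a1 <- a) \Co_(b0, b1, b2, b3, b4 <- b)
    omegai a1 (beta b2 *: b1) (antipode b3) *: (amul a0 b0 \ot b4).

Definition galois (k : fieldType) (H : coquasiHopf k) (A : comoduleAlgebra H) : Prop :=
  bijective (@galois_can k H A).

Section TwistedAlgebra.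
Variables (k : fieldType) (H : coquasiBialgebra k) (A : comoduleAlgebra H).

Definition coinv2 (x : A \ot A) : Prop :=
  \Te_(a, b <- x) \Co_(a0, a1 <- a) \Co_(b0, b1 <- b) (a0 \ot b0) \ot hmul a1 b1
  = x \ot hone.

Definition twisted_mul (x y : A \ot A) : (A \ot A)%type :=
  \Te_(a, b <- x) \Te_(c, d <- y)
  \Co_(a0, a1 <- a) \Co_(c0, c1, c2 <- c) \Co_(d0, d1, d2 <- d) \Co_(b0, b1, b2 <- b)
    (omegai a1 c1 (hmul d1 b1) * omega c2 d2 b2) *: (amul a0 c0 \ot amul d0 b0).

(* The ring [L], embedded in A (x) A by [iota], is the set of coinvariants of *)
(* A (x) A with the twisted multiplication; this determines [L] and [iota] up *)
(* to a unique isomorphism.                                                   *)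
Record twisted_coinv_ring (L : pzRingType) (iota : {additive L -> (A \ot A)%type}) :
    Prop := TwistedCoinvRing {
  iota_inj : injective iota;
  iota_image : forall x : A \ot A, coinv2 x <-> exists l, iota l = x;
  iota1 : iota 1 = aone \ot aone;
  iotaM : forall l l', iota (l * l') = twisted_mul (iota l) (iota l')
}.

End TwistedAlgebra.

(* [L] is a B (x) B^op-ring via [s] and [t], hence a B-bimodule by            *)
(* b . l . c = s b * t c * l; [tensL] is L (x)_B L for this structure and     *)
(* [tensL3] is L (x)_B (L (x)_B L).                                           *)
Section Bialgebroid.
Variables (B L : pzRingType) (s : {rmorphism B -> L}) (t : {rmorphism B^c -> L}).

Definition tensL : Type := btens (fun (b : B) (l : L) => t b * l) (fun (b : B) (l : L) => s b * l).
HB.instance Definition _ := GRing.Zmodule.on tensL.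
Definition pureL (x y : L) : tensL := bpure _ _ x y.

Definition tensL_lact (b : B) (z : tensL) : tensL := \Te_(x, y <- z) pureL (s b * x) y.
Definition tensL_ract (b : B) (z : tensL) : tensL := \Te_(x, y <- z) pureL x (t b * y).

Definition tensL3 : Type := btens (fun (b : B) (l : L) => t b * l) tensL_lact.
HB.instance Definition _ := GRing.Zmodule.on tensL3.
Definition pureL3 (x : L) (z : tensL) : tensL3 := bpure _ _ x z.

Definition in_takeuchi (z : tensL) : Prop :=
  forall b : B, \Te_(x, y <- z) pureL (x * t b) y = \Te_(x, y <- z) pureL x (y * s b).

(* The factorwise product; well defined when z is in the Takeuchi product. *)
Definition takeuchi_mul (z z' : tensL) : tensL :=
  \Te_(x', y' <- z') \Te_(x, y <- z) pureL (x * x') (y * y').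

Record bialgebroid_structure (DeltaL : {additive L -> tensL})
    (epsL : {additive L -> B}) : Prop := BialgebroidStructure {
  DeltaL_bimod : forall b c l,
    DeltaL (s b * t c * l) = tensL_lact b (tensL_ract c (DeltaL l));
  epsL_bimod : forall b c l, epsL (s b * t c * l) = b * epsL l * c;
  DeltaL_coassoc : forall l,
    \Te_(x, y <- DeltaL l) pureL3 x (DeltaL y) =
    \Te_(x, y <- DeltaL l) \Te_(x1, x2 <- DeltaL x) pureL3 x1 (pureL x2 y);
  epsL_counitl : forall l, \Te_(x, y <- DeltaL l) (s (epsL x) * y) = l;
  epsL_counitr : forall l, \Te_(x, y <- DeltaL l) (t (epsL y) * x) = l;
  DeltaL_takeuchi : forall l, in_takeuchi (DeltaL l);
  DeltaL1 : DeltaL 1 = pureL 1 1;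
  DeltaLM : forall l l', DeltaL (l * l') = takeuchi_mul (DeltaL l) (DeltaL l');
  epsL1 : epsL 1 = 1;
  epsLMs : forall x y, epsL (x * y) = epsL (x * s (epsL y));
  epsLMt : forall x y, epsL (x * y) = epsL (x * t (epsL y))
}.

Definition left_bialgebroid : Prop :=
  (forall b c : B, s b * t c = t c * s b) /\
  exists (DeltaL : {additive L -> tensL}) (epsL : {additive L -> B}),
    bialgebroid_structure DeltaL epsL.

End Bialgebroid.

(* Main.v *)
Require Import Defs.
From HB Require Import structures.
From mathcomp Require Import all_boot all_algebra.
From mathcomp Require Import boolp.

Set Implicit Arguments.
Unset Strict Implicit.
Unset Printing Implicit Defensive.

Import GRing.Theory.
Local Open Scope ring_scope.

(* All is done in the monoidal category of right H-comodules, with associator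
   Phi(u (x) v (x) w) = omega(u_1, v_1, w_1) u_0 (x) v_0 (x) w_0, in which A is an algebra.
   - L = (A (x) A)^coH is the opposite of the ring of colinear A-bimodule endomorphisms of
     A (x) A, an element y corresponding to the endomorphism that sends 1 (x) 1 to y.
   - The canonical map of a relative Hopf module M is colinear for the coaction
     h |-> h_2 (x) S(h_1) on H, and that of V (x) M is obtained from that of M by an associator.
     With left flatness this yields M^coH (x)_B A = M for M = A (x) A and M = A (x) A (x) A, thus
     L (x)_B A = A (x) A.
   - Consequently (L (x)_B L) (x)_B A = A (x) A (x) A, and by faithful flatness L (x)_B L is
     (A (x) A (x) A)^coH; likewise L (x)_B L (x)_B L embeds in the fourth tensor power of A.
   Under these identifications Delta(a (x) b) = a (x) 1 (x) b and epsilon(a (x) b) = ab, and every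
   axiom can be checked in tensor powers of A. *)

(** * Sweedler calculus *)

(** The cocycle and quasi-associativity axioms enter only in the coherence of the associator
    (colinearity, pentagon, units). Afterwards it is moved by naturality, and it is the identity as
    soon as one of its three arguments is coinvariant.

    M^coH is the kernel of m |-> rho(m) - m (x) 1. Tensored over B with A this sequence stays exact,
    and the canonical map turns it into the same difference on M (x) H. There every j(m) = m_0 (x)
    beta(m_1) m_2 is coinvariant, j is split injective, and x (x) a with x coinvariant goes to
    j(xa); hence M^coH (x)_B A -> M is bijective.

    L itself is not known to be flat over B, so the inclusion of L in A (x) A does not formally give
    an injection of L (x)_B L into L (x)_B (A (x) A). Instead, the unit L (x)_B L -> (L (x)_B L)
    (x)_B A, injective by faithful flatness, factors through this map. Faithful flatness also shows
    that every coinvariant of A (x) A (x) A comes from L (x)_B L; so a (x) 1 (x) b has a preimage,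
    and this defines Delta without a formula in L (x)_B L. *)

Definition ot (k : fieldType) (U V : lmodType k) : lmodType k := (U \ot V)%type.
Notation "U \OX V" := (ot U V) (at level 40, left associativity).
Definition pu (k : fieldType) (U V : lmodType k) (u : U) (v : V) : U \OX V := u \ot v.
Notation "u \ox v" := (pu u v) (at level 40, left associativity).
(** [ot], [pu] and [sw] restate tensor products, pure tensors and Sweedler sums with [lmodType]
    arguments, so that iterated products are again modules and the tactics below can match on fixed
    head symbols. *)
Definition sw (k : fieldType) (U V W : lmodType k) (t : U \OX V) (f : U -> V -> W) : W :=
  sweedler t f.
Notation "'\S_' ( x , y <- t ) E" := (sw t (fun x y => E))
  (at level 41, x name, y name, E at level 41,
   format "'[' '\S_' ( x ,  y  <-  t ) '/  '  E ']'") : ring_scope.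
Definition lin (k : fieldType) (U V : lmodType k) (f : U -> V) : Prop :=
  forall a x y, f (a *: x + y) = a *: f x + f y.
Definition bilin (k : fieldType) (U V W : lmodType k) (f : U -> V -> W) : Prop :=
  (forall v, lin (fun u => f u v)) /\ (forall u, lin (f u)).
Definition trilin (k : fieldType) (U V W X : lmodType k) (f : U -> V -> W -> X) : Prop :=
  [/\ forall v w, lin (fun u => f u v w), forall u w, lin (fun v => f u v w)
    & forall u v, lin (f u v)].

Lemma bilin_map (k : fieldType) (U V W : lmodType k) (f : U -> V -> W) :
  bilin f -> bilinear_map f.
Proof. by []. Qed.

Section LinearCombinators.
Variables (k : fieldType) (U V W : lmodType k).

Lemma lin_var : lin (fun x : U => x).
Proof. by []. Qed.

Lemma lin_app (g : {linear V -> W}) (f : U -> V) : lin f -> lin (fun x => g (f x)).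
Proof. by move=> fL a x y; rewrite fL linearP. Qed.

Lemma lin_pul (f : U -> V) (w : W) : lin f -> lin (fun x => f x \ox w).
Proof. by move=> fL a x y; rewrite fL /pu pureDl pureZl. Qed.

Lemma lin_pur (f : U -> V) (w : W) : lin f -> lin (fun x => w \ox f x).
Proof. by move=> fL a x y; rewrite fL /pu pureDr pureZr. Qed.

Lemma lin_scale c (f : U -> V) : lin f -> lin (fun x => c *: f x).
Proof. by move=> fL a x y; rewrite fL scalerDr !scalerA mulrC. Qed.

Lemma lin_scalel (f : U -> k^o) (v : V) : lin f -> lin (fun x => f x *: v).
Proof. by move=> fL a x y; rewrite fL scalerDl !scalerA. Qed.

Lemma lin_mull (f : U -> k^o) (c : k) : lin f -> lin (fun x => (f x * c : k^o)).
Proof. by move=> fL a x y; rewrite fL mulrDl -[in LHS]mulrA. Qed.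

Lemma lin_mulr (f : U -> k^o) (c : k) : lin f -> lin (fun x => (c * f x : k^o)).
Proof. by move=> fL a x y; rewrite fL mulrDr; congr (_ + _); exact: mulrCA. Qed.

Lemma lin_body (M N : lmodType k) (t : M \OX N) (F : U -> M -> N -> V) :
  (forall x y, lin (fun u => F u x y)) -> lin (fun u => sw t (F u)).
Proof.
move=> FL a u v; rewrite scaler_sumr -big_split; apply: eq_bigr => p _.
exact: FL.
Qed.

Lemma lin_head (M N : lmodType k) (T : U -> M \OX N) (F : M -> N -> V) :
  bilin F -> lin T -> lin (fun u => sw (T u) F).
Proof. by move=> FB TL a u v; rewrite TL; exact: (lift_linear (bilin_map FB)). Qed.

Lemma linP_head (T : {linear U -> V}) : lin T.
Proof. by move=> a x y; rewrite linearP. Qed.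
End LinearCombinators.

(** Linearity by recursion on the syntax: at each node the tactic looks at which argument contains
    the bound variable and applies the corresponding combinator. *)
Ltac mlin :=
  cbv beta;
  lazymatch goal with
  | |- bilin _ => split=> ?; mlin
  | |- trilin _ => split=> ? ?; mlin
  | |- lin (fun x => x) => exact: lin_var
  | |- lin (fun x => sw (@?t x) _) =>
      lazymatch t with
      | fun _ => ?s => eapply lin_body => ? ?; mlin
      | _ => eapply lin_head; [ mlin | mlin ]
      end
  | |- lin (fun x => pu (@?t x) _) =>
      lazymatch t with fun _ => ?s => eapply lin_pur; mlin | _ => eapply lin_pul; mlin end
  | |- lin (fun x => GRing.scale (@?t x) _) =>
      lazymatch t with fun _ => ?s => eapply lin_scale; mlin | _ => eapply lin_scalel; mlin end
  | |- lin (fun x => GRing.mul (@?t x) _) =>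
      lazymatch t with fun _ => ?s => eapply lin_mulr; mlin | _ => eapply lin_mull; mlin end
  | |- lin (fun x => GRing.Linear.sort _ _) => eapply lin_app; mlin
  | |- lin (GRing.Linear.sort _) => apply: linP_head
  | |- lin (@pu ?k ?U ?V ?t) => change (lin (fun x => @pu k U V t x)); mlin
  | |- lin (@GRing.scale ?R ?V ?c) => change (lin (fun x => @GRing.scale R V c x)); mlin
  | |- _ => solve [ auto | match goal with H : _ |- _ => eapply H end ]
  end.

Section SweedlerCalculus.
Variable k : fieldType.
Implicit Types M N U V W X Z : lmodType k.

Lemma puDl U V (u u' : U) (v : V) : (u + u') \ox v = u \ox v + u' \ox v.
Proof. exact: pureDl. Qed.
Lemma puDr U V (u : U) (v v' : V) : u \ox (v + v') = u \ox v + u \ox v'.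
Proof. exact: pureDr. Qed.
Lemma puZl U V c (u : U) (v : V) : (c *: u) \ox v = c *: (u \ox v).
Proof. exact: pureZl. Qed.
Lemma puZr U V c (u : U) (v : V) : u \ox (c *: v) = c *: (u \ox v).
Proof. exact: pureZr. Qed.

Lemma eq_sw U V W (t : U \OX V) (f g : U -> V -> W) :
  (forall x y, f x y = g x y) -> sw t f = sw t g.
Proof. exact: eq_sweedler. Qed.

Lemma sw_pure U V W (f : U -> V -> W) u v : bilin f -> sw (u \ox v) f = f u v.
Proof. by move=> fB; apply: sweedler_pure. Qed.

Lemma ot_ind U V (P : U \OX V -> Prop) :
  (forall u v, P (u \ox v)) -> (forall x y, P x -> P y -> P (x + y)) -> forall t, P t.
Proof.
move=> Pp PD t; have [s ->] := btensP (t : (U \ot V)%type).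
elim: s => [|[m n] s IH]; first by rewrite big_nil -(pure0l U (0 : V)); apply: Pp.
by rewrite big_cons; apply: PD => //; apply: Pp.
Qed.

Lemma tens_eq U V W (f g : U \OX V -> W) :
  lin f -> lin g -> (forall u v, f (u \ox v) = g (u \ox v)) -> forall t, f t = g t.
Proof.
move=> fL gL; apply: tens_ext => x y; [have := fL 1 x y|have := gL 1 x y];
  by rewrite !scale1r.
Qed.

Lemma tens_eq3l U V W X (f g : U \OX V \OX W -> X) : lin f -> lin g ->
  (forall u v w, f (u \ox v \ox w) = g (u \ox v \ox w)) -> forall t, f t = g t.
Proof.
move=> fL gL e; apply: tens_eq => // t w; move: t.
by apply: tens_eq => [a x y|a x y|u v]; rewrite ?e // puDl puZl ?fL ?gL.
Qed.

Lemma tens_eq3r U V W X (f g : U \OX (V \OX W) -> X) : lin f -> lin g ->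
  (forall u v w, f (u \ox (v \ox w)) = g (u \ox (v \ox w))) -> forall t, f t = g t.
Proof.
move=> fL gL e; apply: tens_eq => // u t; move: t.
by apply: tens_eq => [a x y|a x y|v w]; rewrite ?e // puDr puZr ?fL ?gL.
Qed.

Lemma tens_eq4l U V W Z X (f g : U \OX V \OX W \OX Z -> X) : lin f -> lin g ->
  (forall u v w z, f (u \ox v \ox w \ox z) = g (u \ox v \ox w \ox z)) ->
  forall t, f t = g t.
Proof.
move=> fL gL e; apply: tens_eq3l => // t w z; move: t.
by apply: tens_eq => [a x y|a x y|u v]; rewrite ?e // !(puDl, puZl) ?fL ?gL.
Qed.

Lemma sw_swap U V U' V' W (t : U \OX V) (t' : U' \OX V') (F : U -> V -> U' -> V' -> W) :
  sw t (fun x y => sw t' (fun z w => F x y z w)) =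
  sw t' (fun z w => sw t (fun x y => F x y z w)).
Proof. exact: exchange_big. Qed.

Lemma swZl U V W (t : U \OX V) (f : U -> V -> k^o) (v : W) :
  sw t (fun x y => (f x y : k) *: v) = (sw t f : k) *: v.
Proof. by rewrite [RHS]scaler_suml. Qed.

Lemma swZr U V W (t : U \OX V) (c : k) (f : U -> V -> W) :
  c *: sw t f = sw t (fun x y => c *: f x y).
Proof. exact: scaler_sumr. Qed.

Lemma sw_lin U V W W' (t : U \OX V) (g : {linear W -> W'}) (f : U -> V -> W) :
  g (sw t f) = sw t (fun x y => g (f x y)).
Proof. exact: raddf_sum. Qed.

Lemma linZ U V (g : {linear U -> V}) c x : g (c *: x) = c *: g x.
Proof. by rewrite linearZ. Qed.

Definition tlift U V W (f : U -> V -> W) (fB : bilin f) : U \OX V -> W := fun t => sw t f.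
HB.instance Definition _ U V W (f : U -> V -> W) (fB : bilin f) :=
  GRing.isLinear.Build k (U \OX V) W *:%R (tlift fB) (lift_linear (bilin_map fB)).

Lemma sw_bind U V U' V' W (t : U \OX V) (f : U -> V -> U' \OX V') (F : U' -> V' -> W) :
  bilin F -> sw (sw t f) F = sw t (fun x y => sw (f x y) F).
Proof. by move=> FB; apply: (sw_lin _ (tlift FB)). Qed.

Definition linmap U V (f : U -> V) (fL : lin f) : U -> V := f.
HB.instance Definition _ U V (f : U -> V) (fL : lin f) :=
  GRing.isLinear.Build k U V *:%R (linmap fL) fL.

Lemma pul_lin U V (v : V) : lin (fun u : U => u \ox v). Proof. by mlin. Qed.
Lemma pur_lin U V (u : U) : lin (fun v : V => u \ox v). Proof. by mlin. Qed.
Definition pul U V (v : V) : {linear U -> U \OX V} := linmap (@pul_lin U V v).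
Definition pur U V (u : U) : {linear V -> U \OX V} := linmap (@pur_lin U V u).

Lemma pu_swl U V W X (t : U \OX V) (f : U -> V -> W) (x : X) :
  sw t f \ox x = sw t (fun u v => f u v \ox x).
Proof. exact: (sw_lin t (pul W x) f). Qed.
Lemma pu_swr U V W X (t : U \OX V) (f : U -> V -> W) (x : X) :
  x \ox sw t f = sw t (fun u v => x \ox f u v).
Proof. exact: (sw_lin t (pur W x) f). Qed.

Lemma sw_id U V (t : U \OX V) : \S_(x, y <- t) (x \ox y) = t.
Proof. by move: t; apply: tens_eq => [||u v]; [mlin|mlin|rewrite sw_pure //; mlin]. Qed.

Lemma pu_expand U V W (u : U) (t : V \OX W) : u \ox t = \S_(x, y <- t) (u \ox (x \ox y)).
Proof. by rewrite -pu_swr sw_id. Qed.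

Lemma tlift3_bilin U V W X (F : U -> V -> W -> X) :
  trilin F -> bilin (fun u (t : V \OX W) => sw t (F u)).
Proof. by case=> F1 F2 F3; split=> ?; [mlin | apply: lin_head; [split|mlin]]. Qed.

Definition tlift3 U V W X (F : U -> V -> W -> X) (F3 : trilin F) :
    {linear U \OX (V \OX W) -> X} := tlift (tlift3_bilin F3).

Lemma tlift3r U V W X (F : U -> V -> W -> X) (F3 : trilin F) u t :
  tlift3 F3 (u \ox t) = sw t (F u).
Proof. exact/sw_pure/tlift3_bilin. Qed.

Lemma tlift3E U V W X (F : U -> V -> W -> X) (F3 : trilin F) u v w :
  tlift3 F3 (u \ox (v \ox w)) = F u v w.
Proof. by rewrite tlift3r sw_pure //; case: F3. Qed.

Lemma tl_bilin U V U' (f : {linear U -> U'}) : bilin (fun u (v : V) => f u \ox v).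
Proof. by mlin. Qed.
Lemma tr_bilin U V V' (f : {linear V -> V'}) : bilin (fun (u : U) v => u \ox f v).
Proof. by mlin. Qed.
(* [tl f] = f (x) id and [tr f] = id (x) f are sealed: unfolded, they unify with the scaling
   of tensors, which makes [rewrite tlE] match scalar multiples. *)
Lemma tl_subproof U V U' (f : {linear U -> U'}) :
  {g : {linear U \OX V -> U' \OX V} | forall u v, g (u \ox v) = f u \ox v}.
Proof. by exists (tlift (@tl_bilin U V U' f)) => u v; apply/sw_pure/tl_bilin. Qed.
Lemma tr_subproof U V V' (f : {linear V -> V'}) :
  {g : {linear U \OX V -> U \OX V'} | forall u v, g (u \ox v) = u \ox f v}.
Proof. by exists (tlift (@tr_bilin U V V' f)) => u v; apply/sw_pure/tr_bilin. Qed.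
Definition tl U V U' (f : {linear U -> U'}) : {linear U \OX V -> U' \OX V} :=
  sval (tl_subproof V f).
Definition tr U V V' (f : {linear V -> V'}) : {linear U \OX V -> U \OX V'} :=
  sval (tr_subproof U f).

Lemma tlE U V U' (f : {linear U -> U'}) (u : U) (v : V) : tl V f (u \ox v) = f u \ox v.
Proof. exact: (svalP (tl_subproof V f)). Qed.
Lemma trE U V V' (f : {linear V -> V'}) (u : U) (v : V) : tr U f (u \ox v) = u \ox f v.
Proof. exact: (svalP (tr_subproof U f)). Qed.

Lemma tl_sw U V U' (f : {linear U -> U'}) (t : U \OX V) :
  tl V f t = \S_(x, y <- t) (f x \ox y).
Proof.
by move: t; apply: tens_eq => [||u v]; [mlin|mlin|rewrite tlE sw_pure //; mlin].
Qed.

Lemma tr_sw U V V' (f : {linear V -> V'}) (t : U \OX V) :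
  tr U f t = \S_(x, y <- t) (x \ox f y).
Proof.
by move: t; apply: tens_eq => [||u v]; [mlin|mlin|rewrite trE sw_pure //; mlin].
Qed.
End SweedlerCalculus.
Arguments tl {k U V U'} f.
Arguments tr {k U V V'} f.

(** Rewriting under binders: [swn n tac] applies [tac] below exactly [n] Sweedler sums, [swbot tac]
    below all of them, and [swpush] moves sums and scalars outwards through linear maps and
    tensors. *)
Ltac swn_in n tac :=
  lazymatch n with
  | O => etransitivity; [ tac tt | reflexivity ]
  | S ?m => apply: eq_sw => ? ?; swn_in m tac
  end.
Ltac swn n tac := etransitivity; [ swn_in n tac | ]; cbv beta.
Ltac swbot_in tac :=
  lazymatch goal with
  | |- sw _ _ = _ => apply: eq_sw => ? ?; swbot_in tac
  | |- _ => etransitivity; [ tac tt | reflexivity ]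
  end.
Ltac swbot tac := etransitivity; [ swbot_in tac | ]; cbv beta.
Ltac swpush_step :=
  match goal with
  | |- context [GRing.Linear.sort ?g (@sw ?k ?M ?N ?W ?t ?f)] =>
      rewrite (@sw_lin k M N W _ t g f)
  | |- context [@pu ?k _ ?X (@sw _ ?U ?V ?W ?t ?f) ?x] => rewrite (@pu_swl k U V W X t f x)
  | |- context [@pu ?k ?X _ ?x (@sw _ ?U ?V ?W ?t ?f)] => rewrite (@pu_swr k U V W X t f x)
  | |- context [GRing.scale ?c (@sw ?k ?U ?V ?W ?t ?f)] => rewrite (@swZr k U V W t c f)
  | |- context [@GRing.Linear.sort _ _ _ _ ?g (@GRing.scale _ _ ?c ?x)] => rewrite (linZ g c x)
  | |- context [@pu ?k ?U ?V (@GRing.scale _ _ ?c ?u) ?v] => rewrite (@puZl k U V c u v)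
  | |- context [@pu ?k ?U ?V ?u (@GRing.scale _ _ ?c ?v)] => rewrite (@puZr k U V c u v)
  end.
Ltac swpush :=
  repeat (swbot ltac:(fun _ => progress (repeat swpush_step); reflexivity)).

(** * Comodules and their tensor products *)

Definition De (k : fieldType) (C : coalgebra k) : {linear C -> C \OX C} := Delta.
Arguments De {k C}.

Section Coalgebra.
Variables (k : fieldType) (C : coalgebra k).
Implicit Types h : C.

Lemma De_coassoc (X : lmodType k) h (F : C -> C -> C -> X) : trilin F ->
  \S_(h', h3 <- De h) \S_(h1, h2 <- De h') F h1 h2 h3 =
  \S_(h1, h' <- De h) \S_(h2, h3 <- De h') F h1 h2 h3.
Proof.
move=> F3.
have /(congr1 (tlift3 F3)) e :
  \S_(h1, h' <- De h) (h1 \ox De h') =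
  \S_(h', h3 <- De h) \S_(h1, h2 <- De h') (h1 \ox (h2 \ox h3)).
  exact: Delta_coassoc.
symmetry; rewrite !sw_lin in e; etransitivity; [|etransitivity; [exact: e|]].
  by apply: eq_sw => x t; rewrite tlift3r.
by apply: eq_sw => t x; rewrite sw_lin; apply: eq_sw => y z; rewrite tlift3E.
Qed.

Lemma De_counitl (X : lmodType k) h (F : C -> X) : lin F ->
  \S_(h1, h2 <- De h) (counit h1 *: F h2) = F h.
Proof.
move=> FL; have e : \S_(h1, h2 <- De h) (counit h1 *: h2) = h by apply: counitl.
rewrite -[RHS]/(linmap FL h) -[in RHS]e sw_lin.
by apply: eq_sw => x y; rewrite linearZ.
Qed.

Lemma De_counitr (X : lmodType k) h (F : C -> X) : lin F ->
  \S_(h1, h2 <- De h) (counit h2 *: F h1) = F h.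
Proof.
move=> FL; have e : \S_(h1, h2 <- De h) (counit h2 *: h1) = h by apply: counitr.
rewrite -[RHS]/(linmap FL h) -[in RHS]e sw_lin.
by apply: eq_sw => x y; rewrite linearZ.
Qed.
End Coalgebra.

Record comod (k : fieldType) (H : coquasiBialgebra k) := Comod {
  cm :> lmodType k;
  rho : {linear cm -> cm \OX H};
  rho_coassoc : forall u : cm,
    \S_(u', u2 <- rho u) \S_(u0, u1 <- rho u') (u0 \ox (u1 \ox u2)) =
    \S_(u0, h <- rho u) \S_(u1, u2 <- De h) (u0 \ox (u1 \ox u2));
  rho_counit : forall u : cm, \S_(u0, u1 <- rho u) (counit u1 *: u0) = u
}.
Arguments rho {k H c}.

Section Comod.
Variables (k : fieldType) (H : coquasiBialgebra k) (U : comod H).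

Lemma Ro_coassoc (X : lmodType k) (u : U) (F : U -> H -> H -> X) : trilin F ->
  \S_(u', u2 <- rho u) \S_(u0, u1 <- rho u') F u0 u1 u2 =
  \S_(u0, h <- rho u) \S_(u1, u2 <- De h) F u0 u1 u2.
Proof.
move=> F3; have := congr1 (tlift3 F3) (rho_coassoc u).
rewrite !sw_lin => e; etransitivity; [|etransitivity; [exact: e|]];
  by apply: eq_sw => t x; rewrite sw_lin; apply: eq_sw => y z; rewrite tlift3E.
Qed.

Lemma Ro_counit (X : lmodType k) (u : U) (F : U -> X) : lin F ->
  \S_(u0, u1 <- rho u) (counit u1 *: F u0) = F u.
Proof.
move=> FL; rewrite -[RHS]/(linmap FL u) -[in RHS](rho_counit u) sw_lin.
by apply: eq_sw => x y; rewrite linearZ.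
Qed.
End Comod.

Definition mulH (k : fieldType) (H : coquasiBialgebra k) : {linear H \OX H -> H} := hmul_lin H.
Notation "h ** g" := (mulH _ (h \ox g)) (at level 40, left associativity) : ring_scope.
Definition omegaL (k : fieldType) (H : coquasiBialgebra k) : {linear H \OX (H \OX H) -> k^o} :=
  omega_lin H.
Definition omegaiL (k : fieldType) (H : coquasiBialgebra k) : {linear H \OX (H \OX H) -> k^o} :=
  omegai_lin H.
Notation om h g x := (omegaL _ (h \ox (g \ox x))).
Notation omi h g x := (omegaiL _ (h \ox (g \ox x))).

Section Bialgebra.
Variables (k : fieldType) (H : coquasiBialgebra k).
Implicit Types h g x : H.

Lemma De_mul (X : lmodType k) h g (F : H -> H -> X) : bilin F ->
  \S_(x, y <- De (h ** g)) F x y =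
  \S_(h1, h2 <- De h) \S_(g1, g2 <- De g) F (h1 ** g1) (h2 ** g2).
Proof.
move=> FB; have -> : De (h ** g) =
  \S_(h1, h2 <- De h) \S_(g1, g2 <- De g) ((h1 ** g1) \ox (h2 ** g2)) by apply: Delta_mul.
rewrite sw_bind //; apply: eq_sw => h1 h2; rewrite sw_bind //.
by apply: eq_sw => g1 g2; rewrite sw_pure.
Qed.

Lemma counitM h g : counit (h ** g) = counit h * counit g.
Proof. exact: counit_mul. Qed.

Variables (U V : comod H).

Definition tens_rho_fun (u : U) (v : V) : U \OX V \OX H :=
  \S_(u0, u1 <- rho u) \S_(v0, v1 <- rho v) ((u0 \ox v0) \ox (u1 ** v1)).
Lemma tens_rho_bilin : bilin tens_rho_fun.
Proof. by rewrite /tens_rho_fun; mlin. Qed.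
Definition tens_rho : {linear U \OX V -> U \OX V \OX H} := tlift tens_rho_bilin.

Lemma tens_rhoE u v : tens_rho (u \ox v) =
  \S_(u0, u1 <- rho u) \S_(v0, v1 <- rho v) ((u0 \ox v0) \ox (u1 ** v1)).
Proof. exact/sw_pure/tens_rho_bilin. Qed.

Lemma tens_rho_sw (X : lmodType k) u v (F : U \OX V -> H -> X) : bilin F ->
  \S_(x, y <- tens_rho (u \ox v)) F x y =
  \S_(u0, u1 <- rho u) \S_(v0, v1 <- rho v) F (u0 \ox v0) (u1 ** v1).
Proof.
move=> FB; rewrite tens_rhoE sw_bind //; apply: eq_sw => u0 u1.
by rewrite sw_bind //; apply: eq_sw => v0 v1; rewrite sw_pure.
Qed.

Lemma tens_rho_coassoc (t : U \OX V) :
    \S_(u', u2 <- tens_rho t) \S_(u0, u1 <- tens_rho u') (u0 \ox (u1 \ox u2)) =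
    \S_(u0, h <- tens_rho t) \S_(u1, u2 <- De h) (u0 \ox (u1 \ox u2)).
Proof.
move: t; apply: tens_eq; [mlin | mlin | move=> u v].
rewrite !tens_rho_sw; [|mlin|mlin].
swn 2%N ltac:(fun _ => eapply tens_rho_sw; mlin).
swn 1%N ltac:(fun _ => exact: sw_swap).
swn 0%N ltac:(fun _ => eapply Ro_coassoc; mlin).
swn 2%N ltac:(fun _ => eapply Ro_coassoc; mlin).
symmetry.
swn 2%N ltac:(fun _ => eapply De_mul; mlin).
by swn 1%N ltac:(fun _ => exact: sw_swap).
Qed.

Lemma tens_rho_counit (t : U \OX V) : \S_(u0, u1 <- tens_rho t) (counit u1 *: u0) = t.
Proof.
move: t; apply: tens_eq; [mlin | mlin | move=> u v].
rewrite tens_rho_sw; last mlin.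
swn 2%N ltac:(fun _ => rewrite counitM -scalerA; reflexivity).
swn 1%N ltac:(fun _ => symmetry; apply: swZr).
swn 1%N ltac:(fun _ => apply: (congr1 ( *:%R _)); apply: (@Ro_counit _ _ V); mlin).
by apply: (@Ro_counit _ _ U); mlin.
Qed.

Definition ctens : comod H := Comod tens_rho_coassoc tens_rho_counit.
End Bialgebra.

Section TripleCoassoc.
Variables (k : fieldType) (H : coquasiBialgebra k) (U V W : comod H) (X : lmodType k).

(** Two successive coactions on three factors become one coaction followed by a comultiplication of
    each leg. Identities between composed associators thereby reduce to convolution identities for
    omega. *)
Lemma Ro3_coassoc (F : U -> H -> H -> V -> H -> H -> W -> H -> H -> X) u v w :
  (forall v0 v1 v2 w0 w1 w2, trilin (fun u0 u1 u2 => F u0 u1 u2 v0 v1 v2 w0 w1 w2)) ->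
  (forall u0 u1 u2 w0 w1 w2, trilin (fun v0 v1 v2 => F u0 u1 u2 v0 v1 v2 w0 w1 w2)) ->
  (forall u0 u1 u2 v0 v1 v2, trilin (F u0 u1 u2 v0 v1 v2)) ->
  \S_(u', u2 <- rho u) \S_(v', v2 <- rho v) \S_(w', w2 <- rho w)
  \S_(u0, u1 <- rho u') \S_(v0, v1 <- rho v') \S_(w0, w1 <- rho w')
    F u0 u1 u2 v0 v1 v2 w0 w1 w2 =
  \S_(u0, h <- rho u) \S_(v0, g <- rho v) \S_(w0, x <- rho w)
  \S_(u1, u2 <- De h) \S_(v1, v2 <- De g) \S_(w1, w2 <- De x)
    F u0 u1 u2 v0 v1 v2 w0 w1 w2.
Proof.
move=> FU FV FW.
swn 2%N ltac:(fun _ => exact: sw_swap).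
swn 1%N ltac:(fun _ => exact: sw_swap).
swn 0%N ltac:(fun _ => eapply Ro_coassoc; split=> ? ?; do 4 apply: lin_body => ? ?; apply FU).
swn 3%N ltac:(fun _ => exact: sw_swap).
swn 2%N ltac:(fun _ => eapply Ro_coassoc; split=> ? ?; do 2 apply: lin_body => ? ?; apply FV).
swn 4%N ltac:(fun _ => eapply Ro_coassoc; apply FW).
swn 1%N ltac:(fun _ => exact: sw_swap).
swn 3%N ltac:(fun _ => exact: sw_swap).
swn 2%N ltac:(fun _ => exact: sw_swap).
done.
Qed.

Lemma Ro3_counit (F : U -> V -> W -> X) u v w : trilin F ->
  \S_(u0, h <- rho u) \S_(v0, g <- rho v) \S_(w0, x <- rho w)
   ((counit h * counit g * counit x) *: F u0 v0 w0) = F u v w.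
Proof.
case=> FU FV FW.
swbot ltac:(fun _ => rewrite -!scalerA; reflexivity).
swn 2%N ltac:(fun _ => rewrite -!swZr; reflexivity).
swn 2%N ltac:(fun _ => do 2! apply: (congr1 ( *:%R _)); exact: Ro_counit).
swn 1%N ltac:(fun _ => rewrite -!swZr; reflexivity).
swn 1%N ltac:(fun _ => apply: (congr1 ( *:%R _)); exact: Ro_counit).
exact: Ro_counit.
Qed.
End TripleCoassoc.

(** * The associator *)

Lemma swZr2 (k : fieldType) (U V U' V' W : lmodType k) (t : U \OX V)
    (t' : U -> V -> U' \OX V') (c : k) (f : U -> V -> U' -> V' -> W) :
  \S_(x, y <- t) \S_(z, w <- t' x y) (c *: f x y z w) =
  c *: \S_(x, y <- t) \S_(z, w <- t' x y) f x y z w.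
Proof. by rewrite swZr; apply: eq_sw => x y; rewrite swZr. Qed.

Lemma scale_mul3 (k : fieldType) (a b c : k) : a *: (b * c : k^o) = b *: (c *: (a : k^o)).
Proof. exact: (etrans (mulrCA a b c) (congr1 _ (mulrC a c))). Qed.

Lemma swMr (k : fieldType) (U V : lmodType k) (t : U \OX V) (c : k) (f : U -> V -> k^o) :
  \S_(x, y <- t) (c * f x y : k^o) = c *: sw t f.
Proof. by rewrite swZr. Qed.

Lemma mul_scale (k : fieldType) (a b : k) : a * b = a *: (b : k^o).
Proof. by []. Qed.

Section Associator.
Variables (k : fieldType) (H : coquasiBialgebra k).

Section Def.
Variables (U V W : comod H).

Lemma assoc_bilin : bilin (fun (t : U \OX V) (w : W) =>
  \S_(u, v <- t) \S_(u0, u1 <- rho u) \S_(v0, v1 <- rho v) \S_(w0, w1 <- rho w)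
    (om u1 v1 w1 *: (u0 \ox (v0 \ox w0)))).
Proof. by mlin. Qed.

Lemma assoc_subproof : {g : {linear U \OX V \OX W -> U \OX (V \OX W)} |
  forall u v w, g (u \ox v \ox w) =
    \S_(u0, u1 <- rho u) \S_(v0, v1 <- rho v) \S_(w0, w1 <- rho w)
      (om u1 v1 w1 *: (u0 \ox (v0 \ox w0)))}.
Proof.
exists (tlift assoc_bilin) => u v w.
by etransitivity; [apply: sw_pure assoc_bilin | rewrite sw_pure //; mlin].
Qed.

Definition assoc : {linear U \OX V \OX W -> U \OX (V \OX W)} := sval assoc_subproof.

Lemma associ_trilin : trilin (fun (u : U) (v : V) (w : W) =>
  \S_(u0, u1 <- rho u) \S_(v0, v1 <- rho v) \S_(w0, w1 <- rho w)
    (omi u1 v1 w1 *: (u0 \ox v0 \ox w0))).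
Proof. by mlin. Qed.

Lemma associ_subproof : {g : {linear U \OX (V \OX W) -> U \OX V \OX W} |
  forall u v w, g (u \ox (v \ox w)) =
    \S_(u0, u1 <- rho u) \S_(v0, v1 <- rho v) \S_(w0, w1 <- rho w)
      (omi u1 v1 w1 *: (u0 \ox v0 \ox w0))}.
Proof. by exists (tlift3 associ_trilin) => u v w; rewrite tlift3E. Qed.

Definition associ : {linear U \OX (V \OX W) -> U \OX V \OX W} := sval associ_subproof.

Lemma assocE u v w : assoc (u \ox v \ox w) =
  \S_(u0, u1 <- rho u) \S_(v0, v1 <- rho v) \S_(w0, w1 <- rho w)
    (om u1 v1 w1 *: (u0 \ox (v0 \ox w0))).
Proof. exact: (svalP assoc_subproof). Qed.

Lemma associE u v w : associ (u \ox (v \ox w)) =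
  \S_(u0, u1 <- rho u) \S_(v0, v1 <- rho v) \S_(w0, w1 <- rho w)
    (omi u1 v1 w1 *: (u0 \ox v0 \ox w0)).
Proof. exact: (svalP associ_subproof). Qed.

Lemma om_omi_scale (X : lmodType k) (h g x : H) (v : X) :
  \S_(h1, h2 <- De h) \S_(g1, g2 <- De g) \S_(x1, x2 <- De x)
    ((om h1 g1 x1 * omi h2 g2 x2) *: v) = (counit h * counit g * counit x) *: v.
Proof.
have <- : (\S_(h1, h2 <- De h) \S_(g1, g2 <- De g) \S_(x1, x2 <- De x)
    (om h1 g1 x1 * omi h2 g2 x2 : k^o)) = counit h * counit g * counit x :> k.
  exact: omega_mulVr.
swn 2%N ltac:(fun _ => exact: swZl).
by swn 1%N ltac:(fun _ => exact: swZl); rewrite swZl.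
Qed.

Lemma omi_om_scale (X : lmodType k) (h g x : H) (v : X) :
  \S_(h1, h2 <- De h) \S_(g1, g2 <- De g) \S_(x1, x2 <- De x)
    ((omi h1 g1 x1 * om h2 g2 x2) *: v) = (counit h * counit g * counit x) *: v.
Proof.
have <- : (\S_(h1, h2 <- De h) \S_(g1, g2 <- De g) \S_(x1, x2 <- De x)
    (omi h1 g1 x1 * om h2 g2 x2 : k^o)) = counit h * counit g * counit x :> k.
  exact: omega_mulVl.
swn 2%N ltac:(fun _ => exact: swZl).
by swn 1%N ltac:(fun _ => exact: swZl); rewrite swZl.
Qed.

Lemma assocK : cancel assoc associ.
Proof.
apply: tens_eq3l; [mlin|mlin|move=> u v w].
rewrite assocE; swpush.
swbot ltac:(fun _ => rewrite associE; reflexivity).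
swpush.
swbot ltac:(fun _ => rewrite scalerA mulrC; reflexivity).
etransitivity; [eapply Ro3_coassoc; move=> *; mlin | ]; cbv beta.
swn 3%N ltac:(fun _ => exact: omi_om_scale).
by apply: Ro3_counit; mlin.
Qed.

Lemma associK : cancel associ assoc.
Proof.
apply: tens_eq3r; [mlin|mlin|move=> u v w].
rewrite associE; swpush.
swbot ltac:(fun _ => rewrite assocE; reflexivity).
swpush.
swbot ltac:(fun _ => rewrite scalerA mulrC; reflexivity).
etransitivity; [eapply Ro3_coassoc; move=> *; mlin | ]; cbv beta.
swn 3%N ltac:(fun _ => exact: om_omi_scale).
by apply: Ro3_counit; mlin.
Qed.
End Def.

Lemma quasiA_lin (X : lmodType k) (h g x : H) (G : H -> X) : lin G ->
  \S_(h1, h2 <- De h) \S_(g1, g2 <- De g) \S_(x1, x2 <- De x)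
    (om h2 g2 x2 *: G (h1 ** (g1 ** x1))) =
  \S_(h1, h2 <- De h) \S_(g1, g2 <- De g) \S_(x1, x2 <- De x)
    (om h1 g1 x1 *: G (h2 ** g2 ** x2)).
Proof.
move=> GL.
have /(congr1 (linmap GL)) : \S_(h1, h2 <- De h) \S_(g1, g2 <- De g) \S_(x1, x2 <- De x)
    (om h2 g2 x2 *: (h1 ** (g1 ** x1))) =
  \S_(h1, h2 <- De h) \S_(g1, g2 <- De g) \S_(x1, x2 <- De x)
    (om h1 g1 x1 *: (h2 ** g2 ** x2)) by exact: hmul_quasiA.
rewrite !sw_lin => e; etransitivity; [|etransitivity; [exact: e|]];
  by apply: eq_sw => ? ?; rewrite sw_lin; apply: eq_sw => ? ?; rewrite sw_lin;
    apply: eq_sw => ? ?; rewrite linZ.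
Qed.

Lemma om_cocycle (h g x y : H) :
  \S_(h1, h2 <- De h) \S_(g1, g2 <- De g) \S_(x1, x2 <- De x) \S_(y1, y2 <- De y)
      (om h1 g1 (x1 ** y1) * om (h2 ** g2) x2 y2 : k^o) =
  \S_(h1, h2 <- De h) \S_(g1, g' <- De g) \S_(g2, g3 <- De g')
  \S_(x1, x' <- De x) \S_(x2, x3 <- De x') \S_(y1, y2 <- De y)
      (om g1 x1 y1 * om h1 (g2 ** x2) y2 * om h2 g3 x3 : k^o).
Proof. exact (omega_cocycle h g x y). Qed.

Lemma De_one_sw (X : lmodType k) (F : H -> H -> X) : bilin F ->
  \S_(x, y <- De (hone : H)) F x y = F hone hone.
Proof.
move=> FB; have -> : De (hone : H) = hone \ox hone by apply: Delta_one.
by rewrite sw_pure.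
Qed.

Lemma mulH1h (h : H) : hone ** h = h. Proof. exact: hmul1h. Qed.
Lemma mulHh1 (h : H) : h ** hone = h. Proof. exact: hmulh1. Qed.

Lemma om_h1g (h g : H) : om h hone g = counit h * counit g. Proof. exact (omega_unit h g). Qed.

(** In the convolution algebra, q = q(qq') = (qq)q' = qq' = 1: an idempotent with a right inverse is
    the unit. *)
Lemma idempotent_counit (q q' : H -> H -> k^o) : bilin q -> bilin q' ->
  (forall x y, \S_(x1, x2 <- De x) \S_(y1, y2 <- De y) (q x1 y1 * q x2 y2 : k^o) = q x y) ->
  (forall x y, \S_(x1, x2 <- De x) \S_(y1, y2 <- De y) (q x1 y1 * q' x2 y2 : k^o) =
     counit x * counit y) ->
  forall x y, q x y = counit x * counit y.
Proof.
move=> qB qB' qq qq' x y.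
transitivity (\S_(x1, x' <- De x) \S_(y1, y' <- De y) \S_(x2, x3 <- De x') \S_(y2, y3 <- De y')
  (q x1 y1 *: (q x2 y2 *: q' x3 y3 : k^o))).
  symmetry; swn 2%N ltac:(fun _ => exact: swZr2).
  swn 2%N ltac:(fun _ => apply: (congr1 ( *:%R _)); exact: qq').
  swn 2%N ltac:(fun _ => exact: scale_mul3).
  swn 1%N ltac:(fun _ => symmetry; exact: swZr).
  swn 1%N ltac:(fun _ => apply: (congr1 ( *:%R _)); apply: De_counitr; mlin).
  by apply: De_counitr; mlin.
swn 1%N ltac:(fun _ => exact: sw_swap).
swn 0%N ltac:(fun _ => symmetry; eapply De_coassoc; mlin).
swn 2%N ltac:(fun _ => symmetry; eapply De_coassoc; mlin).
swn 1%N ltac:(fun _ => exact: sw_swap).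
swn 4%N ltac:(fun _ => exact: scalerA).
swn 3%N ltac:(fun _ => exact: swZl).
swn 2%N ltac:(fun _ => exact: swZl).
swn 2%N ltac:(fun _ => rewrite qq; reflexivity).
exact: qq'.
Qed.

(** The axiom normalizes omega in its middle argument only. The cocycle identity at (1, 1, x, y)
    says that omega(1, -, -) is a convolution idempotent, and it is convolution invertible. *)
Lemma om_1hg (h g : H) : om hone h g = counit h * counit g.
Proof.
apply: (@idempotent_counit (fun x y => om hone x y) (fun x y => omi hone x y));
  [mlin|mlin|move=> x y|move=> x y].
  have := om_cocycle hone hone x y.
  rewrite !De_one_sw; try by mlin.
  set L := (X in X = _ -> _); have -> : L = om hone x y.
    rewrite {}/L; swbot ltac:(fun _ => rewrite om_h1g mulH1h counit_one mul1r counitM -mulrA; reflexivity).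
    swn 1%N ltac:(fun _ => exact: swMr).
    swn 1%N ltac:(fun _ => apply: (congr1 ( *:%R _)); apply: De_counitl; mlin).
    by apply: De_counitl; mlin.
  move=> ->; symmetry.
  swbot ltac:(fun _ => rewrite om_h1g mulH1h counit_one mul1r mulrC; reflexivity).
  swn 1%N ltac:(fun _ => exact: sw_swap).
  swbot ltac:(fun _ => exact: mul_scale).
  swn 2%N ltac:(fun _ => eapply De_counitr; mlin).
  done.
have := omega_mulVr hone x y; rewrite counit_one mul1r => <-.
by rewrite -[RHS]/(\S_(h1, h2 <- De (hone : H)) \S_(g1, g2 <- De x) \S_(x1, x2 <- De y)
   (om h1 g1 x1 * omi h2 g2 x2 : k^o)) De_one_sw //; mlin.
Qed.

(** As for the first argument, now with the cocycle identity at (x, y, 1, 1). *)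
Lemma om_hg1 (h g : H) : om h g hone = counit h * counit g.
Proof.
apply: (@idempotent_counit (fun x y => om x y hone) (fun x y => omi x y hone));
  [mlin|mlin|move=> x y|move=> x y].
  have := om_cocycle x y hone hone.
  set L := (X in X = _ -> _); have -> : L = om x y hone.
    rewrite {}/L; swn 2%N ltac:(fun _ => eapply De_one_sw; mlin).
    swn 2%N ltac:(fun _ => eapply De_one_sw; mlin).
    swbot ltac:(fun _ => rewrite om_h1g mulH1h counit_one mulr1 counitM mulrC -mulrA; reflexivity).
    swn 1%N ltac:(fun _ => exact: swMr).
    swn 1%N ltac:(fun _ => apply: (congr1 ( *:%R _)); apply: De_counitr; mlin).
    by apply: De_counitr; mlin.
  move=> ->; symmetry.
  swn 3%N ltac:(fun _ => eapply De_one_sw; mlin).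
  swn 3%N ltac:(fun _ => eapply De_one_sw; mlin).
  swn 3%N ltac:(fun _ => eapply De_one_sw; mlin).
  swbot ltac:(fun _ => rewrite om_h1g mulHh1 counit_one mulr1 -mulrA; reflexivity).
  swbot ltac:(fun _ => exact: mul_scale).
  swn 2%N ltac:(fun _ => symmetry; exact: swZr).
  swn 1%N ltac:(fun _ => eapply De_counitl; mlin).
  done.
have := omega_mulVr x y hone; rewrite counit_one mulr1 => <-.
symmetry; rewrite -[LHS]/(\S_(g1, g2 <- De x) \S_(x1, x2 <- De y) \S_(h1, h2 <- De (hone : H)) 
   (om g1 x1 h1 * omi g2 x2 h2 : k^o)).
by swn 2%N ltac:(fun _ => eapply De_one_sw; mlin).
Qed.
End Associator.

Canonical ctens.
Notation "U \CX V" := (ctens U V) (at level 40, left associativity).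

Section TensorMaps.
Variable k : fieldType.
Implicit Types M N U V W X Z : lmodType k.

Lemma sw_tl U V U' X (f : {linear U -> U'}) (t : U \OX V) (F : U' -> V -> X) : bilin F ->
  sw (tl f t) F = \S_(x, y <- t) F (f x) y.
Proof.
by move=> FB; rewrite ?tl_sw ?tr_sw sw_bind //; apply: eq_sw => x y; rewrite sw_pure.
Qed.

Lemma tl_tr U V U' V' (f : {linear U -> U'}) (g : {linear V -> V'}) (t : U \OX V) :
  tl f (tr g t) = tr g (tl f t).
Proof. by move: t; apply: tens_eq => [||u v]; [mlin|mlin|rewrite !(tlE, trE)]. Qed.

Lemma eq_tl U V U' U1 U2 (f : {linear U -> U1}) (g : {linear U1 -> U'})
  (f' : {linear U -> U2}) (g' : {linear U2 -> U'}) (t : U \OX V) :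
  (forall u, g (f u) = g' (f' u)) -> tl g (tl f t) = tl g' (tl f' t).
Proof. by move=> e; move: t; apply: tens_eq => [||u v]; [mlin|mlin|rewrite !tlE e]. Qed.

Lemma eq_tr U V V' V1 V2 (f : {linear V -> V1}) (g : {linear V1 -> V'})
  (f' : {linear V -> V2}) (g' : {linear V2 -> V'}) (t : U \OX V) :
  (forall v, g (f v) = g' (f' v)) -> tr g (tr f t) = tr g' (tr f' t).
Proof. by move=> e; move: t; apply: tens_eq => [||u v]; [mlin|mlin|rewrite !trE e]. Qed.

Lemma tl_comp U V U' U1 (f : {linear U -> U1}) (g : {linear U1 -> U'})
  (h : {linear U -> U'}) (t : U \OX V) :
  (forall u, h u = g (f u)) -> tl h t = tl g (tl f t).
Proof. by move=> e; move: t; apply: tens_eq => [||u v]; [mlin|mlin|rewrite !tlE e]. Qed.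

Lemma tr_comp U V V' V1 (f : {linear V -> V1}) (g : {linear V1 -> V'})
  (h : {linear V -> V'}) (t : U \OX V) :
  (forall v, h v = g (f v)) -> tr h t = tr g (tr f t).
Proof. by move=> e; move: t; apply: tens_eq => [||u v]; [mlin|mlin|rewrite !trE e]. Qed.

Lemma tl_can U V U1 (f : {linear U -> U1}) (g : {linear U1 -> U}) (t : U \OX V) :
  cancel f g -> tl g (tl f t) = t.
Proof. by move=> e; move: t; apply: tens_eq => [||u v]; [mlin|mlin|rewrite !tlE e]. Qed.
Lemma tr_can U V V1 (f : {linear V -> V1}) (g : {linear V1 -> V}) (t : U \OX V) :
  cancel f g -> tr g (tr f t) = t.
Proof. by move=> e; move: t; apply: tens_eq => [||u v]; [mlin|mlin|rewrite !trE e]. Qed.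
End TensorMaps.

(** * Colinear maps, naturality of the associator and coinvariant factors *)

Section Colinear.
Variables (k : fieldType) (H : coquasiBialgebra k).
Implicit Types U V W Z : comod H.

Definition colin U V (f : {linear U -> V}) : Prop := forall u, rho (f u) = tl f (rho u).

Definition cinv U (u : U) : Prop := rho u = u \ox hone.

Lemma rho_tens U V (u : U) (v : V) : rho (u \ox v) =
  \S_(u0, u1 <- rho u) \S_(v0, v1 <- rho v) ((u0 \ox v0) \ox (u1 ** v1)).
Proof. exact: tens_rhoE. Qed.

Lemma rho_tens_sw (X : lmodType k) U V (u : U) (v : V) (F : U \OX V -> H -> X) : bilin F ->
  \S_(x, y <- rho (u \ox v)) F x y =
  \S_(u0, u1 <- rho u) \S_(v0, v1 <- rho v) F (u0 \ox v0) (u1 ** v1).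
Proof. exact: tens_rho_sw. Qed.

Lemma cinv_sw U (X : lmodType k) (u : U) (F : U -> H -> X) : cinv u -> bilin F ->
  \S_(x, y <- rho u) F x y = F u hone.
Proof. by move=> -> FB; rewrite sw_pure. Qed.

Lemma cinv_map U V (f : {linear U -> V}) u : colin f -> cinv u -> cinv (f u).
Proof. by move=> fc uc; rewrite /cinv fc uc tlE. Qed.

Lemma colin_comp U V W (f : {linear U -> V}) (g : {linear V -> W}) (h : {linear U -> W}) :
  (forall u, h u = g (f u)) -> colin f -> colin g -> colin h.
Proof. by move=> e fc gc u; rewrite e gc fc -(tl_comp _ e). Qed.

Lemma colin_tl U V U' (f : {linear U -> U'}) : colin f ->
  colin (tl f : {linear U \CX V -> U' \CX V}).
Proof.
move=> fc; apply: tens_eq => [||u v]; [mlin|mlin|].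
rewrite tlE !rho_tens fc sw_tl; last by mlin.
by symmetry; swpush; swbot ltac:(fun _ => rewrite !tlE; reflexivity).
Qed.

Lemma colin_tr U V V' (f : {linear V -> V'}) : colin f ->
  colin (tr f : {linear U \CX V -> U \CX V'}).
Proof.
move=> fc; apply: tens_eq => [||u v]; [mlin|mlin|].
rewrite trE !rho_tens fc; swn 1%N ltac:(fun _ => eapply sw_tl; mlin).
by symmetry; swpush; swbot ltac:(fun _ => rewrite !tlE trE; reflexivity).
Qed.

Lemma rho_mul1r U V (u : U) (v : V) : cinv v -> rho (u \ox v) = tl (pul U v) (rho u).
Proof.
move=> vc; rewrite rho_tens; swn 1%N ltac:(fun _ => eapply cinv_sw; [exact: vc | mlin]).
by rewrite tl_sw; apply: eq_sw => x y; rewrite mulHh1.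
Qed.

Lemma rho_mul1l U V (u : U) (v : V) : cinv u -> rho (u \ox v) = tl (pur V u) (rho v).
Proof.
move=> uc; rewrite rho_tens cinv_sw //; last by mlin.
by rewrite tl_sw; apply: eq_sw => x y; rewrite mulH1h.
Qed.

Lemma colin_pul U V (v : V) : cinv v -> colin (pul U v : {linear U -> U \CX V}).
Proof. by move=> vc u; apply: rho_mul1r. Qed.
Lemma colin_pur U V (u : U) : cinv u -> colin (pur V u : {linear V -> U \CX V}).
Proof. by move=> uc v; apply: rho_mul1l. Qed.

Section Natural.
Variables (U V W U' V' W' : comod H).
Variables (f : {linear U -> U'}) (g : {linear V -> V'}) (h : {linear W -> W'}).
Hypotheses (fc : colin f) (gc : colin g) (hc : colin h).

Lemma assoc_nl (t : U \OX V \OX W) : assoc U' V W (tl (tl f) t) = tl f (assoc U V W t).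
Proof.
move: t; apply: tens_eq3l => [||u v w]; [mlin|mlin|].
rewrite !tlE !assocE fc sw_tl; last by mlin.
by symmetry; swpush; swbot ltac:(fun _ => rewrite !tlE; reflexivity).
Qed.

Lemma assoc_nm (t : U \OX V \OX W) : assoc U V' W (tl (tr g) t) = tr (tl g) (assoc U V W t).
Proof.
move: t; apply: tens_eq3l => [||u v w]; [mlin|mlin|].
rewrite !tlE !trE !assocE gc; swn 1%N ltac:(fun _ => eapply sw_tl; mlin).
by symmetry; swpush; swbot ltac:(fun _ => rewrite !trE tlE; reflexivity).
Qed.

Lemma assoc_nr (t : U \OX V \OX W) : assoc U V W' (tr h t) = tr (tr h) (assoc U V W t).
Proof.
move: t; apply: tens_eq3l => [||u v w]; [mlin|mlin|].
rewrite !trE !assocE hc; swn 2%N ltac:(fun _ => eapply sw_tl; mlin).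
by symmetry; swpush; swbot ltac:(fun _ => rewrite !trE; reflexivity).
Qed.

Lemma associ_nl (t : U \OX (V \OX W)) : associ U' V W (tl f t) = tl (tl f) (associ U V W t).
Proof. by rewrite -{1}[t]associK -assoc_nl assocK. Qed.

Lemma associ_nm (t : U \OX (V \OX W)) :
  associ U V' W (tr (tl g) t) = tl (tr g) (associ U V W t).
Proof. by rewrite -{1}[t]associK -assoc_nm assocK. Qed.

Lemma associ_nr (t : U \OX (V \OX W)) : associ U V W' (tr (tr h) t) = tr h (associ U V W t).
Proof. by rewrite -{1}[t]associK -assoc_nr assocK. Qed.
End Natural.

Section Units.
Variables (U V W : comod H) (u : U) (v : V) (w : W).

(** A coinvariant factor puts 1_H into omega, which becomes a product of two counits; these cancel
    the two remaining coactions. This lemma and its variants are the reason why elements of B and of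
    L associate strictly with everything else. *)
Lemma assoc1l : cinv u -> assoc U V W (u \ox v \ox w) = u \ox (v \ox w).
Proof.
move=> uc; rewrite assocE cinv_sw //; last by mlin.
swbot ltac:(fun _ => rewrite om_1hg -scalerA; reflexivity).
swn 1%N ltac:(fun _ => symmetry; exact: swZr).
swn 1%N ltac:(fun _ => apply: (congr1 ( *:%R _)); eapply (@Ro_counit _ _ W); mlin).
by apply: (@Ro_counit _ _ V _ _ (fun v => u \ox (v \ox w))); mlin.
Qed.

Lemma assoc1m : cinv v -> assoc U V W (u \ox v \ox w) = u \ox (v \ox w).
Proof.
move=> vc; rewrite assocE.
swn 1%N ltac:(fun _ => eapply cinv_sw; [exact: vc | mlin]).
swbot ltac:(fun _ => rewrite om_h1g -scalerA; reflexivity).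
swn 1%N ltac:(fun _ => symmetry; exact: swZr).
swn 1%N ltac:(fun _ => apply: (congr1 ( *:%R _)); eapply (@Ro_counit _ _ W); mlin).
by apply: (@Ro_counit _ _ U _ _ (fun u => u \ox (v \ox w))); mlin.
Qed.

Lemma assoc1r : cinv w -> assoc U V W (u \ox v \ox w) = u \ox (v \ox w).
Proof.
move=> wc; rewrite assocE.
swn 2%N ltac:(fun _ => eapply cinv_sw; [exact: wc | mlin]).
swbot ltac:(fun _ => rewrite om_hg1 -scalerA; reflexivity).
swn 1%N ltac:(fun _ => symmetry; exact: swZr).
swn 1%N ltac:(fun _ => apply: (congr1 ( *:%R _)); eapply (@Ro_counit _ _ V); mlin).
by apply: (@Ro_counit _ _ U _ _ (fun u => u \ox (v \ox w))); mlin.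
Qed.

Lemma associ1l : cinv u -> associ U V W (u \ox (v \ox w)) = u \ox v \ox w.
Proof. by move=> uc; rewrite -assoc1l // assocK. Qed.
Lemma associ1m : cinv v -> associ U V W (u \ox (v \ox w)) = u \ox v \ox w.
Proof. by move=> vc; rewrite -assoc1m // assocK. Qed.
Lemma associ1r : cinv w -> associ U V W (u \ox (v \ox w)) = u \ox v \ox w.
Proof. by move=> wc; rewrite -assoc1r // assocK. Qed.
End Units.

(** Quasi-associativity of the product of H is exactly this statement, read off on the coaction
    legs. *)
Lemma colin_assoc U V W :
  colin (assoc U V W : {linear U \CX V \CX W -> U \CX (V \CX W)}).
Proof.
apply: tens_eq3l => [||u v w]; [mlin|mlin|].
rewrite assocE; swpush.
swn 3%N ltac:(fun _ => rewrite rho_tens; reflexivity).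
swpush.
swn 4%N ltac:(fun _ => eapply rho_tens_sw; mlin).
etransitivity; [eapply Ro3_coassoc; move=> *; mlin | ]; cbv beta.
symmetry.
rewrite rho_tens; swpush; rewrite rho_tens_sw; last by mlin.
swbot ltac:(fun _ => rewrite tlE assocE; reflexivity).
swpush.
etransitivity; [eapply Ro3_coassoc; move=> *; mlin | ]; cbv beta.
apply: eq_sw => u0 h; apply: eq_sw => v0 g; apply: eq_sw => w0 x.
by symmetry; apply: (quasiA_lin _ _ _ (G := fun h => (u0 \ox (v0 \ox w0)) \ox h)); mlin.
Qed.

Lemma colin_associ U V W :
  colin (associ U V W : {linear U \CX (V \CX W) -> U \CX V \CX W}).
Proof.
by move=> t; rewrite -{2}[t]associK colin_assoc tl_can //; exact: assocK.
Qed.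
End Colinear.

Section Pentagon.
Variables (k : fieldType) (H : coquasiBialgebra k) (U V W Z : comod H).

Lemma om_cocycle_scale (X : lmodType k) (h g x y : H) (v : X) :
  \S_(h1, h2 <- De h) \S_(g1, g2 <- De g) \S_(x1, x2 <- De x) \S_(y1, y2 <- De y)
      ((om h1 g1 (x1 ** y1) * om (h2 ** g2) x2 y2) *: v) =
  \S_(h1, h2 <- De h) \S_(g1, g' <- De g) \S_(g2, g3 <- De g')
  \S_(x1, x' <- De x) \S_(x2, x3 <- De x') \S_(y1, y2 <- De y)
      ((om g1 x1 y1 * om h1 (g2 ** x2) y2 * om h2 g3 x3) *: v).
Proof.
transitivity ((\S_(h1, h2 <- De h) \S_(g1, g2 <- De g) \S_(x1, x2 <- De x)
  \S_(y1, y2 <- De y) (om h1 g1 (x1 ** y1) * om (h2 ** g2) x2 y2 : k^o) : k) *: v).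
  swn 3%N ltac:(fun _ => exact: swZl).
  swn 2%N ltac:(fun _ => exact: swZl).
  by swn 1%N ltac:(fun _ => exact: swZl); rewrite swZl.
rewrite om_cocycle; symmetry.
swn 5%N ltac:(fun _ => exact: swZl).
swn 4%N ltac:(fun _ => exact: swZl).
swn 3%N ltac:(fun _ => exact: swZl).
swn 2%N ltac:(fun _ => exact: swZl).
by swn 1%N ltac:(fun _ => exact: swZl); rewrite swZl.
Qed.

(** Once all coactions are gathered by coassociativity, the coefficients on the two sides are those
    of the cocycle identity for omega; the long run of exchanges only reorders the sums. *)
Lemma pentagon (t : U \OX V \OX W \OX Z) :
  tr (assoc V W Z) (assoc U (V \CX W) Z (tl (assoc U V W) t)) =
  assoc U V (W \CX Z) (assoc (U \CX V) W Z t).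
Proof.
move: t; apply: tens_eq4l => [||u v w z]; [mlin|mlin|].
rewrite tlE assocE; swpush.
swbot ltac:(fun _ => rewrite assocE; reflexivity).
swpush.
swn 4%N ltac:(fun _ => eapply rho_tens_sw; mlin).
swbot ltac:(fun _ => rewrite trE assocE; reflexivity).
swpush.
swn 2%N ltac:(fun _ => exact: sw_swap).
swn 1%N ltac:(fun _ => exact: sw_swap).
swn 3%N ltac:(fun _ => exact: sw_swap).
swn 6%N ltac:(fun _ => exact: sw_swap).
swn 5%N ltac:(fun _ => exact: sw_swap).
swn 4%N ltac:(fun _ => exact: sw_swap).
swn 7%N ltac:(fun _ => exact: sw_swap).
swn 0%N ltac:(fun _ => eapply Ro_coassoc; mlin).
swn 2%N ltac:(fun _ => eapply Ro_coassoc; mlin).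
swn 3%N ltac:(fun _ => exact: sw_swap).
swn 2%N ltac:(fun _ => eapply Ro_coassoc; mlin).
swn 5%N ltac:(fun _ => eapply Ro_coassoc; mlin).
swn 6%N ltac:(fun _ => exact: sw_swap).
swn 5%N ltac:(fun _ => eapply Ro_coassoc; mlin).
swn 8%N ltac:(fun _ => eapply Ro_coassoc; mlin).
swn 1%N ltac:(fun _ => exact: sw_swap).
swn 4%N ltac:(fun _ => exact: sw_swap).
swn 3%N ltac:(fun _ => exact: sw_swap).
swn 2%N ltac:(fun _ => exact: sw_swap).
swn 7%N ltac:(fun _ => exact: sw_swap).
swn 6%N ltac:(fun _ => exact: sw_swap).
swn 5%N ltac:(fun _ => exact: sw_swap).
swn 4%N ltac:(fun _ => exact: sw_swap).
swn 3%N ltac:(fun _ => exact: sw_swap).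
swbot ltac:(fun _ => rewrite !scalerA -mulrA mulrC [X in X * _]mulrC; reflexivity).
symmetry.
rewrite assocE rho_tens_sw; last by mlin.
swpush.
swbot ltac:(fun _ => rewrite assocE; reflexivity).
swpush.
swn 6%N ltac:(fun _ => eapply rho_tens_sw; mlin).
swn 3%N ltac:(fun _ => exact: sw_swap).
swn 2%N ltac:(fun _ => exact: sw_swap).
swn 1%N ltac:(fun _ => exact: sw_swap).
swn 4%N ltac:(fun _ => exact: sw_swap).
swn 3%N ltac:(fun _ => exact: sw_swap).
swn 5%N ltac:(fun _ => exact: sw_swap).
swn 0%N ltac:(fun _ => eapply Ro_coassoc; mlin).
swn 2%N ltac:(fun _ => eapply Ro_coassoc; mlin).
swn 4%N ltac:(fun _ => eapply Ro_coassoc; mlin).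
swn 6%N ltac:(fun _ => eapply Ro_coassoc; mlin).
swn 1%N ltac:(fun _ => exact: sw_swap).
swn 3%N ltac:(fun _ => exact: sw_swap).
swn 2%N ltac:(fun _ => exact: sw_swap).
swn 5%N ltac:(fun _ => exact: sw_swap).
swn 4%N ltac:(fun _ => exact: sw_swap).
swn 3%N ltac:(fun _ => exact: sw_swap).
swbot ltac:(fun _ => rewrite scalerA mulrC; reflexivity).
do 4 (apply: eq_sw => ? ?).
exact: om_cocycle_scale.
Qed.

Lemma pentagon_associ (t : U \OX (V \OX (W \OX Z))) :
  associ U (V \CX W) Z (tr (associ V W Z) t) =
  tl (assoc U V W) (associ (U \CX V) W Z (associ U V (W \CX Z) t)).
Proof.
set s := associ _ _ _ (associ _ _ _ _).
rewrite (_ : t = tr (assoc V W Z) (assoc U (V \CX W) Z (tl (assoc U V W) s))).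
  by rewrite tr_can ?assocK //; exact: assocK.
by rewrite pentagon /s !associK.
Qed.
End Pentagon.

(** * Modules over a comodule algebra *)

Section ComoduleAlgebra.
Variables (k : fieldType) (H : coquasiBialgebra k) (A : comoduleAlgebra H).

Definition coactA : {linear A -> A \OX H} := coact.

Lemma coactA_coassoc (a : A) :
    \S_(u', u2 <- coactA a) \S_(u0, u1 <- coactA u') (u0 \ox (u1 \ox u2)) =
    \S_(u0, h <- coactA a) \S_(u1, u2 <- De h) (u0 \ox (u1 \ox u2)).
Proof.
symmetry; swn 1%N ltac:(fun _ => symmetry; exact: pu_expand).
exact: coact_coassoc.
Qed.

Definition comodA : comod H := Comod coactA_coassoc (@coact_counit k H A).

Definition mulA : {linear comodA \OX comodA -> comodA} := amul_lin A.

Lemma colin_mulA : colin (mulA : {linear comodA \CX comodA -> comodA}).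
Proof.
apply: tens_eq => [||a b]; [mlin|mlin|].
have -> : rho (mulA (a \ox b)) =
  \S_(a0, a1 <- rho a) \S_(b0, b1 <- rho b) (mulA (a0 \ox b0) \ox (a1 ** b1)).
  exact: coact_mul.
rewrite rho_tens; symmetry; swpush.
by swbot ltac:(fun _ => rewrite tlE; reflexivity).
Qed.

Lemma rho_mulA_sw (X : lmodType k) (a b : comodA) (F : comodA -> H -> X) : bilin F ->
  \S_(x, y <- rho (mulA (a \ox b))) F x y =
  \S_(a0, a1 <- rho a) \S_(b0, b1 <- rho b) F (mulA (a0 \ox b0)) (a1 ** b1).
Proof.
move=> FB; rewrite colin_mulA sw_tl // rho_tens_sw //.
by split=> z c x y; [rewrite linearP; exact: FB.1 | exact: FB.2].
Qed.

Lemma mulA_assoc (t : comodA \OX comodA \OX comodA) :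
  mulA (tl mulA t) = mulA (tr mulA (assoc comodA comodA comodA t)).
Proof.
move: t; apply: tens_eq3l => [||a b c]; [mlin|mlin|].
rewrite tlE assocE; symmetry; swpush.
swbot ltac:(fun _ => rewrite trE; reflexivity).
by symmetry; exact: amul_quasiA.
Qed.

Lemma cinv_one : cinv (aone : comodA). Proof. exact: coact_one. Qed.
Lemma cinv_coinv (b : coinv A) : cinv ((b : A) : comodA). Proof. exact: coact_coinv. Qed.
Lemma mul1A (a : comodA) : mulA (aone \ox a) = a. Proof. exact: amul1a. Qed.
Lemma mulA1 (a : comodA) : mulA (a \ox aone) = a. Proof. exact: amula1. Qed.

Implicit Types (U V W : comod H).

(** The action that makes A (x) W the free left A-module on W in the monoidal category; the inverse
    associator is part of it. *)
Definition lact (W : comod H) : {linear comodA \OX (comodA \OX W) -> comodA \OX W} :=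
  tl mulA \o associ comodA comodA W.

Lemma lact_def W t : lact W t = tl mulA (associ comodA comodA W t).
Proof. by []. Qed.

Lemma colin_lact W : colin (lact W : {linear comodA \CX (comodA \CX W) -> comodA \CX W}).
Proof.
apply: (colin_comp (lact_def (W := W))); first exact: colin_associ.
exact/colin_tl/colin_mulA.
Qed.

Lemma lact_nat W (W' : comod H) (f : {linear W -> W'}) t : colin f ->
  lact W' (tr (tr f) t) = tr f (lact W t).
Proof. by move=> fc; rewrite !lact_def associ_nr // -tl_tr. Qed.

Lemma lact_assoc W t :
  lact W (tr (lact W) t) = lact W (lact (comodA \CX W) t).
Proof.
rewrite !lact_def (tr_comp _ (lact_def (W := W))).
rewrite associ_nm; last exact: colin_mulA.
rewrite pentagon_associ.
rewrite associ_nl; last exact: colin_mulA.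
move: (associ _ _ _ (associ _ _ _ t)); apply: tens_eq => [||u w]; [mlin|mlin|].
by rewrite !tlE mulA_assoc.
Qed.

Lemma lact1 W (t : comodA \OX W) : lact W (aone \ox t) = t.
Proof.
move: t; apply: tens_eq => [||a w]; [mlin|mlin|].
by rewrite lact_def associ1l ?tlE ?mul1A //; exact: cinv_one.
Qed.

Section LactCinv.
Variables (W : comod H) (a b : comodA) (w : W).
Lemma lact_cinvl : cinv a -> lact W (a \ox (b \ox w)) = mulA (a \ox b) \ox w.
Proof. by move=> ac; rewrite lact_def associ1l // tlE. Qed.
Lemma lact_cinvm : cinv b -> lact W (a \ox (b \ox w)) = mulA (a \ox b) \ox w.
Proof. by move=> ac; rewrite lact_def associ1m // tlE. Qed.
Lemma lact_cinvr : cinv w -> lact W (a \ox (b \ox w)) = mulA (a \ox b) \ox w.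
Proof. by move=> ac; rewrite lact_def associ1r // tlE. Qed.
End LactCinv.

Lemma mulA_lact t : mulA (lact comodA t) = mulA (tr mulA t).
Proof. by rewrite lact_def mulA_assoc associK. Qed.

(** Relative Hopf modules, with associativity demanded at a coinvariant middle factor, where no
    associator appears. This is what makes the canonical map balanced over B ([canmB]), and it
    passes to V (x) M by naturality. *)
Record rmod := Rmod {
  rm :> comod H;
  ract : {linear rm \OX comodA -> rm};
  colin_ract : colin (ract : {linear rm \CX comodA -> rm});
  ractB : forall (m : rm) (b a : comodA), cinv b ->
    ract (ract (m \ox b) \ox a) = ract (m \ox mulA (b \ox a));
  ract1 : forall m : rm, ract (m \ox aone) = m
}.

Lemma colin_mulr (b : comodA) : cinv b -> @colin _ _ comodA comodA (mulA \o pul comodA b).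
Proof.
by move=> bc; apply: (@colin_comp _ _ _ (comodA \CX comodA) _ (pul comodA b) mulA) => //;
  [exact: colin_pul | exact: colin_mulA].
Qed.
Lemma colin_mull (b : comodA) : cinv b -> @colin _ _ comodA comodA (mulA \o pur comodA b).
Proof.
by move=> bc; apply: (@colin_comp _ _ _ (comodA \CX comodA) _ (pur comodA b) mulA) => //;
  [exact: colin_pur | exact: colin_mulA].
Qed.
Lemma colin_ractr (M : rmod) (b : comodA) : cinv b -> @colin _ _ M M (ract M \o pul M b).
Proof.
by move=> bc; apply: (@colin_comp _ _ _ (M \CX comodA) _ (pul M b) (ract M)) => //;
  [exact: colin_pul | exact: colin_ract].
Qed.

Lemma mulA_cinvm (a b c : comodA) : cinv b ->
  mulA (mulA (a \ox b) \ox c) = mulA (a \ox mulA (b \ox c)).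
Proof. by move=> bc; have := mulA_assoc (a \ox b \ox c); rewrite tlE assoc1m // trE. Qed.

Definition rmodA : rmod := Rmod colin_mulA mulA_cinvm mulA1.

Section TensRmod.
Variables (V : comod H) (M : rmod).

Definition tens_ract : {linear (V \CX M) \OX comodA -> V \CX M} :=
  tr (ract M) \o assoc V M comodA.

Lemma colin_tens_ract : colin (tens_ract : {linear (V \CX M) \CX comodA -> V \CX M}).
Proof.
apply: (colin_comp (f := assoc V M comodA) (g := tr (ract M))) => //.
  exact: colin_assoc.
exact/colin_tr/colin_ract.
Qed.

Lemma tens_ract_cinv (v : V) (m : M) (b : comodA) : cinv b ->
  tens_ract ((v \ox m) \ox b) = v \ox ract M (m \ox b).
Proof. by move=> bc; rewrite /tens_ract /= assoc1r // trE. Qed.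

(** For coinvariant b the maps m |-> mb and a |-> ba are colinear, so naturality carries them
    through the associator and leaves the law of M. *)
Lemma tens_ractB (t : V \CX M) (b a : comodA) : cinv b ->
  tens_ract (tens_ract (t \ox b) \ox a) = tens_ract (t \ox mulA (b \ox a)).
Proof.
move=> bc; move: t; apply: tens_eq => [||v m]; [mlin|mlin|].
rewrite tens_ract_cinv //.
have := assoc_nm (@colin_ractr M b bc) (v \ox m \ox a).
have := assoc_nr (colin_mull bc) (v \ox m \ox a).
rewrite tlE !trE /= => e1 e2; rewrite /tens_ract /= e1 e2; apply: eq_tr => {e1 e2}.
apply: tens_eq => [||m' a']; [mlin|mlin|].
by rewrite tlE trE /= ractB.
Qed.

Lemma tens_ract1 (t : V \CX M) : tens_ract (t \ox aone) = t.
Proof.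
move: t; apply: tens_eq => [||v m]; [mlin|mlin|].
by rewrite tens_ract_cinv ?ract1 //; exact: cinv_one.
Qed.

Definition tens_rmod : rmod := Rmod colin_tens_ract tens_ractB tens_ract1.
End TensRmod.
End ComoduleAlgebra.

Arguments comodA {k H} A.
Arguments mulA {k H} A.
Arguments lact {k H} A W.
Arguments rmodA {k H} A.
Arguments tens_ract {k H A} V M.
Arguments tens_rmod {k H A} V M.
Arguments colin_mulA {k H} A _.
Arguments lact_assoc {k H A W} t.
Arguments lact_nat {k H A W W'} f t.
Arguments colin_ractr {k H A} M {b}.

(** * The twisted multiplication *)

Section TwistedEndomorphisms.
Variables (k : fieldType) (H : coquasiBialgebra k) (A : comoduleAlgebra H).
Local Notation cA := (comodA A).
Local Notation AA := (cA \CX cA).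
Local Notation m := (mulA A).
Local Notation ra := (tens_ract cA (rmodA A)).

Lemma ra_def t : ra t = tr m (assoc cA cA cA t).
Proof. by []. Qed.

Lemma colin_ra : @colin _ _ (AA \CX cA) AA ra.
Proof. exact (@colin_tens_ract _ _ A cA (rmodA A)). Qed.

Lemma ra_assoc (t : AA \OX cA \OX cA) : ra (tl ra t) = ra (tr m (assoc AA cA cA t)).
Proof.
rewrite !ra_def (tl_comp _ ra_def) (assoc_nm (colin_mulA A)) (assoc_nr (colin_mulA A)).
rewrite -pentagon; move: (assoc cA AA cA _).
apply: tens_eq => [||a u]; [mlin|mlin|]; rewrite !trE; congr (_ \ox _).
exact: mulA_assoc.
Qed.

(** The two actions multiply in different tensor factors; naturality separates the multiplications,
    and what remains is the pentagon. *)
Lemma bimod (t : (cA \OX AA) \OX cA) :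
  ra (tl (lact A cA) t) = lact A cA (tr ra (assoc cA AA cA t)).
Proof.
rewrite !ra_def !lact_def (tl_comp _ (@lact_def _ _ A cA)) (tr_comp _ ra_def).
rewrite (assoc_nl (colin_mulA A)) (associ_nr (colin_mulA A)) -tl_tr.
congr (tl _ _); congr (tr _ _); apply: (can_inj (@assocK _ _ cA cA AA)).
rewrite associK -pentagon; congr (tr _ _); congr (assoc _ _ _ _).
by rewrite tl_can //; exact: associK.
Qed.

(* For coinvariant y, right multiplication x |-> xy of L is the restriction of the colinear
   A-bimodule endomorphism [Tw y] of A (x) A sending 1 (x) 1 to y; such endomorphisms compose,
   whence the associativity of L. *)
Definition xi (y : AA) : {linear cA -> AA} := ra \o pur cA y.
Definition lam (y : AA) : {linear cA -> AA} := lact A cA \o pul cA y.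
Definition Tw (y : AA) : {linear AA -> AA} := lact A cA \o tr (xi y).

Lemma xiE y a : xi y a = ra (y \ox a). Proof. by []. Qed.
Lemma lamE y a : lam y a = lact A cA (a \ox y). Proof. by []. Qed.
Lemma Tw_def y t : Tw y t = lact A cA (tr (xi y) t). Proof. by []. Qed.
Lemma TwE y a b : Tw y (a \ox b) = lact A cA (a \ox ra (y \ox b)).
Proof. by rewrite Tw_def trE. Qed.

Section Coinvariant.
Variables (y : AA) (yc : cinv y).

Lemma colin_xi : @colin _ _ cA AA (xi y).
Proof.
by apply: (@colin_comp _ _ _ (AA \CX cA) _ (pur cA y) ra) => //;
  [exact: colin_pur | exact: colin_ra].
Qed.

Lemma colin_lam : @colin _ _ cA AA (lam y).
Proof.
by apply: (@colin_comp _ _ _ (cA \CX AA) _ (pul cA y) (lact A cA)) => //;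
  [exact: colin_pul | exact: colin_lact].
Qed.

Lemma colin_Tw : @colin _ _ AA AA (Tw y).
Proof.
by apply: (@colin_comp _ _ _ (cA \CX AA) _ (tr (xi y)) (lact A cA)) => //;
  [exact/colin_tr/colin_xi | exact: colin_lact].
Qed.

Lemma xi_mul (t : cA \OX cA) : xi y (m t) = ra (tl (xi y) t).
Proof.
move: t; apply: tens_eq => [||a b]; [mlin|mlin|].
by rewrite tlE !xiE; have := ra_assoc (y \ox a \ox b); rewrite tlE assoc1l // trE.
Qed.

Lemma lam_mul (a b : cA) : lam y (m (a \ox b)) = lact A cA (a \ox lam y b).
Proof.
rewrite !lamE; have := lact_assoc (a \ox (b \ox y)).
by rewrite trE lact_cinvr // => ->.
Qed.

Lemma Tw_lact (t : cA \OX AA) : Tw y (lact A cA t) = lact A cA (tr (Tw y) t).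
Proof.
by rewrite Tw_def -lact_nat ?(tr_comp _ (Tw_def y)) ?lact_assoc //; exact: colin_xi.
Qed.

Lemma Tw_ra (t : AA \OX cA) : Tw y (ra t) = ra (tl (Tw y) t).
Proof.
rewrite Tw_def (tl_comp _ (Tw_def y)) bimod (assoc_nm colin_xi) ra_def; congr (lact _ _ _).
by apply: eq_tr => v; exact: xi_mul.
Qed.
End Coinvariant.

(** [Tw z] is linear for both actions, so in a(yb) it passes to the inside and replaces y by
    [Tw z y]. *)
Lemma Tw_Tw (y z x : AA) : cinv y -> cinv z -> Tw z (Tw y x) = Tw (Tw z y) x.
Proof.
move=> yc zc; move: x; apply: tens_eq => [||a b]; [mlin|mlin|].
by rewrite !TwE Tw_lact // trE Tw_ra // tlE.
Qed.

Lemma Tw_one (y : AA) : Tw y (aone \ox aone) = y.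
Proof. by rewrite TwE lact1 tens_ract1. Qed.

Lemma ra_cinvl (a b c : cA) : cinv a -> ra ((a \ox b) \ox c) = a \ox m (b \ox c).
Proof. by move=> ac; rewrite ra_def assoc1l // trE. Qed.
Lemma ra_cinvr (a b c : cA) : cinv c -> ra ((a \ox b) \ox c) = a \ox m (b \ox c).
Proof. by move=> ac; rewrite ra_def assoc1r // trE. Qed.

Lemma one_Tw (x : AA) : Tw (aone \ox aone) x = x.
Proof.
move: x; apply: tens_eq => [||a b]; [mlin|mlin|].
rewrite TwE ra_cinvl ?lact_cinvm ?mulA1 ?mul1A //; exact: cinv_one.
Qed.

Lemma TwD (y z x : AA) : Tw (y + z) x = Tw y x + Tw z x.
Proof.
have L (y' z' : AA) : lin (fun t => Tw y' t + Tw z' t).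
  by move=> a u v; rewrite !linearP scalerDr addrACA.
by move: x; apply: tens_eq => [||a b]; [mlin|exact: L|rewrite !TwE puDl linearD puDr linearD].
Qed.

End TwistedEndomorphisms.

Section TwistedMul.
Variables (k : fieldType) (H : coquasiBialgebra k) (A : comoduleAlgebra H).
Local Notation cA := (comodA A).
Local Notation AA := (cA \CX cA).
Local Notation m := (mulA A).

Lemma Tw_lin_arg (x : AA) : lin (fun y => Tw y x).
Proof.
move=> c y z; move: x; apply: tens_eq => [||a b]; first by mlin.
  by move=> d u v; rewrite !(linearP (Tw _)) !scalerDr !scalerA [d * c]mulrC addrACA.
by rewrite !TwE puDl puZl linearP puDr puZr linearP.
Qed.

(** In a((c (x) d)b) the right action contributes omega(c, d, b) and the left action omega^{-1}(a,
    c, db); since the coaction is multiplicative on db, these are the two factors of the twisted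
    product. *)
Lemma twisted_mulE (x y : AA) : twisted_mul x y = Tw y x.
Proof.
have -> : twisted_mul x y = \S_(a, b <- x) \S_(c, d <- y)
  \S_(a0, a1 <- rho a) \S_(c0, c' <- rho c) \S_(c1, c2 <- De c')
  \S_(d0, d' <- rho d) \S_(d1, d2 <- De d') \S_(b0, b' <- rho b) \S_(b1, b2 <- De b')
  ((omi a1 c1 (d1 ** b1) * om c2 d2 b2) *: (m (a0 \ox c0) \ox m (d0 \ox b0))) by [].
move: x; apply: tens_eq => [||a b]; [mlin|mlin|]; rewrite sw_pure; last by mlin.
move: y; apply: tens_eq => [||c d]; [mlin|exact: Tw_lin_arg|]; rewrite sw_pure; last by mlin.
symmetry; rewrite TwE ra_def assocE; swpush.
swbot ltac:(fun _ => rewrite trE lact_def associE; reflexivity).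
swpush.
swn 5%N ltac:(fun _ => eapply rho_mulA_sw; mlin).
swbot ltac:(fun _ => rewrite tlE; reflexivity).
swn 2%N ltac:(fun _ => exact: sw_swap).
swn 1%N ltac:(fun _ => exact: sw_swap).
swn 0%N ltac:(fun _ => exact: sw_swap).
swn 3%N ltac:(fun _ => exact: sw_swap).
swn 2%N ltac:(fun _ => exact: sw_swap).
swn 4%N ltac:(fun _ => exact: sw_swap).
swn 1%N ltac:(fun _ => eapply Ro_coassoc; mlin).
swn 3%N ltac:(fun _ => eapply Ro_coassoc; mlin).
swn 5%N ltac:(fun _ => eapply Ro_coassoc; mlin).
by swbot ltac:(fun _ => rewrite scalerA mulrC; reflexivity).
Qed.
End TwistedMul.

(** * The canonical map *)

Section AntipodeComodule.
Variables (k : fieldType) (H : coquasiHopf k).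

Definition antip : {linear H -> H} := antipode.
Definition alphaL : {linear H -> k^o} := alpha.
Definition betaL : {linear H -> k^o} := beta.

Lemma De_antip (X : lmodType k) (h : H) (F : H -> H -> X) : bilin F ->
  \S_(x, y <- De (antip h)) F x y = \S_(h1, h2 <- De h) F (antip h2) (antip h1).
Proof.
move=> FB; have -> : De (antip h) = \S_(h1, h2 <- De h) (antip h2 \ox antip h1).
  exact: Delta_antipode.
by rewrite sw_bind //; apply: eq_sw => h1 h2; rewrite sw_pure.
Qed.

Lemma rhoS_lin : lin (fun h : H => \S_(h1, h2 <- De h) (h2 \ox antip h1)).
Proof. by mlin. Qed.
Definition rhoS : {linear H -> H \OX H} := linmap rhoS_lin.

Lemma rhoS_sw (X : lmodType k) (h : H) (F : H -> H -> X) : bilin F ->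
  \S_(x, y <- rhoS h) F x y = \S_(h1, h2 <- De h) F h2 (antip h1).
Proof. by move=> FB; rewrite sw_bind //; apply: eq_sw => h1 h2; rewrite sw_pure. Qed.

Lemma rhoS_coassoc (h : H) :
    \S_(u', u2 <- rhoS h) \S_(u0, u1 <- rhoS u') (u0 \ox (u1 \ox u2)) =
    \S_(u0, h <- rhoS h) \S_(u1, u2 <- De h) (u0 \ox (u1 \ox u2)).
Proof.
rewrite !rhoS_sw; [|mlin|mlin].
swn 1%N ltac:(fun _ => eapply rhoS_sw; mlin).
symmetry; swn 1%N ltac:(fun _ => eapply De_antip; mlin).
by eapply (@De_coassoc _ _ _ _ (fun h1 h2 h3 => h3 \ox (antip h2 \ox antip h1))); mlin.
Qed.

Lemma rhoS_counit (h : H) : \S_(u0, u1 <- rhoS h) (counit u1 *: u0) = h.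
Proof.
rewrite rhoS_sw; last by mlin.
swbot ltac:(fun _ => rewrite counit_antipode; reflexivity).
by apply: (@De_counitl _ _ _ _ (fun x => x)); mlin.
Qed.

(* With [comodS] the associator absorbs all antipodes of the canonical map:
   can(a (x) b) = (m (x) H) Phi^-1(a (x) j(b)) for the coinvariant element
   j(b) = b_0 (x) beta(b_1) b_2 of A (x) [comodS]. *)
Definition comodS : comod H := Comod rhoS_coassoc rhoS_counit.

Lemma antip_beta (X : lmodType k) (h : H) (F : H -> X) : lin F ->
  \S_(h1, h' <- De h) \S_(h2, h3 <- De h') (betaL h2 *: F (h1 ** antip h3)) =
  betaL h *: F hone.
Proof.
move=> FL; have /(congr1 (linmap FL)) e :
  \S_(h1, h' <- De h) \S_(h2, h3 <- De h') (betaL h2 *: (h1 ** antip h3)) = betaL h *: (hone : H).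
  exact: antipode_beta.
rewrite linZ in e; rewrite -[RHS]e sw_lin; apply: eq_sw => ? ?.
by rewrite sw_lin; apply: eq_sw => ? ?; rewrite linZ.
Qed.

Lemma om_scale (a b : k) (h g x : H) : om (b *: h) g (a *: x) = b * a * om h g x.
Proof.
rewrite puZl (linZ (omegaL H)) puZr puZr (linZ (omegaL H)).
by rewrite -[LHS]/(b * (a * _)) mulrA.
Qed.

Lemma antip_omega (X : lmodType k) (h : H) (v : X) :
  \S_(h1, x <- De h) \S_(h2, y <- De x) \S_(h3, z <- De y) \S_(h4, h5 <- De z)
    ((betaL h2 * alphaL h4 * om h1 (antip h3) h5) *: v) = counit h *: v.
Proof.
have <- : \S_(h1, x <- De h) \S_(h2, y <- De x) \S_(h3, z <- De y) \S_(h4, h5 <- De z)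
    (om (betaL h2 *: h1) (antip h3) (alphaL h4 *: h5) : k^o) = counit h :> k.
  exact (antipode_omega h).
symmetry; rewrite -swZl.
swn 1%N ltac:(fun _ => symmetry; exact: swZl).
swn 2%N ltac:(fun _ => symmetry; exact: swZl).
swn 3%N ltac:(fun _ => symmetry; exact: swZl).
by swbot ltac:(fun _ => rewrite om_scale; reflexivity).
Qed.

Section Twist.
Variable M : comod H.

Lemma jm_lin : lin (fun m : M =>
  \S_(m0, h <- rho m) \S_(h1, h2 <- De h) (betaL h1 *: (m0 \ox h2))).
Proof. by mlin. Qed.
Definition jm : {linear M -> M \OX comodS} := linmap jm_lin.

Lemma jmE (m : M) : jm m =
  \S_(m0, h <- rho m) \S_(h1, h2 <- De h) (betaL h1 *: (m0 \ox h2)).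
Proof. by []. Qed.

(** The coaction leg is m_1 beta(m_2) S(m_3), which the antipode axiom for beta collapses to
    beta(m_1) 1_H. *)
Lemma cinv_jm (m : M) : cinv (jm m : M \CX comodS).
Proof.
rewrite /cinv jmE; swpush.
swbot ltac:(fun _ => rewrite rho_tens; reflexivity).
swpush.
swn 3%N ltac:(fun _ => eapply rhoS_sw; mlin).
swn 1%N ltac:(fun _ => exact: sw_swap).
swn 0%N ltac:(fun _ => eapply Ro_coassoc; mlin).
swn 2%N ltac:(fun _ => symmetry; eapply De_coassoc; mlin).
swn 1%N ltac:(fun _ => symmetry; eapply De_coassoc; mlin).
swn 2%N ltac:(fun _ => eapply antip_beta; mlin).
symmetry; swpush; reflexivity.
Qed.

(** The formula is chosen so that composing it with [jm] gives the coefficient beta(m_2) alpha(m_4)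
    omega(m_1, S(m_3), m_5), which is the counit by the axiom linking omega to the antipode. *)
Lemma pm_bilin : bilin (fun (c : M) (h : comodS) =>
  \S_(c0, c1 <- rho c) \S_(h1, h' <- De (h : H)) \S_(h2, h3 <- De h')
    (alphaL h2 *: (om c1 (antip h1) h3 *: c0))).
Proof. by mlin. Qed.
Definition pm : {linear M \OX comodS -> M} := tlift pm_bilin.

Lemma jmK : cancel jm pm.
Proof.
move=> m; rewrite jmE; swpush.
swbot ltac:(fun _ => apply: (congr1 ( *:%R _)); exact: (sw_pure _ _ pm_bilin)).
swpush.
swn 1%N ltac:(fun _ => exact: sw_swap).
swn 0%N ltac:(fun _ => eapply Ro_coassoc; mlin).
swbot ltac:(fun _ => rewrite !scalerA mulrA; reflexivity).
swn 1%N ltac:(fun _ => exact: antip_omega).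
by apply: (@Ro_counit _ _ M _ _ (fun x => x)); mlin.
Qed.
End Twist.

Lemma jm_nat (M N : comod H) (f : {linear M -> N}) m : colin f -> jm N (f m) = tl f (jm M m).
Proof.
move=> fc; rewrite !jmE fc sw_tl; last by mlin.
by symmetry; swpush; swbot ltac:(fun _ => rewrite tlE; reflexivity).
Qed.
End AntipodeComodule.
Arguments antip {k H}.
Arguments alphaL {k H}.
Arguments betaL {k H}.
Arguments comodS {k} H.
Arguments jm {k H} M.
Arguments pm {k H} M.

Section CanonicalMap.
Variables (k : fieldType) (H : coquasiHopf k) (A : comoduleAlgebra H).
Local Notation cA := (comodA A).
Local Notation cS := (comodS H).

Section Can.
Variable M : rmod A.

Definition canm (a : cA) : {linear M -> M \OX cS} :=
  tl (ract M) \o associ M cA cS \o pul M (jm cA a).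

Lemma canmE a (m : M) : canm a m = tl (ract M) (associ M cA cS (m \ox jm cA a)).
Proof. by []. Qed.

Lemma canmD a b (m : M) : canm (a + b) m = canm a m + canm b m.
Proof. by rewrite !canmE linearD puDr !linearD. Qed.

Lemma colin_canm a : @colin _ _ M (M \CX cS) (canm a).
Proof.
apply: (@colin_comp _ _ _ (M \CX cA \CX cS) _ (associ M cA cS \o pul M (jm cA a)) (tl (ract M))).
- by [].
- apply: (@colin_comp _ _ _ (M \CX (cA \CX cS)) _ (pul M (jm cA a)) (associ M cA cS)) => //.
    exact/colin_pul/cinv_jm.
  exact: colin_associ.
exact/colin_tl/colin_ract.
Qed.

(** The associator is trivial at the coinvariant m, and a |-> ma is colinear, so that [jm] commutes
    with it. *)
Lemma canm_cinv (m : M) a : cinv m -> canm a m = jm M (ract M (m \ox a)).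
Proof.
move=> mc; have fc : @colin _ _ cA M (ract M \o pur cA m).
  by apply: (@colin_comp _ _ _ (M \CX cA) _ (pur cA m) (ract M)) => //;
   [exact: colin_pur | exact: colin_ract].
rewrite -[ract M _]/((ract M \o pur cA m) a) jm_nat // canmE.
move: (jm cA a); apply: tens_eq => [||b h]; [mlin|mlin|].
by rewrite associ1l // !tlE.
Qed.

Lemma canmB (m : M) (b a : cA) : cinv b ->
  canm a (ract M (m \ox b)) = canm (mulA A (b \ox a)) m.
Proof.
move=> bc; rewrite !canmE.
have := associ_nl (@colin_ractr _ _ _ M b bc) (m \ox jm cA a).
have := associ_nm (U := M) (W := cS) (colin_mull bc) (m \ox jm cA a).
rewrite tlE trE -(jm_nat _ (colin_mull bc)) /= => -> ->.
apply: eq_tl; apply: tens_eq => [||m' a']; [mlin|mlin|].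
by rewrite tlE trE /= ractB.
Qed.
End Can.

(** In the pentagon for V, M, A and [comodS], one associator has j(a) as last argument and
    disappears because j(a) is coinvariant. Thus only an invertible associator separates the
    canonical maps of M and V (x) M. *)
Lemma canm_tens (V : comod H) (M : rmod A) (v : V) (m : M) (a : cA) :
  canm (tens_rmod V M) a (v \ox m) = associ V M cS (v \ox canm M a m).
Proof.
rewrite !canmE.
have := pentagon_associ (v \ox (m \ox jm cA a)).
rewrite trE [in RHS]associ1r; last exact: cinv_jm.
have := associ_nm (U := V) (W := cS) (@colin_ract _ _ _ M) (v \ox associ M cA cS (m \ox jm cA a)).
rewrite trE => -> ->.
exact: tl_comp.
Qed.

(** The coaction of [comodS] on the second leg of j(b) = b_0 (x) beta(b_1) b_2 supplies S(b_3) and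
    b_4, and that of A on the first leg supplies b_1. *)
Lemma galois_canE (a b : cA) :
  \S_(a0, a1 <- rho a) \S_(b0, b' <- rho b) \S_(b1, x <- De b') \S_(b2, y <- De x)
  \S_(b3, b4 <- De y)
    (omi a1 (betaL b2 *: b1) (antip b3) *: (mulA A (a0 \ox b0) \ox b4)) =
  canm (rmodA A) b a.
Proof.
symmetry; rewrite canmE jmE; swpush.
swbot ltac:(fun _ => rewrite associE; reflexivity).
swpush.
swn 4%N ltac:(fun _ => eapply rhoS_sw; mlin).
swbot ltac:(fun _ => rewrite tlE; reflexivity).
swn 1%N ltac:(fun _ => exact: sw_swap).
swn 0%N ltac:(fun _ => exact: sw_swap).
swn 2%N ltac:(fun _ => exact: sw_swap).
swn 1%N ltac:(fun _ => eapply Ro_coassoc; mlin).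
do 5 (apply: eq_sw => ? ?).
by rewrite puZl puZr (linZ (omegaiL H)) scalerA.
Qed.
End CanonicalMap.

(** * Faithful flatness *)

Section BalancedTheory.
Variables (M N : zmodType) (I : Type) (ra : I -> M -> M) (la : I -> N -> N).
Implicit Types t : btens ra la.

Lemma bpureDl m m' n : bpure ra la (m + m') n = bpure ra la m n + bpure ra la m' n.
Proof. by have [D _ _] := bpure_balanced ra la; apply: D. Qed.
Lemma bpureDr m n n' : bpure ra la m (n + n') = bpure ra la m n + bpure ra la m n'.
Proof. by have [_ D _] := bpure_balanced ra la; apply: D. Qed.
Lemma bpureM i m n : bpure ra la (ra i m) n = bpure ra la m (la i n).
Proof. by have [_ _ D] := bpure_balanced ra la; apply: D. Qed.
Lemma bpure0l n : bpure ra la 0 n = 0.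
Proof. by apply: (addIr (bpure ra la 0 n)); rewrite -bpureDl !add0r. Qed.

Lemma btens_pure_ind (P : btens ra la -> Prop) :
  (forall m n, P (bpure ra la m n)) -> (forall x y, P x -> P y -> P (x + y)) ->
  forall t, P t.
Proof.
move=> Pp PD t; have [s ->] := btensP t.
elim: s => [|[m n] s IH]; first by rewrite big_nil -(bpure0l 0).
by rewrite big_cons; apply: PD => //; apply: Pp.
Qed.

Variables (V : zmodType) (f : M -> N -> V) (fB : balanced ra la f).

Lemma sweedler_bpure m n : sweedler (bpure ra la m n) f = f m n.
Proof. exact: btensor_lift_pure. Qed.

Lemma sweedlerD : {morph (fun t => sweedler t f) : x y / x + y}.
Proof. exact: btensor_liftD. Qed.
End BalancedTheory.

Lemma morph_add0 (U V : zmodType) (f : U -> V) : {morph f : x y / x + y} -> f 0 = 0.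
Proof. by move=> fD; apply: (addIr (f 0)); rewrite -fD !add0r. Qed.

Lemma morph_addN (U V : zmodType) (f : U -> V) : {morph f : x y / x + y} ->
  {morph f : x / - x}.
Proof.
by move=> fD x; apply: (addIr (f x)); rewrite -fD !addNr; apply: morph_add0.
Qed.

Lemma morph_add_inj (U V : zmodType) (f : U -> V) : {morph f : x y / x + y} ->
  (forall x, f x = 0 -> x = 0) -> injective f.
Proof.
move=> fD f0 x y e; apply/eqP; rewrite -subr_eq0; apply/eqP/f0.
by rewrite fD (morph_addN fD) e subrr.
Qed.

(** One abelian group carries several B-actions here (on L, multiplication by sources and by
    targets), so actions are explicit functions; [racted] turns one of them into a module over [R^c]
    where faithful flatness is applied. *)
Record right_action (R : pzRingType) (X : zmodType) (ra : R -> X -> X) : Prop :=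
  RightAction {
    raDr : forall r, {morph ra r : x y / x + y};
    raDl : forall r s x, ra (r + s) x = ra r x + ra s x;
    raM : forall r s x, ra (r * s) x = ra s (ra r x);
    ra1 : forall x, ra 1 x = x
  }.

Definition racted (R : pzRingType) (X : zmodType) (ra : R -> X -> X)
  (ax : right_action ra) : Type := X.

Section Racted.
Variables (R : pzRingType) (X : zmodType) (ra : R -> X -> X) (ax : right_action ra).
HB.instance Definition _ := GRing.Zmodule.on (racted ax).
Definition racted_scale (r : R^c) (x : racted ax) : racted ax := ra r x.
Lemma racted_scaleA (a b : R^c) (x : racted ax) :
  racted_scale a (racted_scale b x) = racted_scale (a * b) x.
Proof. by rewrite /racted_scale -(raM ax). Qed.
Lemma racted_scale1 : left_id (1 : R^c) racted_scale.
Proof. exact: (ra1 ax). Qed.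
Lemma racted_scaleDr : right_distributive racted_scale +%R.
Proof. by move=> r x y; apply: (raDr ax). Qed.
Lemma racted_scaleDl (x : racted ax) : {morph racted_scale^~ x : b c / b + c}.
Proof. by move=> r s; apply: (raDl ax). Qed.
HB.instance Definition _ := GRing.Zmodule_isLmodule.Build R^c (racted ax)
  racted_scaleA racted_scale1 racted_scaleDr racted_scaleDl.
End Racted.

Section Flatness.
Variables (R : pzRingType) (N : lmodType R).
Local Notation la := (fun (r : R) (n : N) => r *: n).

Definition radditive (X Y : zmodType) (raX : R -> X -> X) (raY : R -> Y -> Y) (f : X -> Y) :=
  {morph f : x y / x + y} /\ forall r x, f (raX r x) = raY r (f x).

Definition tensor_map (X Y : zmodType) (raX : R -> X -> X) (raY : R -> Y -> Y) (f : X -> Y)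
    (t : btens raX la) : btens raY la :=
  \Te_(x, n <- t) bpure raY la (f x) n.

Section Map.
Variables (X Y : zmodType) (raX : R -> X -> X) (raY : R -> Y -> Y) (f : X -> Y).
Hypothesis fr : radditive raX raY f.
Local Notation F := (@tensor_map X Y raX raY f).

Lemma tensor_map_balanced :
  balanced raX la (fun x n => bpure raY la (f x) n).
Proof.
by case: fr => fD fM; split=> *; rewrite ?fD ?fM ?bpureDl ?bpureDr ?bpureM.
Qed.

Lemma tensor_mapE x n : F (bpure raX la x n) = bpure raY la (f x) n.
Proof. exact: (sweedler_bpure tensor_map_balanced). Qed.

Lemma tensor_mapD : {morph F : x y / x + y}.
Proof. exact: (sweedlerD tensor_map_balanced). Qed.
End Map.

Hypothesis N_ff : faithfully_flat N.

Lemma radditive_linear (X Y : zmodType) (raX : R -> X -> X) (raY : R -> Y -> Y)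
  (aX : right_action raX) (aY : right_action raY) (h : X -> Y) :
  radditive raX raY h -> linear (h : racted aX -> racted aY).
Proof. by case=> hD hM r x y; rewrite hD hM. Qed.

(* The structures are destructed to make those of [X] and [racted aX] convertible. *)
Lemma ff_exact (X Y Z : zmodType) (raX : R -> X -> X) (raY : R -> Y -> Y) (raZ : R -> Z -> Z)
  (aX : right_action raX) (aY : right_action raY) (aZ : right_action raZ)
  (f : X -> Y) (g : Y -> Z) (fr : radditive raX raY f) (gr : radditive raY raZ g) :
  exact f g <-> exact (@tensor_map X Y raX raY f) (@tensor_map Y Z raY raZ g).
Proof.
pose f' : racted aX -> racted aY := f; pose g' : racted aY -> racted aZ := g.
pose fl : {linear racted aX -> racted aY} :=
  HB.pack f' (GRing.isLinear.Build _ _ _ _ f' (@radditive_linear _ _ _ _ aX aY _ fr)).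
pose gl : {linear racted aY -> racted aZ} :=
  HB.pack g' (GRing.isLinear.Build _ _ _ _ g' (@radditive_linear _ _ _ _ aY aZ _ gr)).
have := N_ff fl gl; rewrite {}/fl {}/gl {}/f' {}/g'.
move: raX raY raZ aX aY aZ f g fr gr.
case: X => X [? ? ? ? ? ? ? ?]; case: Y => Y []; case: Z => Z [].
move=> *; assumption.
Qed.

Section InjSurj.
Variables (X Y : zmodType) (raX : R -> X -> X) (raY : R -> Y -> Y).
Hypotheses (aX : right_action raX) (aY : right_action raY).
Variables (f : X -> Y) (fr : radditive raX raY f).

Lemma radditive0 (X' Y' : zmodType) (raX' : R -> X' -> X') (raY' : R -> Y' -> Y')
  (aY' : right_action raY') : radditive raX' raY' (fun => 0).
Proof.
by split=> [x y|r x]; rewrite ?addr0 // (morph_add0 (raDr aY' r)).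
Qed.

Lemma tensor_map0 (X' Y' : zmodType) (raX' : R -> X' -> X') (raY' : R -> Y' -> Y')
  (aY' : right_action raY') t : @tensor_map X' Y' raX' raY' (fun => 0) t = 0.
Proof.
rewrite /tensor_map /sweedler /btensor_lift /formal_eval big1 // => p _.
exact: bpure0l.
Qed.

(** Injectivity of f is exactness of X -> X -> Y with zero first map, and the zero map stays zero
    after tensoring. Surjectivity is treated dually below, with a zero second map. *)
Lemma ff_inj : injective f <-> injective (@tensor_map X Y raX raY f).
Proof.
have e := ff_exact aX aX aY (radditive0 raX aX) fr.
have ker0 (U V W : zmodType) (g : U -> V) (h : W -> U) : {morph g : x y / x + y} ->
    (forall w, h w = 0) -> injective g <-> exact h g.
  move=> gD h0; split=> [gi v|gh].
    split=> [gv0|[u <-]]; last by rewrite h0 morph_add0.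
    by exists 0; rewrite h0; apply: gi; rewrite gv0 morph_add0.
  by apply: morph_add_inj => // v /gh [u <-].
have h1 := ker0 _ _ _ f (fun _ : X => 0) (proj1 fr) (fun => erefl).
have h2 := ker0 _ _ _ _ _ (tensor_mapD fr) (@tensor_map0 X X raX raX aX).
by split=> [/h1/e/h2|/h2/e/h1].
Qed.

Lemma ff_surj : (forall y, exists x, f x = y) <->
  (forall u, exists t, @tensor_map X Y raX raY f t = u).
Proof.
have e := ff_exact aX aY aY fr (radditive0 raY aY).
have cok (U V W : zmodType) (h : W -> U) (g : U -> V) :
    (forall u, g u = 0) -> (forall u, exists w, h w = u) <-> exact h g.
  by move=> g0; split=> [s v|s u]; [split=> // _; apply: s | apply/s].
have h1 := cok _ _ _ f (fun _ : Y => 0 : Y) (fun => erefl).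
have h2 := cok _ _ _ (@tensor_map X Y raX raY f) _ (@tensor_map0 Y Y raY raY aY).
by split=> [/h1/e/h2|/h2/e/h1].
Qed.
End InjSurj.
End Flatness.

Lemma puBl (k : fieldType) (U V : lmodType k) (u u' : U) (v : V) :
  (u - u') \ox v = u \ox v - u' \ox v.
Proof. exact: pureBl. Qed.

(** * The structure theorem for relative Hopf modules *)

Section CoinvariantSubspace.
Variables (k : fieldType) (H : coquasiBialgebra k) (U : comod H).

Definition cinv_pred : {pred U} := [pred u | `[< cinv u >]].
Lemma cinv_predP u : reflect (cinv u) (u \in cinv_pred).
Proof. exact: asboolP. Qed.
Lemma cinv_zmod_closed : zmod_closed cinv_pred.
Proof.
split=> [|x y /cinv_predP xc /cinv_predP yc]; apply/cinv_predP.
  by rewrite /cinv linear0 /pu pure0l.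
by rewrite /cinv linearB xc yc /pu pureBl.
Qed.
HB.instance Definition _ := GRing.isZmodClosed.Build U cinv_pred cinv_zmod_closed.

Record coinvs : Type := Coinvs { cval :> U; cvalP : cval \in cinv_pred }.
HB.instance Definition _ := [isSub for cval].
HB.instance Definition _ := [Choice of coinvs by <:].
HB.instance Definition _ := [SubChoice_isSubZmodule of coinvs by <:].

Lemma cinv_cval (x : coinvs) : cinv (cval x).
Proof. exact/cinv_predP/cvalP. Qed.
Definition coinvs_of (u : U) (uc : cinv u) : coinvs := Coinvs (introT (cinv_predP u) uc).
Lemma cval_inj : injective cval. Proof. exact: val_inj. Qed.
Lemma cvalD : {morph cval : x y / x + y}. Proof. exact: (raddfD (val : coinvs -> U)). Qed.
End CoinvariantSubspace.
Arguments coinvs {k H} U.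

Section Structure.
Variables (k : fieldType) (H : coquasiHopf k) (A : comoduleAlgebra H).
Local Notation cA := (comodA A).
Local Notation cS := (comodS H).
Local Notation B := (coinv A).
Local Notation N := (leftmod A).
Local Notation la := (fun (r : B) (n : N) => r *: n).

Lemma coinvD (b c : B) : ((b + c : B) : A) = (b : A) + (c : A).
Proof. exact: (raddfD (val : B -> A)). Qed.

Section Action.
Variable M : rmod A.

Definition actB (b : B) (m : M) : M := ract M (m \ox (b : A)).

Lemma actB_right_action : right_action actB.
Proof.
split=> [b x y|b c x|b c x|x]; rewrite /actB.
- by rewrite puDl linearD.
- by rewrite coinvD puDr linearD.
- by rewrite ractB //; exact: cinv_coinv.
- exact: ract1.
Qed.

Definition coactB (b : B) (x : coinvs M) : coinvs M :=
  coinvs_of (cinv_map (colin_ractr M (cinv_coinv b)) (cinv_cval x)).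

Lemma coactB_val b x : cval (coactB b x) = actB b (cval x). Proof. by []. Qed.

Lemma coactB_right_action : right_action coactB.
Proof.
have [D Dl Mu one] := actB_right_action.
split=> [b x y|b c x|b c x|x]; apply: cval_inj.
- by rewrite cvalD !coactB_val cvalD D.
- by rewrite cvalD !coactB_val Dl.
- by rewrite !coactB_val Mu.
by rewrite coactB_val one.
Qed.

Lemma cval_radditive : radditive coactB actB (@cval _ _ M).
Proof. by split=> [x y|//]; rewrite cvalD. Qed.

Definition otA : zmodType := btens actB la.

Lemma canm_balanced : balanced actB la (fun m (a : N) => canm M a m).
Proof.
split=> [m m' a|m a a'|b m a]; rewrite ?linearD ?canmD //.
exact/canmB/cinv_coinv.
Qed.
Definition canT (t : otA) : M \OX cS := \Te_(m, a <- t) canm M a m.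

Lemma canTE m a : canT (bpure actB la m a) = canm M a m.
Proof. exact: (sweedler_bpure canm_balanced). Qed.
Lemma canTD : {morph canT : x y / x + y}.
Proof. exact: (sweedlerD canm_balanced). Qed.
End Action.

Section CanTens.
Variables (V : comod H) (M : rmod A) (g : M \OX cS -> otA M).
Hypotheses (canTK : cancel (@canT M) g) (gK : cancel g (@canT M)).
Local Notation VM := (tens_rmod V M).

Definition pure_tens (v : V) (z : otA M) : otA VM :=
  \Te_(m, a <- z) bpure (@actB VM) la (v \ox m) a.

Lemma pure_tens_balanced v :
  balanced (@actB M) la (fun m (a : N) => bpure (@actB VM) la (v \ox m) a).
Proof.
split=> [m m' a|m a a'|b m a]; rewrite ?puDr ?bpureDl ?bpureDr // -bpureM /actB.
by rewrite [ract VM _]tens_ract_cinv //; exact: cinv_coinv.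
Qed.

Lemma pure_tensE v m a : pure_tens v (bpure (@actB M) la m a) = bpure (@actB VM) la (v \ox m) a.
Proof. exact: (sweedler_bpure (pure_tens_balanced v)). Qed.
Lemma pure_tensD v : {morph pure_tens v : x y / x + y}.
Proof. exact: (sweedlerD (pure_tens_balanced v)). Qed.

Lemma gD : {morph g : x y / x + y}.
Proof. by move=> x y; rewrite -{1}[x]gK -{1}[y]gK -canTD canTK. Qed.

Lemma inv_balanced :
  @balanced V (M \OX cS) k *:%R *:%R (otA VM) (fun v u => pure_tens v (g u)).
Proof.
split=> [v v' u|v u u'|c v u].
- move: (g u); apply: btens_pure_ind => [m a|x y ex ey].
    by rewrite !pure_tensE puDl bpureDl.
  by rewrite !pure_tensD ex ey addrACA.
- by rewrite gD pure_tensD.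
(* The group [otA M] carries no k-structure, so [g] cannot be called k-linear. Writing u as a value
   of [canT] lets the scalar pass into m through the k-linearity of [canm]. *)
rewrite -[u]gK; move: (g u); apply: btens_pure_ind => [m a|x y ex ey].
  by rewrite canTK canTE -linZ -canTE canTK !pure_tensE puZl puZr.
by rewrite canTD scalerDr !gD !pure_tensD ex ey.
Qed.

(** The inverse dictated by [canm_tens]: undo the associator, then apply [g] beside V. *)
Definition canT_inv (w : V \OX M \OX cS) : otA VM :=
  sweedler (assoc V M cS w : (V \ot (M \OX cS))%type) (fun v u => pure_tens v (g u)).

Lemma canT_invD : {morph canT_inv : x y / x + y}.
Proof. by move=> x y; rewrite /canT_inv linearD; apply: (sweedlerD inv_balanced). Qed.

Lemma canT_invE v u : canT_inv (associ V M cS (v \ox u)) = pure_tens v (g u).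
Proof. by rewrite /canT_inv associK; apply: (sweedler_bpure inv_balanced). Qed.

Lemma canT_pure_tens v z : canT (pure_tens v z) = associ V M cS (v \ox canT z).
Proof.
move: z; apply: btens_pure_ind => [m a|x y ex ey].
  by rewrite pure_tensE !canTE canm_tens.
by rewrite pure_tensD !canTD ex ey puDr linearD.
Qed.

Lemma can_tensK : cancel (@canT VM) canT_inv.
Proof.
apply: btens_pure_ind => [x a|x y ex ey]; last by rewrite canTD canT_invD ex ey.
rewrite canTE; elim/ot_ind : x => [v m|x y ex ey].
  by rewrite canm_tens canT_invE -canTE canTK pure_tensE.
by rewrite linearD canT_invD ex ey bpureDl.
Qed.

Lemma can_tens_invK : cancel canT_inv (@canT VM).
Proof.
move=> w; rewrite -[w](@assocK _ _ V M cS); elim/ot_ind : (assoc _ _ _ w) => [v u|x y ex ey].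
  by rewrite canT_invE canT_pure_tens gK.
by rewrite linearD canT_invD canTD ex ey.
Qed.
End CanTens.

Lemma can_tens_bij (V : comod H) (M : rmod A) :
  bijective (@canT M) -> bijective (@canT (tens_rmod V M)).
Proof. by case=> g gK1 gK2; exists (@canT_inv V M g); [exact: can_tensK | exact: can_tens_invK]. Qed.

Hypothesis A_flat : left_faithfully_flat A.

Section StructureTheorem.
Variable M : rmod A.

Definition cotA : zmodType := btens (@coactB M) la.

Lemma mu_balanced : balanced (@coactB M) la (fun x (a : N) => ract M (cval x \ox (a : cA))).
Proof.
split=> [x y a|x a b|b x a]; first by rewrite cvalD puDl linearD.
  by rewrite puDr linearD.
by rewrite coactB_val ractB //; exact: cinv_coinv.
Qed.
Definition mu (t : cotA) : M := \Te_(x, a <- t) ract M (cval x \ox (a : cA)).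
Lemma muE x a : mu (bpure (@coactB M) la x a) = ract M (cval x \ox (a : cA)).
Proof. exact: (sweedler_bpure mu_balanced). Qed.
Lemma muD : {morph mu : x y / x + y}.
Proof. exact: (sweedlerD mu_balanced). Qed.

Local Notation incl := (@tensor_map B N (coinvs M) M (@coactB M) (@actB M) (@cval _ _ M)).

(** This square carries the structure theorem. Three of its sides are injective, namely [incl] by
    flatness, [canT] by the Galois condition and [jm] by its retraction, and each half of the
    bijectivity of [mu] is read off from it. *)
Lemma canT_incl t : canT (incl t) = jm M (mu t).
Proof.
have D := tensor_mapD (cval_radditive M); move: t.
apply: btens_pure_ind => [x a|x y ex ey].
  rewrite (tensor_mapE (cval_radditive M)) canTE muE canm_cinv //; exact: cinv_cval.
by rewrite D canTD muD linearD ex ey.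
Qed.

Lemma incl_inj : injective incl.
Proof.
apply/(ff_inj A_flat (coactB_right_action M) (actB_right_action M) (cval_radditive M)).
exact: cval_inj.
Qed.

Lemma mu_inj : injective (@canT M) -> injective mu.
Proof.
by move=> can_inj x y e; apply/incl_inj/can_inj; rewrite !canT_incl e.
Qed.

Lemma trivial_coassoc (h : H) :
    \S_(u', u2 <- pul H (hone : H) h) \S_(u0, u1 <- pul H (hone : H) u') (u0 \ox (u1 \ox u2)) =
    \S_(u0, g <- pul H (hone : H) h) \S_(u1, u2 <- De g) (u0 \ox (u1 \ox u2)).
Proof.
have e u : pul H (hone : H) u = u \ox hone by [].
by rewrite !e !sw_pure ?e ?sw_pure ?De_one_sw //; mlin.
Qed.

Lemma trivial_counit (h : H) : \S_(u0, u1 <- pul H (hone : H) h) (counit u1 *: u0) = h.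
Proof.
rewrite -[pul H _ h]/(h \ox hone) sw_pure; last by mlin.
by rewrite counit_one scale1r.
Qed.

(** The trivial coaction makes H (x) M, the target of the defect m |-> rho(m) - 1 (x) m, an instance
    of [tens_rmod], so that [can_tens_bij] applies to it. The factor H has to stand on the left for
    this, whence the flip. *)
Definition comod_triv : comod H := Comod trivial_coassoc trivial_counit.

Lemma flip_bilin (U V : lmodType k) : bilin (fun (u : U) (v : V) => v \ox u).
Proof. by mlin. Qed.
Definition flip (U V : lmodType k) : {linear U \OX V -> V \OX U} := tlift (@flip_bilin U V).
Lemma flipE (U V : lmodType k) (u : U) (v : V) : flip U V (u \ox v) = v \ox u.
Proof. exact: (sw_pure _ _ (@flip_bilin U V)). Qed.
Lemma flipK (U V : lmodType k) : cancel (flip U V) (flip V U).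
Proof. by apply: tens_eq => [||u v]; [mlin|mlin|rewrite !flipE]. Qed.

Local Notation HM := (tens_rmod comod_triv M).

Definition coinv_defect (m : M) : HM := flip M H (rho m) - (hone : H) \ox m.

Lemma coinv_defect_radditive : radditive (@actB M) (@actB HM) coinv_defect.
Proof.
split=> [x y|b m]; rewrite /coinv_defect.
  by rewrite linearD /= linearD puDr opprD addrACA.
rewrite /actB puBl linearB [X in _ = _ - X]tens_ract_cinv; last exact: cinv_coinv.
congr (_ - _); rewrite -[ract M (m \ox _)]/((ract M \o pul M (b : A)) m).
rewrite (colin_ractr M (cinv_coinv b)).
elim/ot_ind : (rho m) => [m' h|x y ex ey]; last by rewrite !linearD ex ey puDl linearD.
by rewrite tlE !flipE tens_ract_cinv //; exact: cinv_coinv.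
Qed.

Lemma coinv_defect_exact : exact (@cval _ _ M) coinv_defect.
Proof.
move=> m; split=> [/eqP|[x <-]].
  rewrite subr_eq0 => /eqP e; have mc : cinv m.
    by rewrite /cinv -[LHS](@flipK M H) e flipE.
  by exists (coinvs_of mc).
by rewrite /coinv_defect cinv_cval flipE subrr.
Qed.

(** Since each [canm M a] is colinear, the canonical map turns the defect of M, tensored with A,
    into the defect of M (x) [comodS]; it vanishes wherever [canT z] is coinvariant. *)
Lemma canT_defect z : canT (@tensor_map B N M HM (@actB M) (@actB HM) coinv_defect z) =
  associ comod_triv M cS (flip (M \CX cS) H (rho (canT z : M \CX cS)) - (hone : H) \ox canT z).
Proof.
have D := tensor_mapD coinv_defect_radditive; move: z.
apply: btens_pure_ind => [m a|x y ex ey]; last first.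
  rewrite D canTD ex ey -linearD; congr (associ _ _ _ _).
  by rewrite canTD linearD /= linearD puDr opprD addrACA.
rewrite (tensor_mapE coinv_defect_radditive) !canTE /coinv_defect linearB linearB.
rewrite canm_tens; congr (_ - _).
rewrite (@colin_canm _ _ A M a).
elim/ot_ind : (rho m) => [m' h|x y ex ey]; last by rewrite !linearD ex ey.
by rewrite flipE tlE flipE canm_tens.
Qed.

(** The preimage of j(m) under the canonical map is killed by the defect, because j(m) is
    coinvariant. By exactness it comes from some t in M^coH (x)_B A, and j([mu t]) = j(m). *)
Lemma mu_surj : bijective (@canT M) -> forall m, exists t, mu t = m.
Proof.
move=> can_bij m; case: (can_bij) => g gK1 gK2.
have := ff_exact A_flat (coactB_right_action M) (actB_right_action M)
  (actB_right_action HM) (cval_radditive M) coinv_defect_radditive.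
case=> /(_ coinv_defect_exact) ex _.
have [] := ex (g (jm M m)).
case=> [|t et _].
  apply: (bij_inj (can_tens_bij comod_triv can_bij)).
  rewrite canT_defect gK2 (cinv_jm m) flipE subrr linear0.
  by rewrite (morph_add0 (@canTD HM)).
exists t; apply: (can_inj (@jmK _ _ M)); rewrite -canT_incl et gK2.
by [].
Qed.
End StructureTheorem.
End Structure.

(** * The ring L *)

Section TwistedRing.
Variables (k : fieldType) (H : coquasiBialgebra k) (A : comoduleAlgebra H).
Local Notation cA := (comodA A).
Local Notation AA := (cA \CX cA).
Local Notation m := (mulA A).
Local Notation ra := (tens_ract cA (rmodA A)).
Local Notation B := (coinv A).

Definition twL : Type := coinvs AA.
HB.instance Definition _ := GRing.Zmodule.on twL.
Implicit Types x y z : twL.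

Definition lval (x : twL) : AA := cval x.
Lemma lval_inj : injective lval. Proof. exact: cval_inj. Qed.
Lemma lvalD : {morph lval : x y / x + y}. Proof. exact: cvalD. Qed.
Lemma lval_cinv x : cinv (lval x). Proof. exact: cinv_cval. Qed.

Definition twL_mul x y : twL := coinvs_of (cinv_map (colin_Tw (lval_cinv y)) (lval_cinv x)).
Lemma lval_mul x y : lval (twL_mul x y) = Tw (lval y) (lval x). Proof. by []. Qed.

Lemma cinv_l (b : cA) : cinv b -> cinv (b \ox aone : AA).
Proof. by move=> bc; rewrite /cinv rho_mul1r ?bc ?tlE //; exact: cinv_one. Qed.
Lemma cinv_r (b : cA) : cinv b -> cinv (aone \ox b : AA).
Proof. by move=> bc; rewrite /cinv rho_mul1l ?bc ?tlE //; exact: cinv_one. Qed.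

Definition twL_one : twL := coinvs_of (cinv_l (cinv_one A)).
Lemma lval_one : lval twL_one = aone \ox aone. Proof. by []. Qed.

Lemma twL_mulA : associative twL_mul.
Proof.
by move=> x y z; apply: lval_inj; rewrite !lval_mul Tw_Tw //; exact: lval_cinv.
Qed.
Lemma twL_mul1l : left_id twL_one twL_mul.
Proof. by move=> x; apply: lval_inj; rewrite lval_mul lval_one Tw_one. Qed.
Lemma twL_mul1r : right_id twL_one twL_mul.
Proof. by move=> x; apply: lval_inj; rewrite lval_mul lval_one one_Tw. Qed.
Lemma twL_mulDl : left_distributive twL_mul +%R.
Proof. by move=> x y z; apply: lval_inj; rewrite lvalD !lval_mul lvalD linearD. Qed.
Lemma twL_mulDr : right_distributive twL_mul +%R.
Proof. by move=> x y z; apply: lval_inj; rewrite lvalD !lval_mul lvalD TwD. Qed.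

HB.instance Definition _ := GRing.Zmodule_isPzRing.Build twL
  twL_mulA twL_mul1l twL_mul1r twL_mulDl twL_mulDr.

Lemma lvalM x y : lval (x * y) = Tw (lval y) (lval x). Proof. by []. Qed.

Definition srcL (b : B) : twL := coinvs_of (cinv_l (cinv_coinv b)).
Definition tgtL (b : B^c) : twL := coinvs_of (cinv_r (cinv_coinv (b : B))).
Lemma lval_src b : lval (srcL b) = (b : A) \ox aone. Proof. by []. Qed.
Lemma lval_tgt (b : B) : lval (tgtL b) = aone \ox (b : A). Proof. by []. Qed.

(** On a (x) c, multiplying from the left by sources and targets acts on the outer sides, giving ba
    (x) c and a (x) cb; multiplying from the right acts on the inner sides, giving ab (x) c and a
    (x) bc. *)
Lemma lval_srcM (b : B) x : lval (srcL b * x) = lact A cA ((b : A) \ox lval x).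
Proof. by rewrite lvalM lval_src TwE [X in lact _ _ (_ \ox X)]tens_ract1. Qed.
Lemma lval_tgtM (b : B) x : lval (tgtL b * x) = ra (lval x \ox (b : A)).
Proof. by rewrite lvalM lval_tgt TwE lact1. Qed.
Lemma lval_Msrc (b : B) x : lval (x * srcL b) = tl (m \o pul cA (b : A)) (lval x).
Proof.
have bc := cinv_coinv b; have oc := cinv_one A; rewrite lvalM lval_src.
move: (lval x); apply: tens_eq => [||a c]; [mlin|mlin|].
by rewrite TwE ra_cinvl // mul1A lact_cinvm // tlE.
Qed.
Lemma lval_Mtgt (b : B) x : lval (x * tgtL b) = tr (m \o pur cA (b : A)) (lval x).
Proof.
have bc := cinv_coinv b; have oc := cinv_one A; rewrite lvalM lval_tgt.
move: (lval x); apply: tens_eq => [||a c]; [mlin|mlin|].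
by rewrite TwE ra_cinvl // lact_cinvm // mulA1 trE.
Qed.

Lemma srcL_additive : additive srcL.
Proof.
move=> b c; apply: lval_inj.
by rewrite -[lval _]/((b - c : A) \ox (aone : A)) puBl [RHS](raddfB (val : coinvs AA -> AA)).
Qed.
Lemma srcL_multiplicative : multiplicative srcL.
Proof.
split=> [b c|]; last by apply: lval_inj.
apply: lval_inj; rewrite lval_srcM lval_src lact_cinvl //; exact: cinv_coinv.
Qed.
Lemma tgtL_additive : additive tgtL.
Proof.
move=> b c; apply: lval_inj.
by rewrite -[lval _]/((aone : A) \ox (b - c : A)) [LHS](linearB (pur A (aone : A)))
 [RHS](raddfB (val : coinvs AA -> AA)).
Qed.
Lemma tgtL_multiplicative : multiplicative tgtL.
Proof.
split=> [b c|]; last by apply: lval_inj.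
apply: lval_inj; rewrite lval_tgtM lval_tgt ra_cinvl //; exact: cinv_one.
Qed.
HB.instance Definition _ := GRing.isAdditive.Build B twL srcL srcL_additive.
HB.instance Definition _ := GRing.isMultiplicative.Build B twL srcL srcL_multiplicative.
HB.instance Definition _ := GRing.isAdditive.Build B^c twL tgtL tgtL_additive.
HB.instance Definition _ := GRing.isMultiplicative.Build B^c twL tgtL tgtL_multiplicative.

Definition iotaL (x : twL) : (A \ot A)%type := lval x.
Lemma iotaL_additive : additive iotaL.
Proof. exact: (raddfB (val : coinvs AA -> AA)). Qed.
HB.instance Definition _ := GRing.isAdditive.Build twL (A \ot A)%type iotaL iotaL_additive.

Lemma twL_ring : twisted_coinv_ring (iotaL : {additive twL -> (A \ot A)%type}).
Proof.
split=> [|x||x y].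
- exact: lval_inj.
- split=> [xc|[l <-]]; last exact: (lval_cinv l).
  by exists (coinvs_of (xc : cinv (x : AA))).
- by [].
by rewrite [RHS]twisted_mulE.
Qed.

Lemma src_tgt_comm (b c : B) : srcL b * tgtL c = tgtL c * srcL b.
Proof.
have [bc cc oc] := And3 (cinv_coinv b) (cinv_coinv c) (cinv_one A).
apply: lval_inj; rewrite lval_srcM lval_tgtM !(lval_src, lval_tgt).
by rewrite lact_cinvl // ra_cinvl // mulA1 mul1A.
Qed.
End TwistedRing.

(** * Embedding the tensor powers of L *)

Section GaloisBijective.
Variables (k : fieldType) (H : coquasiHopf k) (A : comoduleAlgebra H).
Local Notation cA := (comodA A).
Local Notation B := (coinv A).
Local Notation N := (leftmod A).
Local Notation la := (fun (r : B) (n : N) => r *: n).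
Local Notation raA := (fun (b : B) (a : A) => amul a b).
Local Notation laA := (fun (b : B) (a : A) => amul (b : A) a).

Lemma galois_can_balanced : balanced raA laA (fun a b => canm (rmodA A) (b : cA) (a : cA)).
Proof.
split=> [a a' b|a b b'|c a b]; rewrite ?linearD ?canmD //.
exact: (@canmB _ _ _ (rmodA A) a (c : A) b (cinv_coinv c)).
Qed.

Lemma galois_can_lift (t : tensB A) :
  galois_can t = \Te_(a, b <- t) canm (rmodA A) (b : cA) (a : cA).
Proof. by apply: eq_sweedler => a b; rewrite -galois_canE. Qed.

Lemma galois_canT : galois A -> bijective (@canT _ _ A (rmodA A)).
Proof.
(* [f] and [g] are the identity of A (x)_B A, written with the actions of [rmodA] on one side and
   with those of [tensB] on the other. *)
move=> gal; pose f (t : otA (rmodA A)) : tensB A := \Te_(a, b <- t) bpure raA laA a (b : A).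
have fB : balanced (@actB _ _ A (rmodA A)) la (fun (a : cA) (b : N) => bpure raA laA a (b : A)).
  split=> [a a' b|a b b'|c a b]; [exact: bpureDl|exact: bpureDr|exact: bpureM].
pose g (t : tensB A) : otA (rmodA A) :=
  \Te_(a, b <- t) bpure (@actB _ _ A (rmodA A)) la a (b : N).
have gB : balanced raA laA (fun a b => bpure (@actB _ _ A (rmodA A)) la a (b : N)).
  split=> [a a' b|a b b'|c a b]; [exact: bpureDl|exact: bpureDr|exact: bpureM].
have fK : cancel f g.
  apply: btens_pure_ind => [a b|x y ex ey].
    by rewrite /f (sweedler_bpure fB) /g (sweedler_bpure gB).
  by rewrite /f (sweedlerD fB) /g (sweedlerD gB) -/(f x) -/(f y) -/(g _) -/(g _) ex ey.
have gK : cancel g f.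
  apply: btens_pure_ind => [a b|x y ex ey].
    by rewrite /g (sweedler_bpure gB) /f (sweedler_bpure fB).
  by rewrite /g (sweedlerD gB) /f (sweedlerD fB) -/(g x) -/(g y) -/(f _) -/(f _) ex ey.
apply: (eq_bij (bij_comp gal (Bijective fK gK))) => t /=.
rewrite galois_can_lift; move: t; apply: btens_pure_ind => [a b|x y ex ey].
  by rewrite canTE /f (sweedler_bpure fB) (sweedler_bpure galois_can_balanced).
by rewrite canTD /f (sweedlerD fB) (sweedlerD galois_can_balanced) -/(f x) -/(f y) ex ey.
Qed.
End GaloisBijective.

(** * Descent of injectivity along A *)

Section UnitInjective.
Variables (k : fieldType) (H : coquasiHopf k) (A : comoduleAlgebra H).
Hypothesis A_flat : left_faithfully_flat A.
Local Notation cA := (comodA A).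
Local Notation B := (coinv A).
Local Notation N := (leftmod A).
Local Notation la := (fun (r : B) (n : N) => r *: n).
Variables (X : zmodType) (ra : B -> X -> X) (ax : right_action ra).

Definition tmulr (b : A) (t : btens ra la) : btens ra la :=
  \Te_(x, a <- t) bpure ra la x (amul a b : N).

Lemma tmulr_balanced b : balanced ra la (fun x (a : N) => bpure ra la x (amul a b : N)).
Proof.
split=> [x y a|x a a'|c x a]; rewrite ?bpureDl ?amulDl ?bpureDr ?bpureM //.
congr bpure; have := mulA_assoc ((c : A) \ox a \ox b : cA \OX cA \OX cA).
by rewrite tlE assoc1l ?trE => [e|]; [exact: esym e | exact: cinv_coinv].
Qed.
Lemma tmulrE b x (a : N) : tmulr b (bpure ra la x a) = bpure ra la x (amul (a : A) b : N).
Proof. exact: (sweedler_bpure (tmulr_balanced b)). Qed.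
Lemma tmulrD b : {morph tmulr b : x y / x + y}.
Proof. exact: (sweedlerD (tmulr_balanced b)). Qed.

Lemma tmulrDr b c t : tmulr (b + c) t = tmulr b t + tmulr c t.
Proof.
move: t; apply: btens_pure_ind => [x a|x y ex ey]; first by rewrite !tmulrE amulDr bpureDr.
by rewrite !tmulrD ex ey addrACA.
Qed.

Lemma tmulr_tmulr (b : B) a t : tmulr a (tmulr (b : A) t) = tmulr (amul (b : A) a) t.
Proof.
move: t; apply: btens_pure_ind => [x c|x y ex ey]; last by rewrite !tmulrD ex ey.
by rewrite !tmulrE; congr bpure; exact: (mulA_cinvm _ _ (cinv_coinv b)).
Qed.

Lemma tmulr_right_action : right_action (fun (b : B) t => tmulr (b : A) t).
Proof.
split=> [b|b c t|b c t|t].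
- exact: tmulrD.
- by rewrite coinvD tmulrDr.
- by rewrite tmulr_tmulr.
move: t; apply: btens_pure_ind => [x a|x y ex ey]; last by rewrite tmulrD ex ey.
by rewrite tmulrE amula1.
Qed.

Definition tunit (x : X) : btens ra la := bpure ra la x (aone : A).

Lemma tunit_radditive : radditive ra (fun (b : B) t => tmulr (b : A) t) tunit.
Proof.
split=> [x y|b x]; first exact: bpureDl.
rewrite /tunit tmulrE bpureM; congr bpure.
by rewrite amul1a -[LHS]/(amul (b : A) aone) amula1.
Qed.

(** Faithful flatness allows a test after tensoring with A. The map x (x) a |-> (x (x) 1) (x) a is
    split by multiplying the two factors in A. *)
Lemma tunit_inj : injective tunit.
Proof.
apply/(ff_inj A_flat ax tmulr_right_action tunit_radditive).
pose r (t : btens (fun (b : B) t => tmulr (b : A) t) la) : btens ra la :=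
  \Te_(u, a <- t) tmulr (a : A) u.
have rB : balanced (fun (b : B) t => tmulr (b : A) t) la (fun u (a : N) => tmulr (a : A) u).
  split=> [u v a|u a b|b u a]; [exact: tmulrD|exact: tmulrDr|exact: tmulr_tmulr].
apply: (can_inj (g := r)); apply: btens_pure_ind => [x a|x y ex ey].
  by rewrite (tensor_mapE tunit_radditive) /r (sweedler_bpure rB) tmulrE amul1a.
by rewrite (tensor_mapD tunit_radditive) /r (sweedlerD rB) -/(r _) -/(r _) ex ey.
Qed.
End UnitInjective.

(* Injectivity of L (x)_B Q -> L (x)_B P, for a map Q -> P of left B-modules which the
   unit Q -> Q (x)_B A factors through. *)
Section TensorInjective.
Variables (k : fieldType) (H : coquasiHopf k) (A : comoduleAlgebra H).
Hypothesis A_flat : left_faithfully_flat A.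
Local Notation B := (coinv A).
Local Notation N := (leftmod A).
Local Notation la := (fun (r : B) (n : N) => r *: n).
Variables (L Q P : zmodType) (raL : B -> L -> L) (laQ : B -> Q -> Q) (laP : B -> P -> P).
Variables (raQ : B -> Q -> Q) (aQ : right_action raQ).
Hypothesis laQD : forall b, {morph laQ b : x y / x + y}.
Hypothesis laQ_raQ : forall b c q, laQ b (raQ c q) = raQ c (laQ b q).
Variables (j : Q -> P) (th : P -> btens raQ la).
Hypotheses (jD : {morph j : x y / x + y}) (jB : forall b q, j (laQ b q) = laP b (j q)).
Hypothesis thD : {morph th : x y / x + y}.
Hypothesis th_laP : forall b p,
  th (laP b p) = \Te_(q, a <- th p) bpure raQ la (laQ b q) a.
Hypothesis thj : forall q, th (j q) = bpure raQ la q (aone : A).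

Local Notation LQ := (btens raL laQ).
Local Notation LP := (btens raL laP).

Lemma tens_map_balanced : balanced raL laQ (fun l q => bpure raL laP l (j q)).
Proof.
split=> [l l' q|l q q'|b l q]; first exact: bpureDl.
  by rewrite jD bpureDr.
by rewrite jB bpureM.
Qed.
Definition tens_map (t : LQ) : LP := \Te_(l, q <- t) bpure raL laP l (j q).
Lemma tens_mapE l q : tens_map (bpure raL laQ l q) = bpure raL laP l (j q).
Proof. exact: (sweedler_bpure tens_map_balanced). Qed.
Lemma tens_mapD : {morph tens_map : x y / x + y}.
Proof. exact: (sweedlerD tens_map_balanced). Qed.

Lemma raT_balanced b : balanced raL laQ (fun l q => bpure raL laQ l (raQ b q)).
Proof.
split=> [l l' q|l q q'|c l q]; first exact: bpureDl.
  by rewrite (raDr aQ) bpureDr.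
by rewrite bpureM laQ_raQ.
Qed.
Definition raT (b : B) (t : LQ) : LQ := \Te_(l, q <- t) bpure raL laQ l (raQ b q).
Lemma raTE b l q : raT b (bpure raL laQ l q) = bpure raL laQ l (raQ b q).
Proof. exact: (sweedler_bpure (raT_balanced b)). Qed.
Lemma raTD b : {morph raT b : x y / x + y}.
Proof. exact: (sweedlerD (raT_balanced b)). Qed.

Lemma raT_right_action : right_action raT.
Proof.
split=> [b|b c t|b c t|t]; first exact: raTD.
all: move: t; apply: btens_pure_ind => [l q|x y ex ey]; rewrite ?raTD ?ex ?ey ?raTE //.
- by rewrite (raDl aQ) bpureDr.
- by rewrite addrACA.
- by rewrite (raM aQ).
by rewrite (ra1 aQ).
Qed.

Definition comp_pure (l : L) (z : btens raQ la) : btens raT la :=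
  \Te_(q, a <- z) bpure raT la (bpure raL laQ l q) a.
Lemma comp_pure_balanced l :
  balanced raQ la (fun q (a : N) => bpure raT la (bpure raL laQ l q) a).
Proof.
split=> [q q' a|q a a'|b q a]; first by rewrite bpureDr bpureDl.
  exact: bpureDr.
by rewrite -raTE bpureM.
Qed.
Lemma comp_pureE l q (a : N) :
  comp_pure l (bpure raQ la q a) = bpure raT la (bpure raL laQ l q) a.
Proof. exact: (sweedler_bpure (comp_pure_balanced l)). Qed.
Lemma comp_pureD l : {morph comp_pure l : x y / x + y}.
Proof. exact: (sweedlerD (comp_pure_balanced l)). Qed.
Lemma comp_pureDl l l' z : comp_pure (l + l') z = comp_pure l z + comp_pure l' z.
Proof.
move: z; apply: btens_pure_ind => [q a|x y ex ey].
  by rewrite !comp_pureE !bpureDl.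
by rewrite !comp_pureD ex ey addrACA.
Qed.

Lemma laQ_tens_balanced b : balanced raQ la (fun q (a : N) => bpure raQ la (laQ b q) a).
Proof.
split=> [q q' a|q a a'|c q a]; first by rewrite laQD bpureDl.
  exact: bpureDr.
by rewrite laQ_raQ bpureM.
Qed.

Lemma comp_balanced : balanced raL laP (fun l p => comp_pure l (th p)).
Proof.
split=> [l l' p|l p p'|b l p]; first exact: comp_pureDl.
  by rewrite thD comp_pureD.
rewrite th_laP; move: (th p); apply: btens_pure_ind => [q a|x y ex ey].
  by rewrite (sweedler_bpure (laQ_tens_balanced b)) !comp_pureE bpureM.
by rewrite (sweedlerD (laQ_tens_balanced b)) !comp_pureD ex ey.
Qed.
Definition tcomp (t : LP) : btens raT la := \Te_(l, p <- t) comp_pure l (th p).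
Lemma tcompE l p : tcomp (bpure raL laP l p) = comp_pure l (th p).
Proof. exact: (sweedler_bpure comp_balanced). Qed.
Lemma tcompD : {morph tcomp : x y / x + y}.
Proof. exact: (sweedlerD comp_balanced). Qed.

Lemma tcomp_map t : tcomp (tens_map t) = bpure raT la t (aone : A).
Proof.
move: t; apply: btens_pure_ind => [l q|x y ex ey].
  by rewrite tens_mapE tcompE thj comp_pureE.
by rewrite tens_mapD tcompD ex ey bpureDl.
Qed.

Lemma tens_map_inj : injective tens_map.
Proof.
move=> x y /(congr1 tcomp); rewrite !tcomp_map.
exact: (tunit_inj A_flat raT_right_action).
Qed.
End TensorInjective.

(** * The isomorphisms of L (x)_B A with A (x) A and of L (x)_B (A (x) V) with A (x) (A (x) V) *)

Section Decomposition.
Variables (k : fieldType) (H : coquasiHopf k) (A : comoduleAlgebra H).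
Hypotheses (A_flat : left_faithfully_flat A) (A_galois : galois A).
Local Notation cA := (comodA A).
Local Notation AA := (cA \CX cA).
Local Notation ra := (tens_ract cA (rmodA A)).
Local Notation B := (coinv A).
Local Notation L := (twL A).
Local Notation N := (leftmod A).
Local Notation la := (fun (r : B) (n : N) => r *: n).
Local Notation raL := (fun (b : B) (l : L) => tgtL b * l).
Local Notation M2 := (tens_rmod cA (rmodA A)).
Local Notation M3 := (tens_rmod cA M2).
Local Notation LA := (btens raL la).

Lemma can_bij1 : bijective (@canT _ _ A (rmodA A)).
Proof. exact: galois_canT. Qed.
Lemma can_bij2 : bijective (@canT _ _ A M2).
Proof. exact/can_tens_bij/can_bij1. Qed.
Lemma can_bij3 : bijective (@canT _ _ A M3).
Proof. exact/can_tens_bij/can_bij2. Qed.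

Lemma raL_coact (b : B) (l : L) : tgtL b * l = coactB (M := M2) b l :> L.
Proof. by apply: lval_inj; rewrite lval_tgtM. Qed.

Lemma forget_balanced : balanced (@coactB _ _ A M2) la
  (fun (l : coinvs M2) (a : N) => bpure raL la (l : L) a).
Proof.
split=> [l l' a|l a a'|b l a]; [exact: bpureDl|exact: bpureDr|].
by rewrite -bpureM; congr bpure; rewrite raL_coact.
Qed.

(* The inverse of the isomorphism L (x)_B A -> A (x) A, l (x) a |-> la. *)
Definition theta (w : AA) : LA :=
  \Te_(l, a <- sval (cid (mu_surj A_flat can_bij2 w))) bpure raL la (l : L) a.

Lemma theta_pure (l : L) (a : cA) : theta (ra (lval l \ox a)) = bpure raL la l (a : A).
Proof.
rewrite /theta; case: cid => z /= ez.
have -> : z = bpure (@coactB _ _ A M2) la (l : coinvs M2) (a : N).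
  by apply: (mu_inj A_flat (bij_inj can_bij2)); rewrite ez muE.
exact: (sweedler_bpure forget_balanced).
Qed.

Lemma thetaD : {morph theta : x y / x + y}.
Proof.
move=> x y; rewrite /theta; case: cid => z /= ez; case: cid => u /= eu; case: cid => v /= ev.
have -> : z = u + v.
  by apply: (mu_inj A_flat (bij_inj can_bij2)); rewrite ez muD eu ev.
exact: (sweedlerD forget_balanced).
Qed.

(** Surjectivity of L (x)_B A -> A (x) A as an induction principle; it reduces claims on A (x) A to
    elements la with l coinvariant, where the associators involving l vanish. *)
Lemma AA_ind (P : AA -> Prop) : (forall l a, P (ra (lval l \ox a))) ->
  (forall x y, P x -> P y -> P (x + y)) -> forall w, P w.
Proof.
move=> Pp PD w; have [z <-] := mu_surj A_flat can_bij2 w.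
move: z; apply: btens_pure_ind => [l a|x y ex ey]; last by rewrite muD; apply: PD.
by rewrite muE; apply: Pp.
Qed.

Lemma lact_ra (b a : cA) (w : AA) : cinv b ->
  lact A cA (b \ox ra (w \ox a)) = ra (lact A cA (b \ox w) \ox a).
Proof. by move=> bc; have := bimod (b \ox w \ox a); rewrite tlE assoc1l // trE => ->. Qed.

Lemma srcM_balanced b : balanced raL la (fun (q : L) (a : N) => bpure raL la (srcL b * q) a).
Proof.
split=> [q q' a|q a a'|c q a]; first by rewrite mulrDr bpureDl.
  exact: bpureDr.
by rewrite -bpureM; congr bpure; rewrite !mulrA src_tgt_comm.
Qed.

Lemma theta_lact (b : B) w : theta (lact A cA ((b : A) \ox w)) =
  \Te_(q, a <- theta w) bpure raL la (srcL b * q) a.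
Proof.
move: w; apply: AA_ind => [l a|x y ex ey].
  rewrite lact_ra; last exact: cinv_coinv.
  by rewrite -lval_srcM !theta_pure (sweedler_bpure (srcM_balanced b)).
by rewrite puDr linearD !thetaD ex ey (sweedlerD (srcM_balanced b)).
Qed.

Section Kappa.
Variable V : comod H.
Definition laV (b : B) (w : cA \CX V) : cA \CX V := lact A V ((b : A) \ox w).
(* The product l.w of A (x) (A (x) V), in which the second factor of l acts on w. *)
Definition kap (l : AA) (w : cA \CX V) : cA \CX (cA \CX V) :=
  tr (lact A V) (assoc cA cA (cA \CX V) (l \ox w)).

Lemma assoc_ra (z : AA \OX cA \OX V) : assoc cA cA V (tl ra z) =
  tr (lact A V) (assoc cA cA (cA \CX V) (assoc AA cA V z)).
Proof.
rewrite (tl_comp _ (@ra_def _ _ A)) (assoc_nm (colin_mulA A)) (tr_comp _ (@lact_def _ _ A V)).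
by congr (tr _ _); rewrite -pentagon tr_can //; exact: assocK.
Qed.

(** Coinvariance of l removes one associator of the pentagon. Hence l (x) (c (x) v) |-> l.(c (x) v)
    amounts to the isomorphism of L (x)_B A with A (x) A, tensored with V, followed by the
    associator; this is why it is invertible. *)
Lemma kap_alt (l : L) (c : cA) (v : V) :
  kap (lval l) (c \ox v) = assoc cA cA V (ra (lval l \ox c) \ox v).
Proof.
rewrite /kap; have := assoc_ra (lval l \ox c \ox v).
by rewrite tlE [X in _ = tr _ (assoc _ _ _ X)]assoc1l ; [move=> <- | exact: lval_cinv].
Qed.

Lemma kap_cinv (x : AA) (w : cA \CX V) : cinv w ->
  kap x w = tr (lact A V \o pul cA w) x.
Proof.
move=> wc; move: x; apply: tens_eq => [||a c]; rewrite /kap; [mlin|mlin|].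
by rewrite assoc1r // !trE.
Qed.

Lemma colin_lact_pur (b : B) : @colin _ _ (cA \CX V) (cA \CX V) (lact A V \o pur _ (b : A)).
Proof.
apply: (@colin_comp _ _ _ (cA \CX (cA \CX V)) _ (pur (cA \CX V) (b : A)) (lact A V)) => //.
  exact/colin_pur/cinv_coinv.
exact: colin_lact.
Qed.

Lemma lact_lactB (b : B) (a : cA) (w : cA \CX V) :
  lact A V (a \ox lact A V ((b : A) \ox w)) = lact A V (mulA A (a \ox (b : A)) \ox w).
Proof.
have := lact_assoc (A := A) (W := V) (a \ox ((b : A) \ox w)); rewrite trE => ->.
by rewrite lact_cinvm //; exact: cinv_coinv.
Qed.

Lemma kap_tgt (b : B) (x : AA) (w : cA \CX V) :
  kap (ra (x \ox (b : A))) w = kap x (laV b w).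
Proof.
have bc := cinv_coinv b; move: x; apply: tens_eq => [||a c]; rewrite /kap; [mlin|mlin|].
rewrite ra_cinvr //.
have := assoc_nm (W := cA \CX V) (colin_mulr bc) (a \ox c \ox w).
have := assoc_nr (colin_lact_pur b) (a \ox c \ox w).
rewrite tlE !trE /= => -> ->; apply: eq_tr.
apply: tens_eq => [||c' w']; [mlin|mlin|].
by rewrite tlE trE; exact: (esym (lact_lactB b c' w')).
Qed.

Lemma kap_src (b : B) (x : AA) (w : cA \CX V) :
  kap (lact A cA ((b : A) \ox x)) w = lact A (cA \CX V) ((b : A) \ox kap x w).
Proof.
have bc := cinv_coinv b; move: x; apply: tens_eq => [||a c]; rewrite /kap; [mlin|mlin|].
rewrite lact_cinvl //.
have -> : assoc cA cA (cA \CX V) (mulA A ((b : A) \ox a) \ox c \ox w) =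
    tl (mulA A \o pur cA (b : A)) (assoc cA cA (cA \CX V) (a \ox c \ox w)).
  by rewrite -(assoc_nl (colin_mull bc)) !tlE.
rewrite -tl_tr.
elim/ot_ind : (tr _ _) => [u v|u v eu ev]; last by rewrite puDr !linearD eu ev.
by rewrite tlE lact_cinvl.
Qed.

Lemma kap_balanced : balanced raL laV (fun (l : L) w => kap (lval l) w).
Proof.
split=> [l l' w|l w w'|b l w]; rewrite /kap.
- by rewrite lvalD puDl !linearD.
- by rewrite puDr !linearD.
by have := kap_tgt b (lval l) w; rewrite /kap -lval_tgtM.
Qed.
Definition kapT (t : btens raL laV) : cA \CX (cA \CX V) := \Te_(l, w <- t) kap (lval l) w.
Lemma kapTE l w : kapT (bpure raL laV l w) = kap (lval l) w.
Proof. exact: (sweedler_bpure kap_balanced). Qed.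
Lemma kapTD : {morph kapT : x y / x + y}.
Proof. exact: (sweedlerD kap_balanced). Qed.

Definition insert (v : V) (z : LA) : btens raL laV :=
  \Te_(l, c <- z) bpure raL laV l ((c : cA) \ox v).
Lemma insert_balanced v :
  balanced raL la (fun l (c : N) => bpure raL laV l ((c : cA) \ox v)).
Proof.
split=> [l l' c|l c c'|b l c]; first exact: bpureDl.
  by rewrite puDl bpureDr.
rewrite bpureM /laV lact_cinvl //; exact: cinv_coinv.
Qed.
Lemma insertE v l (c : N) : insert v (bpure raL la l c) = bpure raL laV l ((c : cA) \ox v).
Proof. exact: (sweedler_bpure (insert_balanced v)). Qed.
Lemma insertD v : {morph insert v : x y / x + y}.
Proof. exact: (sweedlerD (insert_balanced v)). Qed.

Lemma kapV_balanced :
  @balanced AA V k *:%R *:%R (btens raL laV) (fun u v => insert v (theta u)).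
Proof.
split=> [u u' v|u v v'|c u v].
- by rewrite thetaD insertD.
- move: (theta u); apply: btens_pure_ind => [l a|x y ex ey].
    by rewrite !insertE puDr bpureDr.
  by rewrite !insertD ex ey addrACA.
move: u; apply: AA_ind => [l a|x y ex ey].
  by rewrite -linZ -puZr !theta_pure !insertE puZl puZr.
by rewrite scalerDr !thetaD !insertD ex ey.
Qed.

(** Reads [kap_alt] backwards: undo the associator, decompose the element of A (x) A by [theta], and
    attach v again to the A-component. *)
Definition kapV (p : cA \CX (cA \CX V)) : btens raL laV :=
  sweedler (associ cA cA V p : (AA \ot V)%type) (fun u v => insert v (theta u)).
Lemma kapVE u v : kapV (assoc cA cA V (u \ox v)) = insert v (theta u).
Proof. by rewrite /kapV assocK; apply: (sweedler_bpure kapV_balanced). Qed.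
Lemma kapVD : {morph kapV : x y / x + y}.
Proof. by move=> x y; rewrite /kapV linearD; apply: (sweedlerD kapV_balanced). Qed.

Lemma kapTK : cancel kapT kapV.
Proof.
apply: btens_pure_ind => [l w|x y ex ey]; last by rewrite kapTD kapVD ex ey.
rewrite kapTE; elim/ot_ind : w => [c v|x y ex ey].
  by rewrite kap_alt kapVE theta_pure insertE.
by rewrite bpureDr -ex -ey -kapVD; congr kapV; rewrite (balDr kap_balanced).
Qed.

Lemma AAV_ind (P : cA \CX (cA \CX V) -> Prop) : (forall l w, P (kap (lval l) w)) ->
  (forall x y, P x -> P y -> P (x + y)) -> forall p, P p.
Proof.
move=> Pp PD p; rewrite -[p](@associK _ _ cA cA V).
elim/ot_ind : (associ _ _ _ p) => [u v|x y ex ey]; last by rewrite linearD; apply: PD.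
move: u; apply: AA_ind => [l a|x y ex ey]; last by rewrite puDl linearD; apply: PD.
by rewrite -kap_alt; apply: Pp.
Qed.
End Kappa.
End Decomposition.

(** * The second and third tensor powers of L over B *)

Section Comultiplication.
Variables (k : fieldType) (H : coquasiHopf k) (A : comoduleAlgebra H).
Hypotheses (A_flat : left_faithfully_flat A) (A_galois : galois A).
Local Notation cA := (comodA A).
Local Notation AA := (cA \CX cA).
Local Notation ra := (tens_ract cA (rmodA A)).
Local Notation B := (coinv A).
Local Notation L := (twL A).
Local Notation N := (leftmod A).
Local Notation la := (fun (r : B) (n : N) => r *: n).
Local Notation t := (@tgtL _ _ A : {rmorphism B^c -> L}).
Local Notation raL := (fun (b : B) (l : L) => tgtL b * l).
Local Notation laL := (fun (b : B) (l : L) => srcL b * l).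
Local Notation LL := (btens raL laL).
Local Notation pLL := (bpure raL laL).

Lemma raL_right_action : right_action raL.
Proof.
split=> [b x y|b c x|b c x|x]; first exact: mulrDr.
- by rewrite -[tgtL (b + c)]/(t (b + c)) (raddfD t) mulrDl.
- by rewrite -[tgtL (b * c)]/(t ((c : B^c) * (b : B^c))) (rmorphM t) mulrA.
by rewrite -[tgtL 1]/(t 1) (rmorph1 t) mul1r.
Qed.

Lemma src_tgt (b c : B) (q : L) : srcL b * (tgtL c * q) = tgtL c * (srcL b * q).
Proof. by rewrite !mulrA; congr (_ * _); exact: src_tgt_comm. Qed.

Lemma theta_lval (q : L) : theta A_flat A_galois (lval q) = bpure raL la q (aone : A).
Proof. by rewrite -theta_pure [ra _]tens_ract1. Qed.

Definition LL_incl (z : LL) : btens raL (@laV _ _ A cA) := tens_map (@laV _ _ A cA) (@lval _ _ A) z.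

Lemma lval_lact (b : B) (q : L) : lval (srcL b * q) = laV b (lval q).
Proof. exact: lval_srcM. Qed.

Lemma laL_D (b : B) : {morph (fun q : L => srcL b * q) : x y / x + y}.
Proof. exact: mulrDr. Qed.

Lemma LL_incl_inj : injective LL_incl.
Proof.
exact: (tens_map_inj A_flat raL_right_action laL_D src_tgt (@lvalD _ _ A) lval_lact
  (thetaD A_flat A_galois) (theta_lact A_flat A_galois) theta_lval).
Qed.

Lemma LL_inclE x y : LL_incl (pLL x y) = bpure raL (@laV _ _ A cA) x (lval y).
Proof. exact: (tens_mapE _ (@lvalD _ _ A) lval_lact). Qed.
Lemma LL_inclD : {morph LL_incl : x y / x + y}.
Proof. exact: (tens_mapD (@lvalD _ _ A) lval_lact). Qed.

(* L (x)_B L -> A (x) A (x) A, given by (a (x) c) (x) (d (x) e) |-> a (x) cd (x) e up to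
   associativity constraints. *)
Definition Psi (z : LL) : cA \CX AA := kapT (LL_incl z).

Lemma Psi_inj : injective Psi.
Proof.
by move=> x y /(can_inj (kapTK A_flat A_galois (V := cA))); apply: LL_incl_inj.
Qed.
Lemma PsiE x y : Psi (pLL x y) = kap (lval x) (lval y).
Proof. by rewrite /Psi LL_inclE kapTE. Qed.
Lemma PsiD : {morph Psi : x y / x + y}.
Proof. by move=> x y; rewrite /Psi LL_inclD kapTD. Qed.

Definition lactLL (b : B) (z : LL) : LL := \Te_(x, y <- z) pLL (srcL b * x) y.
Lemma lactLL_balanced b : balanced raL laL (fun x y => pLL (srcL b * x) y).
Proof.
split=> [x x' y|x y y'|c x y]; first by rewrite mulrDr bpureDl.
  exact: bpureDr.
by rewrite src_tgt bpureM.
Qed.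
Lemma lactLLE b x y : lactLL b (pLL x y) = pLL (srcL b * x) y.
Proof. exact: (sweedler_bpure (lactLL_balanced b)). Qed.
Lemma lactLLD b : {morph lactLL b : x y / x + y}.
Proof. exact: (sweedlerD (lactLL_balanced b)). Qed.

Local Notation ractLL := (@raT k H A L L raL laL raL).
Lemma ractLLE b x y : ractLL b (pLL x y) = pLL x (tgtL b * y).
Proof. exact: (raTE _ raL_right_action src_tgt). Qed.
Lemma ractLLD b : {morph ractLL b : x y / x + y}.
Proof. exact: (raTD raL_right_action src_tgt). Qed.

Lemma lactLL_ractLL b c z : lactLL b (ractLL c z) = ractLL c (lactLL b z).
Proof.
move: z; apply: btens_pure_ind => [x y|x y ex ey].
  by rewrite ractLLE !lactLLE ractLLE.
by rewrite ractLLD !lactLLD ex ey ractLLD.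
Qed.

Lemma Psi_lact b z : Psi (lactLL b z) = laV b (Psi z).
Proof.
move: z; apply: btens_pure_ind => [x y|x y ex ey].
  by rewrite lactLLE !PsiE lval_srcM kap_src.
by rewrite lactLLD !PsiD ex ey /laV puDr linearD.
Qed.

Local Notation tcompL := (@tcomp k H A L L AA raL laL (@laV _ _ A cA) raL (theta A_flat A_galois)).
Lemma tcompLE l w : tcompL (bpure raL (@laV _ _ A cA) l w) =
  @comp_pure k H A L L raL laL raL l (theta A_flat A_galois w).
Proof.
exact: (tcompE _ raL_right_action laL_D src_tgt (thetaD A_flat A_galois)
  (theta_lact A_flat A_galois)).
Qed.
Lemma tcompLD : {morph tcompL : x y / x + y}.
Proof.
exact: (tcompD raL_right_action laL_D src_tgt (thetaD A_flat A_galois)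
  (theta_lact A_flat A_galois)).
Qed.

(** The passage from A (x) A (x) A through L (x)_B (A (x) A) and L (x)_B (L (x)_B A) to (L (x)_B L)
    (x)_B A. It factors the unit of L (x)_B L, which embeds the third power of L, and it yields the
    surjectivity of [Psi] onto the coinvariants. *)
Definition theta2 (p : cA \CX AA) := tcompL (kapV A_flat A_galois p).

Lemma theta2D : {morph theta2 : x y / x + y}.
Proof. by move=> x y; rewrite /theta2 kapVD tcompLD. Qed.

Lemma theta2_kap l w : theta2 (kap (lval l) w) = @comp_pure k H A L L raL laL raL l (theta A_flat A_galois w).
Proof. by rewrite /theta2 -kapTE kapTK tcompLE. Qed.

Lemma theta2_Psi z : theta2 (Psi z) = bpure ractLL la z (aone : A).
Proof.
rewrite /theta2 /Psi kapTK.
exact: (tcomp_map raL_right_action laL_D src_tgt (@lvalD _ _ A) lval_lact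
  (thetaD A_flat A_galois) (theta_lact A_flat A_galois) theta_lval).
Qed.

Lemma lactLLA_balanced b : balanced ractLL la (fun z (a : N) => bpure ractLL la (lactLL b z) a).
Proof.
split=> [z z' a|z a a'|c z a]; first by rewrite lactLLD bpureDl.
  exact: bpureDr.
by rewrite lactLL_ractLL bpureM.
Qed.

Lemma comp_pureLE l x (a : N) : @comp_pure k H A L L raL laL raL l (bpure raL la x a) =
  bpure ractLL la (pLL l x) a.
Proof. exact: (comp_pureE _ raL_right_action src_tgt). Qed.
Lemma comp_pureLD l : {morph @comp_pure k H A L L raL laL raL l : x y / x + y}.
Proof. exact: (comp_pureD _ raL_right_action src_tgt). Qed.

Lemma theta2_lact b p : theta2 (laV b p) =
  \Te_(z, a <- theta2 p) bpure ractLL la (lactLL b z) a.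
Proof.
move: p; apply: (AAV_ind A_flat A_galois) => [l w|x y ex ey].
  rewrite -[laV b _]kap_src -lval_srcM !theta2_kap.
  move: (theta _ _ w); apply: btens_pure_ind => [x a|x y ex ey].
    by rewrite !comp_pureLE (sweedler_bpure (lactLLA_balanced b)) lactLLE.
  by rewrite !comp_pureLD ex ey (sweedlerD (lactLLA_balanced b)).
by rewrite /laV puDr linearD !theta2D ex ey (sweedlerD (lactLLA_balanced b)).
Qed.

Local Notation LLL := (btens raL lactLL).

Lemma LL_right_action : right_action ractLL.
Proof. exact: (raT_right_action raL raL_right_action src_tgt). Qed.

Definition LLL_incl (z : LLL) : btens raL (@laV _ _ A AA) := tens_map (@laV _ _ A AA) Psi z.
Lemma LLL_incl_inj : injective LLL_incl.
Proof.
exact: (tens_map_inj A_flat LL_right_action lactLLD lactLL_ractLL PsiD Psi_lact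
  theta2D theta2_lact theta2_Psi).
Qed.
Lemma LLL_inclE x z : LLL_incl (bpure raL lactLL x z) = bpure raL (@laV _ _ A AA) x (Psi z).
Proof. exact: (tens_mapE _ PsiD Psi_lact). Qed.
Lemma LLL_inclD : {morph LLL_incl : x y / x + y}.
Proof. exact: (tens_mapD PsiD Psi_lact). Qed.

Definition Psi3 (z : LLL) : cA \CX (cA \CX AA) := kapT (LLL_incl z).
Lemma Psi3_inj : injective Psi3.
Proof.
by move=> x y /(can_inj (kapTK A_flat A_galois (V := AA))); apply: LLL_incl_inj.
Qed.
Lemma Psi3E x z : Psi3 (bpure raL lactLL x z) = kap (lval x) (Psi z).
Proof. by rewrite /Psi3 LLL_inclE kapTE. Qed.
Lemma Psi3D : {morph Psi3 : x y / x + y}.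
Proof. by move=> x y; rewrite /Psi3 LLL_inclD kapTD. Qed.
End Comultiplication.

(** * The bialgebroid structure *)

Section KappaTheory.
Variables (k : fieldType) (H : coquasiHopf k) (A : comoduleAlgebra H).
Local Notation cA := (comodA A).
Local Notation AA := (cA \CX cA).
Local Notation m := (mulA A).
Local Notation ra := (tens_ract cA (rmodA A)).
Local Notation M2 := (tens_rmod cA (rmodA A)).
Local Notation ra3 := (tens_ract cA M2).
Local Notation L := (twL A).
Implicit Types x y : L.

(** As y is coinvariant no associator remains: the product just applies c |-> cy to the second
    factor of x. Most computations with [Psi] below start from this form. *)
Lemma kap_lam (x : AA) y : kap x (lval y) = tr (lam (lval y)) x.
Proof. exact/kap_cinv/lval_cinv. Qed.

Lemma cinv_kap x y : cinv (kap (lval x) (lval y) : cA \CX AA).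
Proof.
rewrite kap_lam; apply: cinv_map; last exact: lval_cinv.
exact/(@colin_tr _ _ cA cA AA)/colin_lam/lval_cinv.
Qed.

Lemma kap_nat (V W : comod H) (f : {linear V -> W}) (x : AA) (w : cA \CX V) : colin f ->
  kap x (tr f w) = tr (tr f) (kap x w).
Proof.
move=> fc; rewrite /kap; have fc' := @colin_tr _ _ cA _ _ _ fc.
have := assoc_nr fc' (x \ox w); rewrite trE => ->.
by apply: eq_tr => u; rewrite lact_nat.
Qed.

Lemma kap_ra x y (a : cA) :
  ra3 (kap (lval x) (lval y) \ox a) = kap (lval x) (ra (lval y \ox a)).
Proof.
have yc := lval_cinv y; rewrite kap_lam; move: (lval x).
apply: tens_eq => [||e f]; rewrite /kap; [mlin|mlin|].
rewrite trE -[LHS]/(tr ra (assoc cA AA cA (e \ox lam (lval y) f \ox a))).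
have := assoc_nm (U := cA) (W := cA) (colin_lam yc) (e \ox f \ox a).
rewrite tlE trE => ->.
have := assoc_nr (U := cA) (V := cA) (colin_xi yc) (e \ox f \ox a).
rewrite trE => ->; apply: eq_tr; apply: tens_eq => [||f' a']; [mlin|mlin|].
rewrite tlE trE lamE xiE.
by have := bimod (f' \ox lval y \ox a'); rewrite tlE assoc1m // trE.
Qed.

Definition ins1 : {linear AA -> cA \CX AA} := tr (pur cA (aone : cA)).
Lemma ins1E (a b : cA) : ins1 (a \ox b) = a \ox (aone \ox b).
Proof. exact: trE. Qed.

Lemma colin_ins1 : @colin _ _ AA (cA \CX AA) ins1.
Proof. exact/(@colin_tr _ _ cA cA AA)/colin_pur/cinv_one. Qed.

Lemma ins1_lact (t : cA \OX AA) : lact A AA (tr ins1 t) = ins1 (lact A cA t).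
Proof. exact/lact_nat/(@colin_pur _ _ cA cA)/cinv_one. Qed.

Lemma ins1_ra (t : AA \OX cA) : ra3 (tl ins1 t) = ins1 (ra t).
Proof.
rewrite -[LHS]/(tr ra (assoc cA AA cA (tl ins1 t))).
rewrite (assoc_nm (@colin_pur _ _ cA cA _ (cinv_one A))) ra_def.
apply: eq_tr; apply: tens_eq => [||d b]; [mlin|mlin|].
by rewrite tlE [LHS]ra_cinvl //; exact: cinv_one.
Qed.

Lemma mulA_ra (t : AA \OX cA) : m (ra t) = m (tl m t).
Proof. by rewrite ra_def mulA_assoc. Qed.

(** Multiplication A (x) A -> A respects both actions, so its value at a(yc) depends on y only
    through its value at y. Both counit axioms for products follow, since y, s(epsilon(y)) and
    t(epsilon(y)) have the same image. *)
Lemma mulA_Tw (x : AA) (y y' : AA) : m y = m y' -> m (Tw y x) = m (Tw y' x).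
Proof.
move=> e; move: x; apply: tens_eq => [||a c]; [mlin|mlin|].
by rewrite !TwE !mulA_lact !trE !mulA_ra !tlE e.
Qed.

Definition lactkap (x : AA) : {linear cA \OX AA -> cA \CX AA} :=
  lact A AA \o tr (tr (lact A cA) \o assoc cA cA AA \o pur AA x).
Lemma lactkapE (x : AA) a w : lactkap x (a \ox w) = lact A AA (a \ox kap x w).
Proof. by rewrite -[LHS]/(lact A AA (tr _ (a \ox w))) trE. Qed.

(** The image of xx' (x) yy' is an additive function of the image of x (x) y. This makes the
    factorwise product with Delta(l) computable from the image of Delta(l) alone. *)
Lemma kap_Tw x y x' y' : kap (Tw (lval x') (lval x)) (lval (y * y')) =
  tr (Tw (lval y')) (lactkap (lval x') (kap (lval x) (lval y))).
Proof.
have yc := lval_cinv y; rewrite !kap_lam.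
rewrite (tr_comp (f := lam (lval y)) (g := Tw (lval y'))); last first.
  by move=> c; rewrite lamE lvalM lamE Tw_lact ?trE //; exact: lval_cinv.
congr (tr _ _); move: (lval x); apply: tens_eq => [||a c]; [mlin|mlin|].
rewrite TwE trE lactkapE.
have := lact_nat (A := A) (W := cA) (W' := AA) (lam (lval y)) (a \ox ra (lval x' \ox c)) (colin_lam yc).
rewrite trE => <-; congr (lact _ _ (_ \ox _)); rewrite /kap.
have := assoc_nr (colin_lam yc) (lval x' \ox c); rewrite trE => ->.
by rewrite ra_def; apply: eq_tr; apply: tens_eq => [||a' b']; [mlin|mlin|rewrite trE lam_mul].
Qed.

Lemma Tw_kap x y' (w : AA) : tr (Tw (lval y')) (kap (lval x) w) =
  kap (lval x) (Tw (lval y') w).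
Proof.
have yc := lval_cinv y'; rewrite /kap.
have := assoc_nr (U := cA) (V := cA) (colin_Tw yc) (lval x \ox w); rewrite trE => ->.
by apply: eq_tr => v; rewrite Tw_lact.
Qed.

(** The analogue of [Tw] with values in A (x) A (x) A: 1 (x) 1 is sent to p and a (x) b to a(pb). *)
Definition bimod3 (l : AA) (p : cA \CX AA) : cA \CX AA := lact A AA (tr (ra3 \o pur cA p) l).

Lemma bimod3E a b p : bimod3 (a \ox b) p = lact A AA (a \ox ra3 (p \ox b)).
Proof. by rewrite /bimod3 trE. Qed.

Lemma bimod3D l : {morph bimod3 l : p q / p + q}.
Proof.
move=> p q; elim/ot_ind : l => [a b|x y ex ey]; first by rewrite !bimod3E puDl linearD puDr linearD.
by rewrite /bimod3 !linearD -!/(bimod3 _ _) ex ey addrACA.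
Qed.

Lemma bimod3_kap (l : AA) x' y' :
  tr (Tw (lval y')) (lactkap (lval x') (ins1 l)) = bimod3 l (kap (lval x') (lval y')).
Proof.
move: l; apply: tens_eq => [||a b]; rewrite /bimod3; [mlin|mlin|].
rewrite trE ins1E lactkapE.
have := lact_nat (A := A) (W := AA) (W' := AA) (Tw (lval y'))
  (a \ox kap (lval x') (aone \ox b)) (colin_Tw (lval_cinv y')).
rewrite trE => <-; rewrite Tw_kap TwE lact1 -kap_ra //.
Qed.

(** Inserting 1 in the middle commutes with both actions of A; this is the multiplicativity of
    Delta, seen in A (x) A (x) A. *)
Lemma bimod3_ins1 (l l' : AA) : bimod3 l (ins1 l') = ins1 (Tw l' l).
Proof.
move: l; apply: tens_eq => [||a b]; rewrite /bimod3; [mlin|mlin|].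
rewrite trE TwE -ins1_lact trE; congr (lact _ _ (_ \ox _)).
by rewrite -ins1_ra tlE.
Qed.
End KappaTheory.

(** F is not assumed balanced: the sum runs over a chosen decomposition of t, and the additive g
    absorbs the choice. Sums over Delta(l), whose terms are unknown, are thus evaluated through the
    image of Delta(l) under [Psi]. *)
Lemma sweedler_factor (M N V U : zmodType) I ra la (t : @btens M N I ra la) (F : M -> N -> V)
    (h : V -> U) (g : @btens M N I ra la -> U) :
  {morph h : x y / x + y} -> {morph g : x y / x + y} ->
  (forall x y, h (F x y) = g (bpure ra la x y)) -> h (sweedler t F) = g t.
Proof.
move=> hD gD e; rewrite -[in RHS](reprK t) -/(btens_class _ _ _) btens_classE.
rewrite (big_morph g gD (morph_add0 gD)) [LHS](big_morph h hD (morph_add0 hD)).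
by apply: eq_bigr => p _; rewrite e.
Qed.

Arguments sweedler_factor {M N V U I ra la t F} h g.

Section Bialgebroid.
Variables (k : fieldType) (H : coquasiHopf k) (A : comoduleAlgebra H).
Hypotheses (A_flat : left_faithfully_flat A) (A_galois : galois A).
Local Notation cA := (comodA A).
Local Notation AA := (cA \CX cA).
Local Notation m := (mulA A).
Local Notation B := (coinv A).
Local Notation L := (twL A).
Local Notation raL := (fun (b : B) (l : L) => tgtL b * l).
Local Notation laL := (fun (b : B) (l : L) => srcL b * l).
Local Notation M2 := (tens_rmod cA (rmodA A)).
Local Notation M3 := (tens_rmod cA M2).
Local Notation ra3 := (tens_ract cA M2).
Local Notation LL := (btens raL laL).
Local Notation pLL := (bpure raL laL).
Local Notation pLLL := (bpure raL (@lactLL _ _ A)).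
Local Notation ractLL := (@raT k H A L L raL laL raL).

Lemma cinv_Psi (z : LL) : cinv (Psi z : M3).
Proof.
move: z; apply: btens_pure_ind => [x y|x y ex ey]; first by rewrite PsiE; apply: cinv_kap.
by rewrite PsiD /cinv linearD ex ey puDl.
Qed.

Definition Psi_coinvs (z : LL) : coinvs M3 := coinvs_of (cinv_Psi z).

Lemma Psi_ract b z : Psi (ractLL b z) = ra3 (Psi z \ox (b : A)).
Proof.
move: z; apply: btens_pure_ind => [x y|x y ex ey].
  by rewrite ractLLE !PsiE lval_tgtM kap_ra.
by rewrite ractLLD !PsiD ex ey puDl linearD.
Qed.

Lemma Psi_coinvs_radditive : radditive ractLL (@coactB _ _ A M3) Psi_coinvs.
Proof.
split=> [x y|b x]; apply: cval_inj; first by rewrite cvalD; apply: PsiD.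
exact: Psi_ract.
Qed.

(** By faithful flatness surjectivity may be tested after tensoring with A. There the target is A
    (x) A (x) A through [mu], and [theta2] provides preimages; the check on generators uses
    injectivity of [mu]. *)
Lemma Psi_coinvs_surj (w : coinvs M3) : exists z, Psi_coinvs z = w.
Proof.
move: w; apply/(ff_surj A_flat (LL_right_action A) (coactB_right_action M3)
  Psi_coinvs_radditive) => u.
have D := tensor_mapD Psi_coinvs_radditive.
exists (theta2 A_flat A_galois (mu u)).
apply: (mu_inj A_flat (bij_inj (can_bij3 A_galois))).
move: (mu u); apply: (AAV_ind A_flat A_galois) => [l w|x y ex ey]; last first.
  by rewrite theta2D D muD ex ey.
rewrite theta2_kap; move: w; apply: (AA_ind A_flat A_galois) => [y a|x y ex ey].
  rewrite theta_pure comp_pureLE (tensor_mapE Psi_coinvs_radditive) muE.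
  by rewrite -kap_ra -PsiE.
by rewrite thetaD comp_pureLD D muD ex ey /kap puDr !linearD.
Qed.

Lemma Psi_ins1 (l : L) : exists z, Psi z = ins1 A (lval l).
Proof.
have lc : cinv (ins1 A (lval l) : M3).
  exact: (cinv_map (@colin_ins1 _ _ A) (lval_cinv l)).
by have [z /(congr1 (@cval _ _ M3)) e] := Psi_coinvs_surj (coinvs_of lc); exists z.
Qed.

(** A chosen preimage under [Psi]; the choice is immaterial because [Psi] is injective. *)
Definition twDelta (l : L) : LL := sval (cid (Psi_ins1 l)).
Lemma Psi_Delta l : Psi (twDelta l) = ins1 A (lval l).
Proof. exact: (svalP (cid (Psi_ins1 l))). Qed.

Let Psi_inj := @Psi_inj _ _ A A_flat A_galois.
Let Psi3_inj := @Psi3_inj _ _ A A_flat A_galois.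

Lemma twDelta_add : {morph twDelta : x y / x + y}.
Proof. by move=> x y; apply: Psi_inj; rewrite PsiD !Psi_Delta lvalD linearD. Qed.

Lemma twEps_subproof (l : L) : m (lval l) \in @coinvariant _ _ A.
Proof. exact/coinvariantP/(cinv_map (colin_mulA A) (lval_cinv l)). Qed.
Definition twEps (l : L) : B := Coinv (twEps_subproof l).
Lemma twEps_val l : (twEps l : A) = m (lval l). Proof. by []. Qed.
Lemma twEps_add : {morph twEps : x y / x + y}.
Proof.
by move=> x y; apply: val_inj; rewrite [RHS]coinvD -[LHS]/(m (lval (x + y))) lvalD linearD.
Qed.

Lemma twDelta_bimod b c l :
  twDelta (srcL b * tgtL c * l) = lactLL b (ractLL c (twDelta l)).
Proof.
apply: Psi_inj; rewrite Psi_lact Psi_ract !Psi_Delta -mulrA lval_srcM lval_tgtM.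
by rewrite -ins1_lact trE /laV -ins1_ra tlE.
Qed.

Lemma twEps_bimod b c l : twEps (srcL b * tgtL c * l) = b * twEps l * c.
Proof.
apply: val_inj; rewrite -[LHS]/(m (lval (srcL b * tgtL c * l))) -mulrA lval_srcM lval_tgtM mulA_lact trE mulA_ra tlE.
by rewrite -[RHS]/(m (m ((b : A) \ox m (lval l)) \ox (c : A))) mulA_cinvm //; apply: (cinv_map (colin_mulA A) (lval_cinv l)).
Qed.

Lemma twDelta_coassoc l :
  \Te_(x, y <- twDelta l) pLLL x (twDelta y) =
  \Te_(x, y <- twDelta l) \Te_(x1, x2 <- twDelta x) pLLL x1 (pLL x2 y).
Proof.
have oc := cinv_one A; have pc := colin_pur oc (V := cA); have pc' := colin_pur oc (V := AA).
apply: Psi3_inj.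
(* In the fourth tensor power of A, the left side inserts a second 1 behind the first one and the
   right side inserts it in front; for l = a (x) d both give a (x) 1 (x) 1 (x) d. *)
rewrite (sweedler_factor (@Psi3 _ _ A) (fun z => tr (ins1 A) (Psi z))).
- rewrite (sweedler_factor (@Psi3 _ _ A) (fun z => tr (pur AA (aone : cA)) (Psi z))).
  + rewrite Psi_Delta; elim/ot_ind : (lval l) => [a d|x y ex ey]; last by rewrite !linearD ex ey.
    by rewrite ins1E !trE.
  + exact: Psi3D.
  + by move=> x y; rewrite PsiD linearD.
  move=> x y; rewrite (sweedler_factor (@Psi3 _ _ A) (fun z => tr (tr (lam (lval y))) (Psi z))).
  + rewrite Psi_Delta PsiE kap_lam; elim/ot_ind : (lval x) => [a d|u v eu ev].
      by rewrite ins1E !trE.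
    by rewrite !linearD eu ev.
  + exact: Psi3D.
  + by move=> u v; rewrite PsiD linearD.
  by move=> x1 x2; rewrite Psi3E !PsiE kap_lam kap_nat //; exact/colin_lam/lval_cinv.
- exact: Psi3D.
- by move=> x y; rewrite PsiD linearD.
by move=> x y; rewrite Psi3E Psi_Delta PsiE kap_nat.
Qed.

(** Under [Psi] the left side multiplies the first two factors of A (x) A (x) A, which removes the
    inserted 1. The right counit law multiplies the last two factors. *)
Lemma twEps_counitl l : \Te_(x, y <- twDelta l) (srcL (twEps x) * y) = l.
Proof.
apply: lval_inj; rewrite (sweedler_factor (@lval _ _ A) (fun z => lact A cA (Psi z))).
- rewrite Psi_Delta; elim/ot_ind : (lval l) => [a d|x y ex ey]; last by rewrite !linearD ex ey.
  by rewrite ins1E lact_cinvm ?mulA1 //; exact: cinv_one.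
- exact: lvalD.
- by move=> x y; rewrite PsiD linearD.
move=> x y; rewrite lval_srcM twEps_val PsiE kap_lam.
elim/ot_ind : (lval x) => [a c|u v eu ev]; last by rewrite !linearD puDl linearD eu ev.
by rewrite trE -lam_mul //; exact: lval_cinv.
Qed.

Lemma twEps_counitr l : \Te_(x, y <- twDelta l) (tgtL (twEps y) * x) = l.
Proof.
apply: lval_inj; rewrite (sweedler_factor (@lval _ _ A) (fun z => tr m (Psi z))).
- rewrite Psi_Delta; elim/ot_ind : (lval l) => [a d|x y ex ey]; last by rewrite !linearD ex ey.
  by rewrite ins1E trE mul1A.
- exact: lvalD.
- by move=> x y; rewrite PsiD linearD.
move=> x y; rewrite lval_tgtM twEps_val PsiE kap_lam.
elim/ot_ind : (lval x) => [a c|u v eu ev]; last by rewrite puDl !linearD eu ev.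
rewrite !trE lamE mulA_lact trE ra_cinvr //.
exact: (cinv_map (colin_mulA A) (lval_cinv y)).
Qed.

(** Seen in A (x) A (x) A, the left side multiplies the middle factor by b from the left and the
    right side from the right. In Delta(l) the middle factor is 1, so both put b there. *)
Lemma twDelta_takeuchi l (b : B) :
  \Te_(x, y <- twDelta l) pLL (x * tgtL b) y = \Te_(x, y <- twDelta l) pLL x (y * srcL b).
Proof.
have bc := cinv_coinv b.
apply: Psi_inj; rewrite (sweedler_factor (@Psi _ _ A) (fun z => tr (lact A cA \o pur AA (b : cA)) (Psi z))).
- rewrite (sweedler_factor (@Psi _ _ A) (fun z => tr (tl (m \o pul cA (b : cA))) (Psi z))).
  + rewrite Psi_Delta; elim/ot_ind : (lval l) => [a d|x y ex ey]; last by rewrite !linearD ex ey.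
    rewrite ins1E !trE tlE; congr (_ \ox _).
    rewrite -[LHS]/(lact A cA ((b : cA) \ox (aone \ox d))) lact_cinvl // mulA1.
    by rewrite -[RHS]/(m (aone \ox (b : cA)) \ox d) mul1A.
  + exact: PsiD.
  + by move=> x y; rewrite PsiD linearD.
  move=> x y; rewrite !PsiE kap_lam.
  rewrite !kap_lam lval_Msrc; elim/ot_ind : (lval x) => [a c|u v eu ev]; last by rewrite !linearD eu ev.
  rewrite !trE !lamE; congr (_ \ox _); elim/ot_ind : (lval y) => [d e|u v eu ev]; last first.
    by rewrite linearD puDr linearD eu ev puDr !linearD.
  rewrite tlE; have := associ_nm (U := cA) (W := cA) (colin_mulr bc) (c \ox (d \ox e)).
  rewrite trE tlE !lact_def => ->; elim/ot_ind : (associ _ _ _ _) => [u v|u v eu ev].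
    elim/ot_ind : u => [u w|u u' eu eu']; last by rewrite puDl !linearD eu eu'.
    rewrite !tlE trE; congr (_ \ox _); symmetry.
    have := mulA_assoc (u \ox w \ox (b : cA)); rewrite tlE assoc1r // trE.
    by [].
  by rewrite !linearD eu ev.
- exact: PsiD.
- by move=> x y; rewrite PsiD linearD.
move=> x y; rewrite !PsiE !kap_lam lval_Mtgt.
elim/ot_ind : (lval x) => [a c|u v eu ev]; last by rewrite !linearD eu ev.
rewrite !trE; congr (_ \ox _).
exact: (lam_mul (lval_cinv y) (b : cA) c).
Qed.

Lemma twDelta1 : twDelta 1 = pLL 1 1.
Proof.
have oc := cinv_one A; apply: Psi_inj; rewrite Psi_Delta PsiE kap_lam.
by rewrite !lval_one ins1E trE lamE lact1.
Qed.

Lemma twDeltaM l l' : twDelta (l * l') =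
  \Te_(x', y' <- twDelta l') \Te_(x, y <- twDelta l) pLL (x * x') (y * y').
Proof.
(* The outer sum over Delta(l') is replaced by its image first; the inner sum over Delta(l) is then
   evaluated for fixed x' and y' by [kap_Tw] and [bimod3_kap]. *)
apply: Psi_inj; rewrite (sweedler_factor (@Psi _ _ A) (fun z => bimod3 (lval l) (Psi z))).
- by rewrite !Psi_Delta bimod3_ins1.
- exact: PsiD.
- by move=> x y; rewrite PsiD bimod3D.
move=> x' y'; rewrite (sweedler_factor (@Psi _ _ A) (fun z => tr (Tw (lval y')) (lactkap (lval x') (Psi z)))).
- by rewrite Psi_Delta PsiE bimod3_kap.
- exact: PsiD.
- by move=> x y; rewrite PsiD !linearD.
by move=> x y; rewrite !PsiE -kap_Tw.
Qed.

Lemma twEps1 : twEps 1 = 1.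
Proof. by apply: val_inj; rewrite -[LHS]/(m (lval 1)) lval_one mulA1. Qed.

Lemma twEpsMs x y : twEps (x * y) = twEps (x * srcL (twEps y)).
Proof. by apply: val_inj; apply: mulA_Tw; rewrite lval_src mulA1. Qed.

Lemma twEpsMt x y : twEps (x * y) = twEps (x * tgtL (twEps y)).
Proof. by apply: val_inj; apply: mulA_Tw; rewrite lval_tgt mul1A. Qed.
End Bialgebroid.

Theorem mainTheorem7 (k : fieldType) (H : coquasiHopf k) (A : comoduleAlgebra H)
    (S_bij : bijective (antipode : H -> H))
    (A_flat : left_faithfully_flat A) (A_galois : galois A) :
  exists (L : pzRingType) (iota : {additive L -> (A \ot A)%type}),
    twisted_coinv_ring iota /\
    exists (s : {rmorphism coinv A -> L}) (t : {rmorphism (coinv A)^c -> L}),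
      [/\ forall b : coinv A, iota (s b) = (b : A) \ot aone,
          forall b : coinv A, iota (t b) = aone \ot (b : A) &
          left_bialgebroid s t].
Proof.
pose s : {rmorphism coinv A -> twL A} := @srcL _ _ A.
pose t : {rmorphism (coinv A)^c -> twL A} := @tgtL _ _ A.
have DB : additive (twDelta A_flat A_galois : twL A -> tensL s t).
  by move=> x y; rewrite twDelta_add (morph_addN (twDelta_add A_flat A_galois)).
have eB : additive (@twEps _ _ A).
  by move=> x y; rewrite twEps_add (morph_addN (@twEps_add _ _ A)).
pose Delta0 : twL A -> tensL s t := twDelta A_flat A_galois.
pose eps0 : twL A -> coinv A := @twEps _ _ A.
pose D : {additive twL A -> tensL s t} := HB.pack Delta0 (GRing.isAdditive.Build _ _ Delta0 DB).
pose e : {additive twL A -> coinv A} := HB.pack eps0 (GRing.isAdditive.Build _ _ eps0 eB).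
exists (twL A), (@iotaL _ _ A : {additive twL A -> (A \ot A)%type}).
split; first exact: twL_ring.
exists s, t; split=> //; split; first exact: src_tgt_comm.
exists D, e; split.
- exact: twDelta_bimod.
- exact: twEps_bimod.
- exact: twDelta_coassoc.
- exact: twEps_counitl.
- exact: twEps_counitr.
- exact: twDelta_takeuchi.
- exact: twDelta1.
- exact: twDeltaM.
- exact: twEps1.
- exact: twEpsMs.
exact: twEpsMt.
Qed.
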